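(* Let $(V,m)$ be a cyclic involutive $A_\infty$-algebra over $k$. Let $\mathfrak g=\mathrm{Der}^{\mathrm{cycl}}_+(\widehat T_{\ge 1}\Sigma^{-1}V^* )$, regarded as a differential graded Lie algebra with the commutator bracket and differential $d(\xi)=[m,\xi]$. Then there is an equivalence of functors $\mathrm{Def}_{\mathfrak g}\simeq\mathrm{Def}_{(V,m)}$ from augmented formal commutative algebras to sets, where $\mathrm{Def}_{\mathfrak g}$ is the Maurer--Cartan deformation functor of $\mathfrak g$ and $\mathrm{Def}_{(V,m)}$ is the functor of equivalence classes of cyclic involutive deformations of $(V,m)$. If moreover the bilinear form on $V$ is non-degenerate of degree $d$, then $\mathfrak g\cong\Sigma^{d+1}\mathrm{CD}^\bullet_+(V)_{\ge1}$ (as complexes).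
   Context: **Graded spaces.** $k$ is a field of characteristic zero. Graded vector spaces are $\mathbb Z$-graded over $k$ (cohomological grading) with the Koszul sign rule; $|x|$ is the degree of $x$. $\Sigma k$ is $k$ in degree $-1$, $\Sigma^{-1}k$ is $k$ in degree $1$, and $\Sigma^{n}V=\Sigma^n k\otimes V$. A formal graded vector space is an inverse limit of finite dimensional graded vector spaces with the inverse limit topology; all maps between formal spaces are continuous and tensor products of formal spaces are completed. For a (discrete) graded space $V=\varinjlim V_i$, $V_i$ finite dimensional, $V^*=\varprojlim \underline{\mathrm{Hom}}(V_i,k)$ is formal. For $W$ formal, $\widehat TW=\prod_{n\ge0}W^{\otimes n}$ and $\widehat T_{\ge 1}W=\prod_{n\ge1}W^{\otimes n}$. **Derivations.** A graded derivation of a graded associative algebra is a homogeneous linear map $f$ with $f(xy)=f(x)y+(-1)^{|f||x|}xf(y)$; $\mathrm{Der}(A)$ is the graded Lie algebra they span, with the commutator bracket (continuous derivations when $A$ is formal). A derivation $\xi$ of $\widehat T\Sigma^{-1}V^*$ is determined by its components $\xi_n\colon\Sigma^{-1}V^*\to(\Sigma^{-1}V^* )^{\otimes n}$, equivalently (dualizing and desuspending, with Koszul signs) by maps $\hat\xi_n\colon V^{\otimes n}\to V$. $\mathrm{Der}(\widehat T_{\ge1}\Sigma^{-1}V^* )\subset\mathrm{Der}(\widehat T\Sigma^{-1}V^* )$ consists of those with $\xi_0=0$. **Involutions.** An involution on a graded space $V$ is a degree-preserving linear map $v\mapsto v^*$ with $(v^* )^*=v$. Suspensions inherit it, and $V^*$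 has the involution $\phi^*(v)=-\phi(v^* )$. If $W$ has an involution, $W^{\otimes n}$ has the involution $(w_1\otimes\dots\otimes w_n)^*=(-1)^{\epsilon}w_n^*\otimes\dots\otimes w_1^*$, $\epsilon=\sum_{i<j}|w_i||w_j|$; so $\widehat T\Sigma^{-1}V^*$ has an involution. **Cyclic involutive $A_\infty$-algebras.** Let $V$ be a graded space with an involution and a symmetric bilinear form $\langle-,-\rangle\colon V\otimes V\to\Sigma^dk$ (of degree $d$) with $\langle x^*,y^*\rangle=\langle x,y\rangle$. A derivation $\xi$ is cyclic if for all $n$ $$\langle\hat\xi_n(x_1,\dots,x_n),x_{n+1}\rangle=(-1)^{\epsilon}(-1)^n\langle\hat\xi_n(x_{n+1},x_1,\dots,x_{n-1}),x_n\rangle,\quad \epsilon=|x_{n+1}|\sum_{i=1}^n|x_i|.$$ $\mathrm{Der}^{\mathrm{cycl}}_+$ is the Lie subalgebra of cyclic derivations with $\xi(x^* )=\xi(x)^*$. A cyclic involutive $A_\infty$-structure on $V$ is $m\in\mathrm{Der}_+^{\mathrm{cycl}}(\widehat T_{\ge1}\Sigma^{-1}V^* )$ of degree one with $m^2=0$. The form is non-degenerate if $V\to\Sigma^dV^*$, $v\mapsto\langle v,-\rangle$, is an isomorphism. **Dihedral complex.** The dihedral group $D_i=\langle r,s\mid r^i=s^2=1,\ srs^{-1}=r^{-1}\rangle$ of order $2i$ acts on $W^{\otimes i}$, $W=\Sigma^{-1}V^*$, by $r(w_1\otimes\dots\otimes w_i)=(-1)^{|w_i|\sum_{j<i}|w_j|}w_i\otimes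 w_1\otimes\dots\otimes w_{i-1}$ and $s(w)=w^*$. $\mathrm{CD}^\bullet_+(V)=\Sigma\prod_{i\ge1}[(\Sigma^{-1}V^* )^{\otimes i}]_{D_i}$ (coinvariants) with differential induced by $m$, and $\mathrm{CD}^\bullet_+(V)_{\ge1}=\Sigma\prod_{i\ge2}[(\Sigma^{-1}V^* )^{\otimes i}]_{D_i}$. **Coefficient algebras.** An augmented formal commutative algebra $R$ is a unital commutative $k$-algebra with an augmentation $R\to k$ whose kernel $R_+$ is an inverse limit of finite dimensional nilpotent commutative algebras. **$\mathrm{Def}_{\mathfrak g}$.** For a differential graded Lie algebra $\mathfrak h$, $\mathrm{MC}(\mathfrak h)$ is the set of $\xi\in\mathfrak h^1$ with $d\xi+\frac12[\xi,\xi]=0$. If $\mathfrak h$ is pronilpotent (an inverse limit of nilpotent Lie algebras), the group $\exp(\mathfrak h^0)=\{e^y\}$ with the Baker--Campbell--Hausdorff product acts on $\mathrm{MC}(\mathfrak h)$ by $e^y\cdot\xi=\xi+\sum_{n\ge1}\frac1{n!}(\mathrm{ad}_y)^{n-1}(\mathrm{ad}_y\xi-dy)$, and $\mathscr{MC}(\mathfrak h)=\mathrm{MC}(\mathfrak h)/\exp(\mathfrak h^0)$. $\mathrm{Def}_{\mathfrak g}(R)=\mathscr{MC}(\mathfrak g\otimes R_+)$, where $\mathfrak g\otimes R_+=\varprojlim_i\mathfrak g\otimes(R_+)_i$ for $R_+=\varprojlim_i(R_+)_i$ with $(R_+)_i$ finite dimensional nilpotent. **$\mathrm{Def}_{(V,m)}$.**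 The involution and bilinear form are extended $R$-linearly. An $R$-linear cyclic involutive $A_\infty$-structure on $R\otimes V$ is an $R$-linear derivation $m'$ of $R\otimes\widehat T_{\ge1}\Sigma^{-1}V^*$ of degree one with $(m')^2=0$, $m'(x^* )=m'(x)^*$, whose components $\hat m'_n\colon(R\otimes V)^{\otimes_Rn}\to R\otimes V$ satisfy the cyclicity condition above for the $R$-bilinear form. An $R$-linear cyclic involutive $A_\infty$-morphism $(R\otimes V,m')\to(R\otimes W,m'')$ is a map of $R$-linear associative algebras $\phi\colon R\otimes\widehat T_{\ge1}\Sigma^{-1}W^*\to R\otimes\widehat T_{\ge1}\Sigma^{-1}V^*$ with $m'\circ\phi=\phi\circ m''$, $\phi(x^* )=\phi(x)^*$ and $\phi(\omega')=\omega$, where $\omega\in\Sigma^{-1}V^*\otimes\Sigma^{-1}V^*$ and $\omega'\in\Sigma^{-1}W^*\otimes\Sigma^{-1}W^*$ are the degree $d+2$ elements representing the bilinear forms. The reduction $\overline{m'}$ or $\overline\phi$ is the map induced modulo $R_+\otimes\widehat T_{\ge1}(-)$. A cyclic involutive $R$-deformation of $(V,m)$ is an $R$-linear cyclic involutive $A_\infty$-structure $m'$ on $R\otimes V$ with $\overline{m'}=m$; two are equivalent if there is an $R$-linear cyclic involutive $A_\infty$-isomorphism between them whose reduction is the identity. $\mathrm{Def}_{(V,m)}(R)$ is the set of equivalence classes. *)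

(* Defs.v *)
From HB Require Import structures.
From mathcomp Require Import all_boot all_order all_algebra.
From mathcomp Require Import all_classical.

Set Implicit Arguments.
Unset Strict Implicit.
Unset Printing Implicit Defensive.

Import GRing.Theory.
Local Open Scope ring_scope.
Local Open Scope classical_set_scope.
Local Open Scope quotient_scope.

(** * Quotients of vector spaces *)

Section Lquot.
Variables (k : fieldType) (U : lmodType k) (N : {pred U}).
Hypothesis Nsub : subsemimod_closed N.

Definition lquot_ideal of subsemimod_closed N : {pred U} := N.
HB.instance Definition _ :=
  GRing.isSubmodClosed.Build k U (lquot_ideal Nsub) Nsub.

Definition lquot : Type := Quotient.quot (lquot_ideal Nsub).
HB.instance Definition _ := GRing.Zmodule.on lquot.

Definition lpi (x : U) : lquot := \pi_(Quotient.quot (lquot_ideal Nsub)) x.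
Definition lrepr (c : lquot) : U := repr (c : Quotient.quot (lquot_ideal Nsub)).

Lemma lreprK c : lpi (lrepr c) = c.
Proof. exact: reprK. Qed.

Lemma lpi_eq x y : (lpi x = lpi y) <-> (x - y \in N).
Proof.
rewrite -[N]/(lquot_ideal Nsub : {pred U}) Quotient.idealrBE.
by split=> [|/eqP] //; move/eqP.
Qed.

Lemma lpiD x y : lpi (x + y) = lpi x + lpi y.
Proof. exact: Quotient.pi_add. Qed.

Definition lquot_scale (a : k) (c : lquot) : lquot := lpi (a *: lrepr c).

Lemma lpiZ a x : lpi (a *: x) = lquot_scale a (lpi x).
Proof.
apply/lpi_eq; rewrite -scalerBr; apply: Nsub.2.
by apply/lpi_eq; rewrite lreprK.
Qed.

Lemma lquot_scaleA a b c : lquot_scale a (lquot_scale b c) = lquot_scale (a * b) c.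
Proof. by rewrite -[c]lreprK -!lpiZ scalerA. Qed.

Lemma lquot_scale1 : left_id 1 lquot_scale.
Proof. by move=> c; rewrite -[c]lreprK -lpiZ scale1r. Qed.

Lemma lquot_scaleDr : right_distributive lquot_scale +%R.
Proof.
move=> a c e; rewrite -[c]lreprK -[e]lreprK -lpiD -!lpiZ scalerDr.
by rewrite lpiD.
Qed.

Lemma lquot_scaleDl c : {morph lquot_scale^~ c : a b / a + b}.
Proof. by move=> a b; rewrite -[c]lreprK -!lpiZ scalerDl lpiD. Qed.

HB.instance Definition _ := GRing.Zmodule_isLmodule.Build k lquot
  lquot_scaleA lquot_scale1 lquot_scaleDr lquot_scaleDl.

End Lquot.

(** * Augmented formal commutative algebras *)

Record nilAlg (k : fieldType) := NilAlg {
  na_sort :> vectType k;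
  na_mul : na_sort -> na_sort -> na_sort;
  na_mulDl : forall (a : k) x y z,
    na_mul (a *: x + y) z = a *: na_mul x z + na_mul y z;
  na_mulC : commutative na_mul;
  na_mulA : associative na_mul;
  na_nilp : exists N : nat, forall (x : na_sort) (s : seq na_sort),
    (N <= size s)%N -> foldl na_mul x s = 0
}.

(** [afa_R] is the algebra, [afa_eps] the augmentation, and the kernel of
    [afa_eps] is the limit of the inverse system [(afa_A, afa_tr)] over a
    directed set, with projections [afa_pr].  The maps [afa_tr i j] are only
    meaningful when [afa_le i j], and [afa_pr i] only on the kernel; it is
    extended to the whole algebra by [afa_pr i 1 = 0].  The projections are not
    assumed to be surjective. *)
Record afa (k : fieldType) := Afa {
  afa_R :> comAlgType k;
  afa_eps : {lrmorphism afa_R -> k^o};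
  afa_I : Type;
  afa_le : afa_I -> afa_I -> Prop;
  afa_lexx : forall i, afa_le i i;
  afa_le_trans : forall i j l, afa_le i j -> afa_le j l -> afa_le i l;
  afa_inh : inhabited afa_I;
  afa_dir : forall i j, exists2 l, afa_le i l & afa_le j l;
  afa_A : afa_I -> nilAlg k;
  afa_tr : forall i j, {linear afa_A j -> afa_A i};
  afa_trM : forall i j x y, afa_le i j ->
    afa_tr i j (na_mul x y) = na_mul (afa_tr i j x) (afa_tr i j y);
  afa_tr_id : forall i x, afa_tr i i x = x;
  afa_tr_comp : forall i j l x, afa_le i j -> afa_le j l ->
    afa_tr i j (afa_tr j l x) = afa_tr i l x;
  afa_pr : forall i, {linear afa_R -> afa_A i};
  afa_pr1 : forall i, afa_pr i 1 = 0;
  afa_prM : forall i r s, afa_eps r = 0 -> afa_eps s = 0 ->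
    afa_pr i (r * s) = na_mul (afa_pr i r) (afa_pr i s);
  afa_pr_tr : forall i j r, afa_le i j -> afa_tr i j (afa_pr j r) = afa_pr i r;
  afa_lim : forall a : (forall i, afa_A i),
    (forall i j, afa_le i j -> afa_tr i j (a j) = a i) ->
    exists! r : afa_R, afa_eps r = 0 /\ forall i, afa_pr i r = a i
}.

(** The basic neighbourhoods of zero of the inverse limit topology. *)
Definition afa_nbhs0 (k : fieldType) (R : afa k) (i : afa_I R) (r : R) : Prop :=
  afa_eps R r = 0 /\ afa_pr i r = 0.

Record afaHom (k : fieldType) (R S : afa k) := AfaHom {
  ah_map :> {lrmorphism R -> S};
  ah_eps : forall r, afa_eps S (ah_map r) = afa_eps R r;
  ah_cont : forall j : afa_I S, exists i : afa_I R,
    forall r, afa_nbhs0 i r -> afa_nbhs0 j (ah_map r)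
}.

Section AfaCategory.
Variable k : fieldType.

Program Definition afaHom_id (R : afa k) : afaHom R R :=
  @AfaHom k R R (idfun : {lrmorphism R -> R}) _ _.
Next Obligation. by []. Qed.
Next Obligation. by move=> R j; exists j. Qed.

Program Definition afaHom_comp (R S T : afa k) (psi : afaHom S T)
    (phi : afaHom R S) : afaHom R T :=
  @AfaHom k R T (psi \o phi : {lrmorphism R -> T}) _ _.
Next Obligation. by move=> R S T psi phi r /=; rewrite !ah_eps. Qed.
Next Obligation.
move=> R S T psi phi j; have [i hi] := ah_cont psi j.
by have [l hl] := ah_cont phi i; exists l => r /hl/hi.
Qed.

Program Definition nil0 : nilAlg k :=
  @NilAlg k 'rV[k]_0 (fun _ _ => 0) _ _ _ _.
Next Obligation. by move=> a x y z; rewrite scaler0 addr0. Qed.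
Next Obligation. by []. Qed.
Next Obligation. by []. Qed.
Next Obligation. by exists 0%N => x s _; apply: thinmx0. Qed.

(** The field [k] itself, with zero augmentation ideal. *)
Program Definition scalars : afa k :=
  @Afa k k^o (idfun : {lrmorphism k^o -> k^o}) unit (fun _ _ => True)
    _ _ _ _ (fun _ => nil0)
    (fun _ _ => idfun : {linear nil0 -> nil0}) _ _ _
    (fun _ => \0 : {linear k^o -> nil0}) _ _ _ _.
Next Obligation. by []. Qed.
Next Obligation. by []. Qed.
Next Obligation. exact: inhabits tt. Qed.
Next Obligation. by exists tt. Qed.
Next Obligation. by []. Qed.
Next Obligation. by []. Qed.
Next Obligation. by []. Qed.
Next Obligation. by []. Qed.
Next Obligation. by []. Qed.
Next Obligation. by []. Qed.
Next Obligation.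
move=> a _; exists 0; split; first by split=> // i; apply/esym/thinmx0.
by move=> r [/= ->].
Qed.

(** Set-valued functors: the value at [R] is the set [sf_obj R] of elements of
    an ambient type. *)
Record setFunctor := SetFunctor {
  sf_amb : afa k -> Type;
  sf_obj : forall R, set (sf_amb R);
  sf_map : forall R S, afaHom R S -> sf_amb R -> sf_amb S
}.

Arguments sf_obj : clear implicits.
Arguments sf_map F {R S} phi x : rename.

Definition is_functor (F : setFunctor) : Prop :=
  [/\ forall R S (phi : afaHom R S) x,
        sf_obj F R x -> sf_obj F S (sf_map F phi x),
      forall R x, sf_obj F R x -> sf_map F (afaHom_id R) x = x
    & forall R S T (psi : afaHom S T) (phi : afaHom R S) x, sf_obj F R x ->
        sf_map F (afaHom_comp psi phi) x = sf_map F psi (sf_map F phi x)].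

Definition nat_equiv (F G : setFunctor) : Prop :=
  exists Phi : forall R, sf_amb F R -> sf_amb G R,
    (forall R, set_bij (sf_obj F R) (sf_obj G R) (Phi R)) /\
    (forall R S (phi : afaHom R S) x, sf_obj F R x ->
       Phi S (sf_map F phi x) = sf_map G phi (Phi R x)).

End AfaCategory.

(** * Complexes and differential graded Lie algebras

    A graded space is given by subspaces [hom p], for [p : int], of an ambient
    space.  Operations whose signs depend on degrees take the degrees
    of their arguments as parameters. *)

Definition ksgn (k : fieldType) (n : int) : k := (-1) ^+ `|n|%N.
Arguments ksgn {k} n.

Record complex (k : fieldType) := Complex {
  cx_amb : lmodType k;
  cx_hom : int -> set cx_amb;
  cx_d : int -> cx_amb -> cx_amb
}.

Record dgLie (k : fieldType) := DgLie {
  dg_amb : lmodType k;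
  dg_hom : int -> set dg_amb;
  dg_br : int -> int -> dg_amb -> dg_amb -> dg_amb;
  dg_d : int -> dg_amb -> dg_amb
}.

Section DgLie.
Variable k : fieldType.

Definition is_subspace (U : lmodType k) (A : set U) : Prop :=
  A 0 /\ forall (a : k) x y, A x -> A y -> A (a *: x + y).

(** For [p : int], [(susp n C)^p = C^(p + n)] since [Sigma k] is [k] in
    degree [-1]. *)
Definition susp (n : int) (C : complex k) : complex k :=
  Complex (fun p => @cx_hom k C (p + n))
          (fun p x => ksgn n *: @cx_d k C (p + n) x).

Definition complex_iso (C D : complex k) : Prop :=
  exists F : int -> cx_amb C -> cx_amb D, forall p,
    [/\ set_bij (cx_hom p) (cx_hom p) (F p),
        forall (a : k) x y, cx_hom p x -> cx_hom p y ->
          F p (a *: x + y) = a *: F p x + F p y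
      & forall x, cx_hom p x -> F (p + 1) (cx_d p x) = cx_d p (F p x)].

Definition is_dgLie (g : dgLie k) : Prop :=
  let hom := @dg_hom k g in
  let br := @dg_br k g in
  let d := @dg_d k g in
  [/\ forall p, is_subspace (hom p),
      (forall p q x y, hom p x -> hom q y -> hom (p + q) (br p q x y)) /\
      (forall p x, hom p x -> hom (p + 1) (d p x)),
      [/\ forall p q (a : k) x y z, hom p x -> hom p y -> hom q z ->
            br p q (a *: x + y) z = a *: br p q x z + br p q y z
        & forall p (a : k) x y, hom p x -> hom p y ->
            d p (a *: x + y) = a *: d p x + d p y],
      [/\ forall p q x y, hom p x -> hom q y ->
            br p q x y = - ksgn (p * q) *: br q p y x
        & forall p q r x y z, hom p x -> hom q y -> hom r z ->
            br p (q + r) x (br q r y z) =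
              br (p + q) r (br p q x y) z
              + ksgn (p * q) *: br q (p + r) y (br p r x z)]
    & [/\ forall p x, hom p x -> d (p + 1) (d p x) = 0
        & forall p q x y, hom p x -> hom q y ->
            d (p + q) (br p q x y) =
              br (p + 1) q (d p x) y + ksgn p *: br p (q + 1) x (d q y)]].

Definition complex_of (g : dgLie k) : complex k :=
  Complex (@dg_hom k g) (@dg_d k g).

Definition MC (h : dgLie k) : set (dg_amb h) :=
  [set xi | dg_hom 1 xi /\ dg_d 1 xi + 2^-1 *: dg_br 1 1 xi xi = 0].

(** The sum of the terms of index at most [N] of the series
    [e^y . xi = xi + \sum_(n >= 1) ad_y^(n-1) (ad_y xi - d y) / n!]. *)
Definition gauge_partial (h : dgLie k) (y xi : dg_amb h) (N : nat) : dg_amb h :=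
  xi + \sum_(1 <= n < N.+1)
    (n`!%:R)^-1 *: iter n.-1 (@dg_br k h 0 1 y)
                     (@dg_br k h 0 1 y xi - @dg_d k h 0 y).

(** [g (x) A] for a finite dimensional [A] with basis [e_a = (vbasis fullv)`_a]:
    the function [x] stands for [\sum_a x a (x) e_a]. *)
Section Tensor.
Variable L : lmodType k.

Definition tensA (A : nilAlg k) := {ffun 'I_(\dim {:A}) -> L}.

Definition tens_pure (A : nilAlg k) (l : L) (a : A) : tensA A :=
  [ffun c => coord (vbasis {:A}) c a *: l].

Definition tens_map (A B : nilAlg k) (f : A -> B) (x : tensA A) : tensA B :=
  \sum_c tens_pure (x c) (f (vbasis {:A})`_c).

End Tensor.

Definition tens_dgLie (g : dgLie k) (A : nilAlg k) : dgLie k :=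
  @DgLie k (tensA (dg_amb g) A)
    (fun p => [set x | forall c, dg_hom p (x c)])
    (fun p q x y => \sum_a \sum_b
       tens_pure (dg_br p q (x a) (y b))
         (na_mul (vbasis {:A})`_a (vbasis {:A})`_b))
    (fun p x => [ffun c => dg_d p (x c)]).

(** ** The Maurer--Cartan deformation functor

    An element of the limit [g (x) R_+] of the [g (x) (R_+)_i] is a compatible
    family; the operations of the limit are computed componentwise. *)
Section DefMC.
Variable g : dgLie k.

Definition fam (R : afa k) := forall i : afa_I R, dg_amb (tens_dgLie g (afa_A i)).

Definition compatible (R : afa k) (x : fam R) : Prop :=
  forall i j, afa_le i j -> tens_map (afa_tr i j) (x j) = x i.

Definition MC_lim (R : afa k) : set (fam R) :=
  [set xi | compatible xi /\ forall i, MC (xi i)].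

(** [eta = e^y . xi] for some [y] of degree zero; the series converges in the
    limit topology, and at each level it is a finite sum. *)
Definition gauge_equiv (R : afa k) (xi eta : fam R) : Prop :=
  exists y : fam R, [/\ compatible y, forall i, dg_hom 0 (y i)
    & forall i, exists N, forall M, (N <= M)%N ->
        gauge_partial (y i) (xi i) M = eta i].

Definition gauge_class (R : afa k) (xi : fam R) : set (fam R) :=
  [set eta | MC_lim eta /\ gauge_equiv xi eta].

(** [y] is the image of [x] under [id (x) phi].  At each level [j] of [S], the
    map [phi] modulo the [j]th neighbourhood factors through the image of [R_+]
    in some [(R_+)_i]. *)
Definition push (R S : afa k) (phi : afaHom R S) (x : fam R) (y : fam S) : Prop :=
  forall j, exists i,
    (forall r, afa_nbhs0 i r -> afa_nbhs0 j (phi r)) /\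
    exists s : seq (dg_amb g * R),
      [/\ forall t, t \in s -> afa_eps R t.2 = 0,
          x i = \sum_(t <- s) tens_pure t.1 (afa_pr i t.2)
        & y j = \sum_(t <- s) tens_pure t.1 (afa_pr j (phi t.2))].

Definition Def_MC : setFunctor k :=
  @SetFunctor k (fun R => set (fam R))
    (fun R => [set C | exists2 xi, MC_lim xi & C = gauge_class xi])
    (fun R S phi C =>
       [set eta | exists xi xi', [/\ C xi, push phi xi xi', MC_lim xi'
                                   & gauge_class xi' eta]]).

End DefMC.
End DgLie.

(** * Graded spaces with an involution and a symmetric form of degree [d] *)

Record invSpace (k : fieldType) (d : int) := InvSpace {
  is_V :> int -> lmodType k;
  is_star : forall i, {linear is_V i -> is_V i};
  is_starK : forall i x, is_star i (is_star i x) = x;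
  is_form : forall i j, is_V i -> is_V j -> k;
  is_formDl : forall i j (a : k) x y (z : is_V j),
    @is_form i j (a *: x + y) z = a * is_form x z + is_form y z;
  is_formC : forall i j (x : is_V i) (y : is_V j),
    is_form x y = ksgn (i * j) * is_form y x;
  is_form_deg : forall i j (x : is_V i) (y : is_V j),
    i + j != - d -> is_form x y = 0;
  is_form_star : forall i j (x : is_V i) (y : is_V j),
    is_form (is_star i x) (is_star j y) = is_form x y
}.

Definition nondegenerate_form (k : fieldType) (d : int) (V : invSpace k d) : Prop :=
  forall i,
    (forall x : V i, (forall j (y : V j), is_form x y = 0) -> x = 0) /\
    (forall phi : {linear V (- d - i) -> k^o},
       exists x : V i, forall y, is_form x y = phi y).

(** * The completed tensor algebra

    With [W = Sigma^-1 V^*], the completed space [R (x) W^{(x) n}] is the space of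
    [k]-multilinear functions on [n]-tuples of homogeneous elements of [V] with
    values in [R]: [w_1 (x) ... (x) w_n], where [w_i] is the desuspension of
    [phi_i], is the function with value [phi_1(x_1) ... phi_n(x_n)] at
    [(x_1, ..., x_n)].  No sign enters here, so that the product of the tensor
    algebra is the plain concatenation product.  A word of any length is a
    sequence of homogeneous elements, and [tens] is the product over all
    [n >= 1].  All degrees are gathered in one space: it is the product of the
    homogeneous components, and a homogeneous continuous map of graded spaces is
    the same as a continuous linear map of this product shifting degrees. *)
Section Tens.
Variables (k : fieldType) (d : int) (V : invSpace k d).

Definition helt := {i : int & V i}.
Definition hel (i : int) (x : V i) : helt := Tagged (fun i => V i) x.

Definition multilinear (R : lmodType k) (f : seq helt -> R) : Prop :=
  forall i (a : k) (x y : V i) (u v : seq helt),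
    f (u ++ hel (a *: x + y) :: v) =
      a *: f (u ++ hel x :: v) + f (u ++ hel y :: v).

Definition tens_pred (R : lmodType k) : {pred (seq helt -> R)} :=
  fun f => `[< multilinear f /\ f [::] = 0 >].
Arguments tens_pred R : clear implicits.

Lemma tens_predP (R : lmodType k) (f : seq helt -> R) :
  reflect (multilinear f /\ f [::] = 0) (f \in tens_pred R).
Proof. exact: asboolP. Qed.

Lemma tens_pred_submod (R : lmodType k) : subsemimod_closed (tens_pred R).
Proof.
split; first split.
- by apply/tens_predP; split=> // i a x y u v; rewrite scaler0 addr0.
- move=> f g /tens_predP[mf f0] /tens_predP[mg g0]; apply/tens_predP.
  rewrite addrfctE; split=> [i a x y u v|]; last by rewrite f0 g0 addr0.
  by rewrite mf mg scalerDr addrACA.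
- move=> b f /tens_predP[mf f0]; apply/tens_predP.
  rewrite scalrfctE; split=> [i a x y u v|]; last by rewrite f0 scaler0.
  by rewrite mf scalerDr !scalerA mulrC.
Qed.

HB.instance Definition _ (R : lmodType k) :=
  GRing.isSubmodClosed.Build k (seq helt -> R) (tens_pred R)
    (tens_pred_submod R).

Record tens (R : lmodType k) := Tens {
  tens_fun :> seq helt -> R;
  tens_funP : tens_fun \in tens_pred R
}.

HB.instance Definition _ R := [isSub for @tens_fun R].
HB.instance Definition _ R := [Choice of tens R by <:].
HB.instance Definition _ R := [SubChoice_isSubLmodule of tens R by <:].

Lemma tens_multilinear R (f : tens R) : multilinear f.
Proof. by case: f => f /= /tens_predP[]. Qed.

Lemma tens_nil R (f : tens R) : f [::] = 0.
Proof. by case: f => f /= /tens_predP[]. Qed.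

Definition mk_tens (R : lmodType k) (f : seq helt -> R)
    (mf : multilinear f) (f0 : f [::] = 0) : tens R :=
  Tens (introT (tens_predP f) (conj mf f0)).

(** The degree of the elements of [W = Sigma^-1 V^*] not vanishing at [x]. *)
Definition wdeg1 (x : helt) : int := 1 - tag x.

Definition wdeg (w : seq helt) : int := \sum_(x <- w) wdeg1 x.

(** [\sum_(i < j) |w_i| |w_j|]. *)
Fixpoint wpairs (w : seq helt) : int :=
  if w is x :: u then wdeg1 x * wdeg u + wpairs u else 0.

(** [\sum_i (n - i) |x_i|] for [w = x_1 ... x_n]. *)
Fixpoint wdesusp (w : seq helt) : int :=
  if w is x :: u then (size u)%:Z * tag x + wdesusp u else 0.

Definition homog (R : lmodType k) (q : int) (f : tens R) : Prop :=
  forall w, f w != 0 -> wdeg w = q.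

Lemma wdeg_cat u v : wdeg (u ++ v) = wdeg u + wdeg v.
Proof. by rewrite /wdeg big_cat. Qed.

Lemma wdeg_cons x u : wdeg (x :: u) = wdeg1 x + wdeg u.
Proof. by rewrite /wdeg big_cons. Qed.

Lemma wpairs_same i (x y : V i) u v :
  wpairs (u ++ hel x :: v) = wpairs (u ++ hel y :: v).
Proof.
elim: u => [|z u IH] //=; rewrite IH; congr (_ * _ + _).
by rewrite !wdeg_cat !wdeg_cons.
Qed.

(** ** Involution, cyclic rotation, product *)

Definition helt_star (x : helt) : helt := hel (is_star V (tag x) (tagged x)).

(** Each tensor factor contributes a sign [-1], as [phi^* x = - phi (star x)]. *)
Definition star_fun (R : lmodType k) (f : seq helt -> R) (w : seq helt) : R :=
  ksgn ((size w)%:Z + wpairs w) *: f (rev (map helt_star w)).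

Lemma star_multilinear (R : lmodType k) (f : seq helt -> R) :
  multilinear f -> multilinear (star_fun f).
Proof.
move=> mf i a x y u v; rewrite /star_fun.
rewrite !size_cat /= (wpairs_same (a *: x + y) x) (wpairs_same y x).
rewrite !map_cat !rev_cat /= !rev_cons -!cats1 -!catA /=.
rewrite /helt_star /= linearP mf scalerDr; congr (_ + _).
by rewrite !scalerA mulrC.
Qed.

Definition star (R : lmodType k) (f : tens R) : tens R.
Proof.
apply: (@mk_tens R (star_fun f)); first exact/star_multilinear/tens_multilinear.
by rewrite /star_fun /= tens_nil scaler0.
Defined.

(** [r(w_1 (x) ... (x) w_n) = +- w_n (x) w_1 (x) ... (x) w_(n-1)]. *)
Definition rot_fun (R : lmodType k) (f : seq helt -> R) (w : seq helt) : R :=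
  if w is x :: u then ksgn (wdeg1 x * wdeg u) *: f (rcons u x) else f [::].

Lemma rot_multilinear (R : lmodType k) (f : seq helt -> R) :
  multilinear f -> multilinear (rot_fun f).
Proof.
move=> mf i a x y [|z u] v /=; rewrite -!cats1 /= -?catA /= mf scalerDr.
  by congr (_ + _); rewrite !scalerA mulrC.
rewrite !wdeg_cat !wdeg_cons /wdeg1 /=; congr (_ + _).
by rewrite !scalerA mulrC.
Qed.

Definition rot (R : lmodType k) (f : tens R) : tens R.
Proof.
apply: (@mk_tens R (rot_fun f)); first exact/rot_multilinear/tens_multilinear.
exact: tens_nil.
Defined.

Definition prod_fun (R : comAlgType k) (f g : seq helt -> R) (w : seq helt) : R :=
  \sum_(i < (size w).+1) f (take i w) * g (drop i w).

Lemma prod_multilinear (R : comAlgType k) (f g : seq helt -> R) :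
  multilinear f -> multilinear g -> multilinear (prod_fun f g).
Proof.
move=> mf mg i a x y u v; rewrite /prod_fun !size_cat /= scaler_sumr -big_split /=.
apply: eq_bigr => -[l /= _] _.
rewrite !take_cat !drop_cat; case: ltnP => hl.
  by rewrite mg mulrDr scalerAr.
case: (l - size u)%N => [|l'] /=.
  by rewrite !cats0 (mg i a x y [::] v) mulrDr scalerAr.
by rewrite mf mulrDl scalerAl.
Qed.

Definition tprod (R : comAlgType k) (f g : tens R) : tens R.
Proof.
apply: (@mk_tens R (prod_fun f g)).
  by apply: prod_multilinear; exact: tens_multilinear.
by rewrite /prod_fun big_ord1 /= tens_nil mul0r.
Defined.

Definition tmap (R S : lmodType k) (phi : {linear R -> S}) (f : tens R) : tens S.
Proof.
apply: (@mk_tens S (fun w => phi (f w))); last by rewrite tens_nil linear0.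
by move=> i a x y u v; rewrite tens_multilinear linearP.
Defined.

(** Multiplication by an element of [R]. *)
Definition tscale (R : comAlgType k) (r : R) (f : tens R) : tens R.
Proof.
apply: (@mk_tens R (fun w => r * f w)); last by rewrite tens_nil mulr0.
by move=> i a x y u v; rewrite tens_multilinear mulrDr scalerAr.
Defined.

(** ** The bilinear form *)

Definition hform (x y : helt) : k := is_form (tagged x) (tagged y).

(** The element [<-, z>] of [Sigma^-1 V^*]; its degree is [d + 1 + |z|]. *)
Definition form_elt (R : comAlgType k) (z : helt) : tens R.
Proof.
apply: (@mk_tens R (fun w => if w is [:: x] then (hform x z)%:A else 0)) => //.
move=> i a x y [|t [|t' u]] [|t'' v] /=; rewrite ?scaler0 ?addr0 //.
by rewrite /hform /= is_formDl scalerDl scalerA.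
Defined.

(** The element of [Sigma^-1 V^* (x) Sigma^-1 V^*] representing the form.  The
    sign is the product of the sign [(-1)^|x|] of the desuspension
    [Sigma V (x) Sigma V -> V (x) V] and of the Koszul sign of the pairing of
    [W (x) W] with [Sigma V (x) Sigma V]. *)
Definition omega (R : comAlgType k) : tens R.
Proof.
apply: (@mk_tens R (fun w => if w is [:: x; y] then
  (ksgn (tag x + wdeg1 x * wdeg1 y) * hform x y)%:A else 0)) => //.
move=> i a x y [|t [|t' [|t'' u]]] [|s [|s' v]] /=; rewrite ?scaler0 ?addr0 //.
  rewrite /hform /= is_formDl mulrDr scalerDl scalerA; congr (_ *: _ + _).
  by rewrite !mulrA [in RHS](mulrC a).
rewrite /hform /= ![is_form (tagged t) _]is_formC is_formDl !mulrDr scalerDl.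
by rewrite scalerA; congr (_ *: _ + _); rewrite !mulrA -!(mulrC a) !mulrA.
Defined.

(** ** Derivations, cyclic structures and deformations *)

Section Structures.
Variable R : afa k.

Notation T := (tens R).

Definition tcont (S : afa k) (D : T -> tens S) : Prop :=
  forall (j : afa_I S) (w : seq helt),
  exists (i : afa_I R) (L : seq (seq helt)),
    forall f : T, (forall u, u \in L -> afa_nbhs0 i (f u)) ->
      afa_nbhs0 j (D f w).

Definition tlinear (D : T -> T) : Prop :=
  (forall f g, D (f + g) = D f + D g) /\
  (forall r f, D (tscale r f) = tscale r (D f)).

Definition is_derivation (p : int) (D : T -> T) : Prop :=
  [/\ tlinear D, tcont D, forall q f, homog q f -> homog (q + p) (D f)
    & forall q f g, homog q f ->
        D (tprod f g) = tprod (D f) g + ksgn (p * q) *: tprod f (D g)].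

(** [<\hat D_n(x_1, ..., x_n), z>], that is the functional [<-, z>] applied to
    [\hat D_n(x_1, ..., x_n)], for [D] of degree [p] and [w = x_1 ... x_n].  The
    three terms of the Koszul sign come from [(Sigma^-1)^{(x) n}], from dualizing
    the map [D_n] of degree [p] applied to an element of degree [d + 1 + |z|],
    and from the pairing of [W^{(x) n}] with [(Sigma V)^{(x) n}] (the
    remaining convention-dependent signs only depend on [n], [p] and [d]). *)
Definition hat_form (p : int) (D : T -> T) (w : seq helt) (z : helt) : R :=
  ksgn (wdesusp w + p * (d + 1 + tag z) + wpairs w) *: D (form_elt R z) w.

(** The variables [x_1, ..., x_(n-1), x_n, x_(n+1)] are [u], [y], [z]; there is
    no condition for [n = 0] since the component [D_0] is zero. *)
Definition is_cyclic (p : int) (D : T -> T) : Prop :=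
  forall (u : seq helt) (y z : helt),
    hat_form p D (rcons u y) z =
      ksgn (tag z * (\sum_(x <- rcons u y) tag x)) *:
      ((-1) ^+ (size u).+1 *: hat_form p D (z :: u) y).

Definition Der_cycl (p : int) : set (T -> T) :=
  [set D | [/\ is_derivation p D, is_cyclic p D
             & forall f, D (star f) = star (D f)]].

Definition cycl_Ainf (D : T -> T) : Prop :=
  Der_cycl 1 D /\ forall f, D (D f) = 0.

Definition is_morphism (m1 m2 phi : T -> T) : Prop :=
  [/\ tlinear phi /\ tcont phi,
      forall q f, homog q f -> homog q (phi f),
      forall f g, phi (tprod f g) = tprod (phi f) (phi g),
      forall f, m1 (phi f) = phi (m2 f)
    & (forall f, phi (star f) = star (phi f)) /\ phi (omega R) = omega R].

Definition is_isomorphism (m1 m2 phi : T -> T) : Prop :=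
  is_morphism m1 m2 phi /\
  exists psi, [/\ is_morphism m2 m1 psi, cancel phi psi & cancel psi phi].

(** Reduction modulo [R_+]. *)
Definition tred (f : T) : tens (scalars k) := tmap (afa_eps R) f.

End Structures.

Arguments Der_cycl R p : clear implicits.

Section Deformations.
Variable m : tens (scalars k) -> tens (scalars k).

Definition is_deformation (R : afa k) (m' : tens R -> tens R) : Prop :=
  cycl_Ainf m' /\ forall f, tred (m' f) = m (tred f).

Definition def_equiv (R : afa k) (m1 m2 : tens R -> tens R) : Prop :=
  exists2 phi, is_isomorphism m1 m2 phi & forall f, tred (phi f) = tred f.

Definition def_class (R : afa k) (m1 : tens R -> tens R) :
    set (tens R -> tens R) :=
  [set m2 | is_deformation m2 /\ def_equiv m1 m2].

(** [m2] is the extension of [m1] along [phi]; as [m2] is [S]-linear and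
    continuous, it is determined by [m1]. *)
Definition base_change (R S : afa k) (phi : afaHom R S)
    (m1 : tens R -> tens R) (m2 : tens S -> tens S) : Prop :=
  forall f, m2 (tmap phi f) = tmap phi (m1 f).

Definition Def_V : setFunctor k :=
  @SetFunctor k (fun R => set (tens R -> tens R))
    (fun R => [set C | exists2 m1, is_deformation m1 & C = def_class m1])
    (fun R S phi C =>
       [set m' | exists m1 m2, [/\ C m1, base_change phi m1 m2,
                                   is_deformation m2 & def_class m2 m']]).

(** The differential graded Lie algebra of cyclic derivations compatible with
    the involution, inside the space of all maps. *)
Definition Der_dgLie : dgLie k :=
  let br p q (f g : tens (scalars k) -> tens (scalars k)) :=
    (fun h => f (g h) - ksgn (p * q) *: g (f h)) in
  @DgLie k (tens (scalars k) -> tens (scalars k))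
    (Der_cycl (scalars k)) br (fun p f => br 1 p m f).

End Deformations.

(** ** The dihedral complex *)

Local Notation T := (tens (scalars k)).

(** The action of [r^a s^e]. *)
Definition dihedral (a : nat) (e : bool) (f : T) : T :=
  iter a (@rot _) (if e then star f else f).

(** In every length [n], [f] is a combination of elements [gamma h - h]. *)
Definition dihedral_pred : {pred T} := fun f => `[<
  forall n : nat, exists s : seq (nat * bool * T), forall w, size w = n ->
    f w = \sum_(t <- s) (dihedral t.1.1 t.1.2 t.2 - t.2) w >].

Lemma tensP (R : lmodType k) (f g : tens R) : (forall w, f w = g w) -> f = g.
Proof. by move=> h; apply/val_inj/funext. Qed.

Lemma tens0E (R : lmodType k) w : (0 : tens R) w = 0.
Proof. by rewrite -[LHS]/(val (0 : tens R) w) raddf0. Qed.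

Lemma tensDE (R : lmodType k) (f g : tens R) w : (f + g) w = f w + g w.
Proof. by rewrite -[LHS]/(val (f + g) w) raddfD. Qed.

Lemma tensZE (R : lmodType k) (a : k) (f : tens R) w : (a *: f) w = a *: f w.
Proof. by rewrite -[LHS]/(val (a *: f) w) linearZ. Qed.

Lemma starZ (R : lmodType k) (a : k) (f : tens R) : star (a *: f) = a *: star f.
Proof.
apply: tensP => w; rewrite tensZE -[LHS]/(star_fun (a *: f) w).
by rewrite /star_fun tensZE -[star f w]/(star_fun f w) !scalerA mulrC.
Qed.

Lemma rotZ (R : lmodType k) (a : k) (f : tens R) : rot (a *: f) = a *: rot f.
Proof.
apply: tensP => w; rewrite tensZE -[LHS]/(rot_fun (a *: f) w).
rewrite -[rot f w]/(rot_fun f w); case: w => [|x u]; rewrite /rot_fun tensZE //.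
by rewrite !scalerA mulrC.
Qed.

Lemma dihedralZ n e (a : k) (f : T) : dihedral n e (a *: f) = a *: dihedral n e f.
Proof.
rewrite /dihedral; have -> : (if e then star (a *: f) else a *: f) =
    a *: (if e then star f else f) by case: e => //; exact: starZ.
by elim: n => //= n ->; rewrite rotZ.
Qed.

Lemma dihedral_pred_submod : subsemimod_closed dihedral_pred.
Proof.
split; first split.
- by apply/asboolP => n; exists [::] => w _; rewrite big_nil tens0E.
- move=> f g /asboolP hf /asboolP hg; apply/asboolP => n.
  have [s hs] := hf n; have [t ht] := hg n; exists (s ++ t) => w sw.
  by rewrite tensDE big_cat hs // ht.
- move=> a f /asboolP hf; apply/asboolP => n; have [s hs] := hf n.
  exists [seq (t.1, a *: t.2) | t <- s] => w sw.
  rewrite big_map tensZE hs // scaler_sumr; apply: eq_bigr => t _.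
  by rewrite dihedralZ -scalerBr; exact/esym/tensZE.
Qed.

(** [\prod_(i >= 1) [W^{(x) i}]_(D_i)]. *)
Definition coinv : lmodType k := lquot dihedral_pred_submod.

Section Complex.
Variable m : T -> T.

(** The part of tensor length at least [n0].  The differential of the class of
    [f] is the class of [m f]; it does not depend on the representative, because
    [m] is a derivation commuting with the involution. *)
Definition coinv_complex (n0 : nat) : complex k :=
  @Complex k coinv
    (fun q => [set c | exists f : T, [/\ homog q f,
                  forall w, (size w < n0)%N -> f w = 0
                & c = lpi dihedral_pred_submod f]])
    (fun _ c => lpi dihedral_pred_submod (m (lrepr c))).

Definition CD : complex k := susp 1 (coinv_complex 1).

Definition CD_ge1 : complex k := susp 1 (coinv_complex 2).

End Complex.

End Tens.

(* Main.v *)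
From HB Require Import structures.
Require Import Defs.
From mathcomp Require Import all_boot all_order all_algebra.
From mathcomp Require Import all_classical.
From mathcomp Require Import zify ring lra.

Set Implicit Arguments.
Unset Strict Implicit.
Unset Printing Implicit Defensive.

Import GRing.Theory.
Local Open Scope ring_scope.
Local Open Scope classical_set_scope.

(** An element of the completed tensor algebra on [W = Sigma^-1 V^*] is handled
    through its values on words of homogeneous elements of [V].  Three ideas
    carry the proof.

    Cyclicity is preservation of [omega].  By Leibniz' rule and continuity, the
    value of a derivation on a word is computed through the first letter
    ([derivation_cons]); applied to [omega], this shows that a derivation is
    cyclic if and only if it kills [omega] ([cyclic_omega]), a condition which is
    visibly stable under brackets.  Hence the differential graded Lie algebra.

    Deformations are Maurer--Cartan elements.  Constant tensors are dense
    ([dense]), so that an [R]-linear continuous operator is given by its reduction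
    and by a compatible family of operators with coefficients in the [afa_A i]
    ([op_exists]).  When the reduction of [m1 = m + xi] is [m], the equation
    [m1^2 = 0] is the Maurer--Cartan equation for [xi] ([deformation_MC],
    [MC_deformation]).  Operators with values in the augmentation ideal shift a
    finite filtration at each level, so that series in them converge
    ([series_exists]).  The exponential of a derivation of degree zero with values
    in the ideal is a morphism ([exp_morphism]), and every morphism [chi] with
    identity reduction arises in this way ([log_exists]): [chi^t] is multiplicative
    for all natural numbers [t] and is polynomial in [t], so that the coefficient
    of [t] is a derivation.  As conjugation by [e^Y] is [e^(ad Y)], and as
    [e^(ad Y) m1 - m] is the gauge action of [Y] on [xi] ([gauge_conj]),
    equivalence of deformations is gauge equivalence ([def_gauge]).  Changing
    coefficients is the same operation on both sides ([push_base_change]).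

    Cyclic derivations are dihedral coinvariants.  The function
    [<\hat D(x_1, ..., x_n), x_(n+1)>], called [ham D] below, is invariant under
    the dihedral group, and when the form is non-degenerate every invariant
    function supported in lengths at least two comes from a unique derivation
    ([derivation_eq], [dmap_Der], [ham_dmap]).  In characteristic zero invariants
    are coinvariants: [D] is sent to the class of [ham D / n] in length [n], whose
    sum of rotations is [ham D].  The function [ham [m, D]] collects all the
    insertions of an operation of [m] in the cyclic words of [ham D]: those that
    avoid the last letter come from [m D] and those that contain it from [D m]
    ([ham_bracket]).  The same sum over insertions computes the differential of
    the dihedral complex ([cnorm_dsub]). *)

(** * Signs *)

(** Signs are compared through parities, on which case analysis is finite. *)
Definition par (n : int) : bool := odd `|n|%N.

Lemma parN n : par (- n) = par n. Proof. by rewrite /par abszN. Qed.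
Lemma parM a b : par (a * b) = par a && par b.
Proof. by rewrite /par abszM oddM. Qed.

Lemma parD a b : par (a + b) = par a (+) par b.
Proof.
have pos (x y : nat) : par (x%:Z - y%:Z) = odd x (+) odd y.
  case: (leqP x y) => [le_xy|/ltnW le_yx].
    by rewrite -opprB parN subzn // /par absz_nat oddB // addbC.
  by rewrite subzn // /par absz_nat oddB.
case: (intP a) => [|x|x]; case: (intP b) => [|y|y];
  rewrite ?addr0 ?add0r ?parN //=.
- by rewrite [par 0]/par /= addbF.
- by rewrite -PoszD /par !absz_nat oddD.
- by rewrite [par 0]/par /= addbF.
- by rewrite addrC addbC; exact: (pos y.+1 x.+1).
- by rewrite -opprD parN -PoszD /par !absz_nat oddD.
Qed.

Lemma par_nat n : par n%:Z = odd n. Proof. by []. Qed.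
Definition parE := (parD, parM, parN, par_nat).

Section Signs.
Variable k : fieldType.
Lemma ksgnE n : ksgn n = (-1) ^+ par n :> k.
Proof. by rewrite /ksgn signr_odd. Qed.
Lemma ksgnD a b : ksgn (a + b) = ksgn a * ksgn b :> k.
Proof. by rewrite !ksgnE parD signr_addb. Qed.
Lemma ksgnK a : ksgn a * ksgn a = 1 :> k.
Proof. by rewrite ksgnE -signr_addb addbb. Qed.
Lemma ksgn_inj_scale (R : lmodType k) a (x y : R) :
  ksgn a *: x = ksgn a *: y -> x = y.
Proof. by move/(congr1 ( *:%R (ksgn a))); rewrite !scalerA ksgnK !scale1r. Qed.
End Signs.

(** ** Linear functionals *)

(** Zorn's lemma gives a subspace maximal among those avoiding [x].  It has
    codimension one, and the functional is the coordinate along [x]. *)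
Lemma functional_neq0 (k : fieldType) (U : lmodType k) (x : U) :
  x != 0 -> exists phi : {linear U -> k^o}, phi x = 1.
Proof.
move=> x0.
pose P (M : set U) := (forall a y z, M y -> M z -> M (a *: y + z)) /\ ~ M x.
have [|M [[Mlin Mx] Mmax]] := @Zorn_bigcup U P.
  move=> F FP Ftot; split=> [a y z [A FA Ay] [B FB Bz]|[A FA Ax]]; last first.
    by case: (FP _ FA).
  case: (Ftot _ _ FA FB) => [AB|BA].
    by exists B => //; apply: (FP _ FB).1 => //; exact: AB.
  by exists A => //; apply: (FP _ FA).1 => //; exact: BA.
have M0 : M 0.
  apply: contrapT => nM0.
  have Mn y : ~ M y.
    by move=> My; apply: nM0; rewrite -(subrr y) -scaleN1r addrC; exact: Mlin.
  apply: (Mmax [set 0]); first by split=> [y /Mn //|/(_ 0 erefl)/Mn].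
  split=> [a y z -> ->|/= /eqP]; first by rewrite /= scaler0 addr0.
  by rewrite (negbTE x0).
have MZ a y : M y -> M (a *: y) by move=> My; rewrite -[_ *: _]addr0; exact: Mlin.
have MD y z : M y -> M z -> M (y + z).
  by move=> My Mz; rewrite -[y]scale1r; exact: Mlin.
have MB y z : M y -> M z -> M (y - z).
  by move=> My Mz; apply: MD => //; rewrite -scaleN1r; exact: MZ.
have ex v : exists c : k, M (v - c *: x).
  have [Mv|nMv] := pselect (M v); first by exists 0; rewrite scale0r subr0.
  pose A : set U := [set u | exists c : k, exists2 y, M y & u = y + c *: v].
  have MA : M `<` A.
    split=> [y My|/(_ v)]; first by exists 0; exists y => //; rewrite scale0r addr0.
    move=> h; apply/nMv/h; exists 1; exists 0 => //.
    by rewrite scale1r add0r.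
  have [Ax|nAx] := pselect (A x); last first.
    case: (Mmax A MA); split=> // a _ _ [c [y My ->]] [e [z Mz ->]].
    exists (a * c + e); exists (a *: y + z); first exact: Mlin.
    by rewrite scalerDr scalerA scalerDl addrACA.
  case: Ax => c [y My xE].
  have c0 : c != 0.
    by apply/eqP => c0; apply: Mx; rewrite xE c0 scale0r addr0.
  exists c^-1; rewrite xE scalerDr scalerA mulVf // scale1r opprD addrCA subrr addr0.
  by rewrite -scaleN1r scalerA; exact: MZ.
have uniq v c e : M (v - c *: x) -> M (v - e *: x) -> c = e.
  move=> hc he; apply/eqP; rewrite -subr_eq0; apply/eqP; apply: contrapT => /eqP ne.
  apply: Mx; have := MZ (c - e)^-1 _ (MB _ _ he hc).
  have -> : v - e *: x - (v - c *: x) = (c - e) *: x.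
    by rewrite scalerBl opprB addrC addrA subrK.
  by rewrite scalerA mulVf // scale1r.
pose f v := projT1 (cid (ex v)); have fP v : M (v - f v *: x) by rewrite /f; case: cid.
have flin : linear (f : U -> k^o).
  move=> a y z; apply: (@uniq (a *: y + z)) => //.
  rewrite scalerDl -scalerA opprD addrACA -scalerBr; exact: Mlin.
pose phi : {linear U -> k^o} := HB.pack (f : U -> k^o)
  (GRing.isLinear.Build k U k^o _ (f : U -> k^o) flin).
by exists phi; apply: (@uniq x) => //=; rewrite scale1r subrr.
Qed.

Lemma ksgn_par (k : fieldType) a b : par a = par b -> ksgn a = ksgn b :> k.
Proof. by rewrite !ksgnE => ->. Qed.

Lemma par0 : par 0 = false. Proof. by []. Qed.
Lemma par1 : par 1 = true. Proof. by []. Qed.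

(** Degrees only matter modulo two, so that an identity between signs is a boolean
    identity in finitely many parities. *)
Ltac par_cases := rewrite ?(parD, parM, parN, par_nat, par0, par1) /=;
  repeat match goal with
  | |- context [par ?x] => case: (par x)
  | |- context [odd ?x] => case: (odd x)
  end; by [].
Ltac signs := apply: ksgn_par; par_cases.

(** * The completed tensor algebra *)

Section Basics.
Variables (k : fieldType) (d : int) (V : invSpace k d).

Lemma hel_inj i : injective (@hel k d V i).
Proof. by move=> x y /eqP; rewrite /hel eq_Tagged => /eqP. Qed.

Lemma wdeg_nil : wdeg ([::] : seq (helt V)) = 0.
Proof. by rewrite /wdeg big_nil. Qed.

Lemma wdeg_seq1 (x : helt V) : wdeg [:: x] = wdeg1 x.
Proof. by rewrite wdeg_cons wdeg_nil addr0. Qed.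

Lemma wdeg_rcons (u : seq (helt V)) x : wdeg (rcons u x) = wdeg u + wdeg1 x.
Proof. by rewrite -cats1 wdeg_cat wdeg_seq1. Qed.

Lemma par_wdeg (u : seq (helt V)) :
  par (wdeg u) = odd (size u) (+) par (\sum_(x <- u) tag x).
Proof.
elim: u => [|x u IH]; first by rewrite wdeg_nil big_nil.
rewrite wdeg_cons big_cons !parD parN IH par1 /=.
by case: (par (tag x)); case: (odd _); case: (par _).
Qed.

Lemma wdesusp_rcons (u : seq (helt V)) y :
  wdesusp (rcons u y) = wdesusp u + \sum_(x <- u) tag x.
Proof.
elim: u => [|x u IH] /=; first by rewrite mul0r big_nil.
by rewrite IH size_rcons big_cons -addn1 PoszD mulrDl mul1r addrACA.
Qed.

Lemma wpairs_rcons (u : seq (helt V)) y :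
  wpairs (rcons u y) = wpairs u + wdeg u * wdeg1 y.
Proof.
elim: u => [|x u IH] /=; first by rewrite wdeg_nil mulr0 mul0r.
rewrite IH wdeg_rcons wdeg_cons mulrDr [(wdeg1 x + _) * _]mulrDl -!addrA; congr (_ + _).
exact: addrCA.
Qed.

Lemma wdeg_same i (x y : V i) u v : wdeg (u ++ hel x :: v) = wdeg (u ++ hel y :: v).
Proof. by rewrite !wdeg_cat !wdeg_cons. Qed.

Section Values.
Variable R : lmodType k.
Implicit Types f g : tens V R.

Lemma tensNE f w : (- f) w = - f w.
Proof. by rewrite -[LHS]/(val (- f) w) raddfN. Qed.
Lemma tensBE f g w : (f - g) w = f w - g w.
Proof. by rewrite tensDE tensNE. Qed.
Lemma tens_sumE (I : Type) (r : seq I) (P : pred I) (F : I -> tens V R) w :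
  (\sum_(i <- r | P i) F i) w = \sum_(i <- r | P i) F i w.
Proof.
by elim/big_rec2: _ => [|i y x _ <-]; rewrite ?tens0E ?tensDE.
Qed.
Lemma starE f w :
  star f w = ksgn ((size w)%:Z + wpairs w) *: f (rev (map (@helt_star k d V) w)).
Proof. by []. Qed.

Lemma homog0 q : homog q (0 : tens V R).
Proof. by move=> w; rewrite tens0E eqxx. Qed.
Lemma homogP q f : homog q f <-> forall w, wdeg w != q -> f w = 0.
Proof.
split=> h w; first by move=> hw; apply/eqP; apply: contraTT hw => /h ->; rewrite eqxx.
by apply: contraNeq => /h ->.
Qed.
Lemma homogD q f g : homog q f -> homog q g -> homog q (f + g).
Proof. by rewrite !homogP => hf hg w hw; rewrite tensDE hf // hg // addr0. Qed.
Lemma homogZ q (a : k) f : homog q f -> homog q (a *: f).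
Proof. by rewrite !homogP => hf w hw; rewrite tensZE hf // scaler0. Qed.
Lemma homogB q f g : homog q f -> homog q g -> homog q (f - g).
Proof. by rewrite !homogP => hf hg w hw; rewrite tensBE hf // hg // subr0. Qed.
Lemma homog_sum q (I : Type) (r : seq I) (P : pred I) (F : I -> tens V R) :
  (forall i, P i -> homog q (F i)) -> homog q (\sum_(i <- r | P i) F i).
Proof. by move=> h; elim/big_ind: _ => //; [exact: homog0 | exact: homogD]. Qed.

Lemma mlin0 (f : seq (helt V) -> R) u i v :
  multilinear f -> f (u ++ hel (0 : V i) :: v) = 0.
Proof. by move=> mf; have := mf i (-1) 0 0 u v; rewrite scaleN1r oppr0 addr0 scaleN1r addNr. Qed.
Lemma mlinZ (f : seq (helt V) -> R) u i v (a : k) (x : V i) :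
  multilinear f -> f (u ++ hel (a *: x) :: v) = a *: f (u ++ hel x :: v).
Proof. by move=> mf; have := mf i a x 0 u v; rewrite addr0 mlin0 // addr0. Qed.
Lemma mlin_sum (f : seq (helt V) -> R) u i v (I : Type) (r : seq I) (a : I -> k) (x : I -> V i) :
  multilinear f ->
  f (u ++ hel (\sum_(j <- r) a j *: x j) :: v) =
    \sum_(j <- r) a j *: f (u ++ hel (x j) :: v).
Proof.
move=> mf; elim: r => [|j r IH]; first by rewrite !big_nil mlin0.
by rewrite !big_cons mf IH.
Qed.

(** Over a finite set of words only finitely many components of a tensor are
    nonzero; this is how homogeneity assumptions are removed. *)
Definition component (q : int) (f : tens V R) : tens V R.
Proof.
apply: (@mk_tens k d V R (fun w => if wdeg w == q then f w else 0)).
  move=> i a x y u v; rewrite (wdeg_same (a *: x + y) x) (wdeg_same y x).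
  by case: eqP => _; rewrite ?tens_multilinear // scaler0 addr0.
by rewrite tens_nil if_same.
Defined.

Lemma componentE q f w : component q f w = if wdeg w == q then f w else 0.
Proof. by []. Qed.

Lemma component_homog q f : homog q (component q f).
Proof. by apply/homogP => w /negbTE hw; rewrite componentE hw. Qed.

(** Contraction of all the letters but one: the result is an element of [W]. *)
Definition slot (u t : seq (helt V)) (f : tens V R) : tens V R.
Proof.
apply: (@mk_tens k d V R (fun w => if w is [:: y] then f (u ++ y :: t) else 0)) => //.
move=> i a x y [|z [|z' u']] [|t1 v] /=; rewrite ?scaler0 ?addr0 //.
exact: tens_multilinear.
Defined.

Lemma slotE u t f w : slot u t f w = if w is [:: y] then f (u ++ y :: t) else 0.
Proof. by []. Qed.

(** Contraction with a first letter.  Tensors vanish on the empty word, so a word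
    of length one contributes nothing. *)
Definition lead (x : helt V) (f : tens V R) : tens V R.
Proof.
apply: (@mk_tens k d V R (fun w => if w is [::] then 0 else f (x :: w))) => //.
move=> i a y z [|t u] v /=; first exact: (tens_multilinear f a y z [:: x]).
exact: (tens_multilinear f a y z [:: x, t & u]).
Defined.

Lemma leadE x f w : lead x f w = if w is [::] then 0 else f (x :: w).
Proof. by []. Qed.

End Values.

Lemma tprodE (R : comAlgType k) (f g : tens V R) w :
  tprod f g w = \sum_(i < (size w).+1) f (take i w) * g (drop i w).
Proof. by []. Qed.

Lemma tscaleE (R : comAlgType k) r (f : tens V R) w : tscale r f w = r * f w.
Proof. by []. Qed.

Lemma form_eltE (R : comAlgType k) (z : helt V) w :
  form_elt R z w = if w is [:: x] then (hform x z)%:A else 0.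
Proof. by []. Qed.

Lemma omegaE (R : comAlgType k) w : omega V R w =
  if w is [:: x; y] then (ksgn (tag x + wdeg1 x * wdeg1 y) * hform x y)%:A else 0.
Proof. by []. Qed.

(** ** Dual families *)

(** Induction on the set: when [x] is not yet expanded, the remainder of its
    expansion is added to the family, with a functional equal to one there. *)
Lemma dual_family_deg i (X : seq (helt V)) :
  exists B : seq ({linear V i -> k^o} * V i),
    forall v : V i, hel v \in X -> v = \sum_(b <- B) b.1 v *: b.2.
Proof.
elim: X => [|[j x] X [B hB]]; first by exists [::].
have [eij|/eqP nij] := eqVneq i j; last first.
  exists B => v; rewrite inE => /orP[/eqP /(congr1 (@tag _ _)) //=|]; last exact: hB.
subst j; pose P v := \sum_(b <- B) b.1 v *: b.2.
have [Px|nPx] := eqVneq (x - P x) 0.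
  exists B => v; rewrite inE => /orP[/eqP /hel_inj ->|]; last exact: hB.
  by apply/eqP; rewrite -subr_eq0 -/(P x) Px.
have [phi phi1] := functional_neq0 nPx.
have lin : linear (fun v => phi (v - P v) : k^o).
  move=> a v w; rewrite -linearP; congr (phi _); rewrite scalerBr addrACA -opprD.
  congr (_ - _); rewrite /P scaler_sumr -big_split /=; apply: eq_bigr => b _.
  by rewrite linearP scalerDl scalerA.
pose psi : {linear V i -> k^o} := HB.pack (fun v => phi (v - P v) : k^o)
  (GRing.isLinear.Build k (V i) k^o _ (fun v => phi (v - P v) : k^o) lin).
exists ((psi, x - P x) :: B) => v; rewrite inE big_cons /= => /orP[/eqP /hel_inj ->|/hB hv].
  by rewrite phi1 scale1r -/(P x) subrK.
by rewrite -/(P v) /P -hv subrr linear0 scale0r add0r.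
Qed.

Definition elt_of (i : int) (phi : {linear V i -> k^o}) : tens V k^o.
Proof.
apply: (@mk_tens k d V k^o (fun w => if w is [:: x] then untag (0 : k^o) (phi : V i -> k^o) x else 0)) => //.
move=> j a x y [|z [|z' u']] [|t1 v] /=; rewrite ?scaler0 ?addr0 //.
have [e|ne] := eqVneq j i; last by rewrite !untag_dflt ?scaler0 ?addr0.
move: phi; rewrite -e => phi.
have uE z : untag (0 : k^o) (phi : V j -> k^o) (hel z) = phi z.
  exact: (@untagE _ _ _ _ _ _ (hel z) erefl).
by rewrite !uE linearP.
Defined.

Lemma elt_of_hel i (phi : {linear V i -> k^o}) (x : V i) : elt_of phi [:: hel x] = phi x.
Proof. exact: (@untagE _ _ _ _ _ _ (hel x) erefl). Qed.

Lemma elt_of_size i (phi : {linear V i -> k^o}) w : size w != 1%N -> elt_of phi w = 0.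
Proof. by case: w => [|x [|y w]]. Qed.

Lemma elt_of_tag i (phi : {linear V i -> k^o}) x : tag x != i -> elt_of phi [:: x] = 0.
Proof. by move=> h; rewrite /= untag_dflt. Qed.

Lemma elt_of_homog i (phi : {linear V i -> k^o}) : homog (1 - i) (elt_of phi).
Proof.
move=> w; have [|/elt_of_size ->] := eqVneq (size w) 1%N; last by rewrite eqxx.
case: w => [|x [|//]] // _; have [e _|/elt_of_tag ->] := eqVneq (tag x) i.
  by rewrite wdeg_seq1 /wdeg1 e.
by rewrite eqxx.
Qed.

(** Linear functionals separate the points of [V i], so that finitely many letters
    can be expanded on finitely many vectors.  On finitely many words a tensor
    thus becomes a sum of products of homogeneous elements of [W] by tensors. *)
Lemma dual_family (X : seq (helt V)) :
  exists B : seq (tens V k^o * helt V),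
  [/\ forall b, b \in B -> homog (wdeg1 b.2) b.1,
      forall b w, b \in B -> size w != 1%N -> b.1 w = 0
    & forall (R : lmodType k) (f : seq (helt V) -> R) x u t, multilinear f -> x \in X ->
        f (u ++ x :: t) = \sum_(b <- B) (b.1 [:: x] : k) *: f (u ++ b.2 :: t)].
Proof.
pose B i := projT1 (cid (dual_family_deg i X)).
have hB i (v : V i) : hel v \in X -> v = \sum_(b <- B i) b.1 v *: b.2.
  by rewrite /B; case: cid => /= C; apply.
pose I := undup (map (@tag _ _) X).
have allI (P : pred (tens V k^o * helt V)) :
    (forall i (b : {linear V i -> k^o} * V i), P (elt_of b.1, hel b.2)) ->
    forall b, b \in [seq (elt_of b.1, hel b.2) | i <- I, b <- B i] -> P b.
  move=> h; apply/allP; elim: I => //= i I' IH; rewrite all_cat IH andbT all_map.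
  by elim: (B i) => //= b s ->; rewrite h.
exists [seq (elt_of b.1, hel b.2) | i <- I, b <- B i]; split.
- move=> b bB; apply/asboolP; move: b bB; apply: allI => i b.
  exact/asboolP/elt_of_homog.
- move=> b w bB hw; apply/eqP; move: b bB; apply: (allI (fun b => b.1 w == 0)) => i b.
  by rewrite elt_of_size.
move=> R f [i x] u t mf xX.
have iI : i \in I by rewrite mem_undup; apply/mapP; exists (Tagged (fun i => V i) x).
rewrite big_allpairs_dep /= (bigD1_seq i) ?undup_uniq //= [X in _ + X]big1 ?addr0.
  rewrite -/(hel x) {1}(hB i x xX) mlin_sum //; apply: eq_bigr => b _.
  by congr (_ *: _); exact/esym/elt_of_hel.
move=> j ji; rewrite big1 // => b _.
by rewrite [X in X *: _](@elt_of_tag j b.1 (hel x)) ?scale0r // eq_sym.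
Qed.
End Basics.

(** * Derivations over the ground field *)

Section Linear.
Variables (k : fieldType) (d : int) (V : invSpace k d) (R : afa k).
Variable D : tens V R -> tens V R.
Hypothesis Dlin : tlinear D.

Lemma tscale_alg (a : k) (f : tens V R) : tscale (a%:A) f = a *: f.
Proof. by apply: tensP => w; rewrite tscaleE tensZE -scalerAl mul1r. Qed.
Lemma tlinD f g : D (f + g) = D f + D g. Proof. exact: Dlin.1. Qed.
Lemma tlinS r f : D (tscale r f) = tscale r (D f). Proof. exact: Dlin.2. Qed.
Lemma tlinZ (a : k) f : D (a *: f) = a *: D f.
Proof. rewrite -tscale_alg tlinS. by rewrite tscale_alg. Qed.
Lemma tlin0 : D 0 = 0. Proof. by have := tlinZ 0 0; rewrite !scale0r. Qed.
Lemma tlinN f : D (- f) = - D f. Proof. by rewrite -scaleN1r tlinZ scaleN1r. Qed.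
Lemma tlinB f g : D (f - g) = D f - D g. Proof. by rewrite tlinD tlinN. Qed.
Lemma tlin_sum (I : Type) (r : seq I) (P : pred I) (F : I -> tens V R) :
  D (\sum_(i <- r | P i) F i) = \sum_(i <- r | P i) D (F i).
Proof.
by elim/big_rec2: _ => [|i y x _ <-]; rewrite ?tlin0 ?tlinD.
Qed.
End Linear.

Section GroundField.
Variables (k : fieldType) (d : int) (V : invSpace k d).
Notation T := (tens V (scalars k)).

(** Over [k], which is discrete, a continuous map has values depending on
    finitely many values of its argument. *)
Lemma tcont_scalars (D : T -> T) : tcont D <->
  forall w, exists L : seq (seq (helt V)),
    forall f : T, (forall u, u \in L -> f u = 0) -> D f w = 0.
Proof.
split=> [h w|h [] w].
  have [[] [L hL]] := h tt w; exists L => f hf.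
  by case: (hL f) => // u /hf ->; split; rewrite ?linear0.
have [L hL] := h w; exists tt, L => f hf.
by rewrite hL => [|u /hf[]//]; split; rewrite ?linear0.
Qed.

Section Cont.
Variables (D : T -> T) (Dlin : tlinear D) (Dcont : tcont D).

Definition tsupport w := projT1 (cid ((tcont_scalars D).1 Dcont w)).

Lemma tsupport_eq (f g : T) w : (forall u, u \in tsupport w -> f u = g u) -> D f w = D g w.
Proof.
rewrite /tsupport; case: cid => L hL /= fg; apply/eqP; rewrite -subr_eq0.
by rewrite -tensBE -(tlinB Dlin) hL // => u uL; rewrite tensBE fg // subrr.
Qed.
End Cont.

Lemma tprod_letter (phi g : T) x w :
  (forall u, size u != 1%N -> phi u = 0) -> tprod phi g (x :: w) = phi [:: x] * g w.
Proof.
move=> h; rewrite tprodE /= big_ord_recl /= tens_nil mul0r add0r big_ord_recl /=.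
rewrite take0 drop0 big1 ?addr0 // => i _; rewrite h ?mul0r //=.
by rewrite size_take; case: ifP => //; case: (w) i => [|y w'] [[] ].
Qed.

Lemma tprod_cons (f g : T) x w :
  tprod f g (x :: w) = \sum_(i < (size w).+1) f (x :: take i w) * g (drop i w).
Proof. by rewrite tprodE /= big_ord_recl /= tens_nil mul0r add0r. Qed.

(** By continuity [f] only matters on finitely many words, where it is a sum of
    products of an element of [W] by a tensor and of a tensor of length one;
    Leibniz' rule applies to each of the products. *)
Lemma derivation_cons p (D : T -> T) (f : T) x w : is_derivation p D ->
  D f (x :: w) = \sum_(i < (size w).+1) D (slot [::] (drop i w) f) (x :: take i w)
                 + ksgn (p * wdeg1 x) *: D (lead x f) w.
Proof.
case=> Dlin Dcont Dhom Dleib.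
pose L := tsupport Dcont.
(* the words at which a value of [D] is needed *)
pose ws := (x :: w) :: [seq x :: take i w | i <- iota 0 (size w).+1].
pose X := x :: flatten (flatten [seq L v | v <- ws]).
have XP v u y u' : v \in ws -> u \in L v -> u = y :: u' -> y \in X.
  move=> vws uL uE; rewrite inE; apply/orP; right; apply/flattenP; exists u; last first.
    by rewrite uE mem_head.
  by apply/flattenP; exists (L v) => //; exact: map_f.
have [B [Bhom Bsize Bdual]] := dual_family X.
(* the words of length one are not reached by the products *)
pose F := \sum_(b <- B) tprod (b.1 : T) (lead b.2 f) + slot [::] [::] f.
have -> : D f (x :: w) = D F (x :: w).
  apply: (tsupport_eq Dlin (Dcont := Dcont)) => -[|y u] uL; first by rewrite !tens_nil.
  have yX : y \in X by apply: (XP (x :: w) (y :: u) y u) => //; rewrite inE eqxx.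
  rewrite /F tensDE tens_sumE slotE.
  have -> : \sum_(b <- B) tprod (b.1 : T) (lead b.2 f) (y :: u) =
            \sum_(b <- B) (b.1 [:: y] : k) *: lead b.2 f u.
    by apply: eq_big_seq => b bB; rewrite tprod_letter // => v; exact: Bsize.
  case: u uL => [|z u] uL.
    by rewrite big1 ?add0r // => b _; rewrite leadE scaler0.
  by rewrite addr0 -(Bdual _ f y [::]) //; exact: tens_multilinear.
rewrite /F (tlinD Dlin) tensDE (tlin_sum Dlin) tens_sumE.
have -> : \sum_(b <- B) D (tprod (b.1 : T) (lead b.2 f)) (x :: w) =
  \sum_(b <- B) \sum_(i < (size w).+1) D (b.1 : T) (x :: take i w) * lead b.2 f (drop i w)
  + \sum_(b <- B) ksgn (p * wdeg1 b.2) *: ((b.1 : T) [:: x] * D (lead b.2 f) w).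
  rewrite -big_split; apply: eq_big_seq => b bB /=.
  rewrite (Dleib _ _ _ (Bhom b bB)) tensDE tensZE tprod_cons; congr (_ + _ *: _).
  by rewrite tprod_letter // => v; exact: Bsize.
rewrite addrAC; congr (_ + _); last first.
  have -> : lead x f = \sum_(b <- B) (b.1 [:: x] : k) *: lead b.2 f.
    apply: tensP => -[|y u]; rewrite tens_sumE.
      by rewrite tens_nil big1 // => b _; rewrite tens_nil.
    rewrite leadE (Bdual _ f x [::]) ?mem_head //; last exact: tens_multilinear.
  rewrite (tlin_sum Dlin) tens_sumE scaler_sumr; apply: eq_big_seq => b bB.
  rewrite (tlinZ Dlin) tensZE -[X in _ = _ *: X]/((b.1 : T) [:: x] * D (lead b.2 f) w).
  have [->|nz] := eqVneq ((b.1 : T) [:: x]) 0; first by rewrite !mul0r !scaler0.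
  have := Bhom b bB [:: x] nz; rewrite wdeg_seq1 => ->.
  by [].
rewrite exchange_big [RHS]big_ord_recr /= [X in X + _ = _]big_ord_recr /= !drop_size take_size.
rewrite [X in _ + X + _]big1 => [|b _]; last by rewrite mulr0.
rewrite addr0; congr (_ + _); apply: eq_bigr => i _.
have dN : drop i w <> [::].
  by move=> /(congr1 size); rewrite size_drop /= => /eqP; rewrite subn_eq0 leqNgt ltn_ord.
transitivity (D (\sum_(b <- B) (f (b.2 :: drop i w) : k) *: (b.1 : T)) (x :: take i w)).
  rewrite (tlin_sum Dlin) tens_sumE; apply: eq_bigr => b _.
  rewrite (tlinZ Dlin) tensZE; case: (drop i w) dN => // z u _.
  by rewrite mulrC.
apply: (tsupport_eq Dlin (Dcont := Dcont)) => u uL.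
have [|u1] := eqVneq (size u) 1%N; last first.
  rewrite tens_sumE big_seq big1; last by move=> b bB; rewrite tensZE Bsize // scaler0.
  by rewrite slotE; case: (u) u1 => [|z [|z' u']].
case: u uL => [|y [|//]] // uL _; rewrite tens_sumE slotE /=.
rewrite (Bdual _ f y [::] (drop i w)); first last.
- apply: (XP (x :: take i w) [:: y] y [::]) => //; rewrite inE; apply/orP; right.
  by apply/mapP; exists (nat_of_ord i) => //; rewrite mem_iota /= add0n ltnS ltnW.
- exact: tens_multilinear.
by apply: eq_bigr => b _; rewrite -[LHS]tensZE; exact: mulrC.
Qed.
End GroundField.

(** * Cyclic derivations over the ground field *)

Section Cyclic.
Variables (k : fieldType) (d : int) (V : invSpace k d).

Section FormElt.
Variable R : comAlgType k.

Lemma form_eltP i (a : k) (x y : V i) :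
  form_elt R (hel (a *: x + y)) = a *: form_elt R (hel x) + form_elt R (hel y).
Proof.
apply: tensP => w; rewrite tensDE tensZE !form_eltE.
case: w => [|z [|z' w]]; rewrite ?scaler0 ?addr0 //.
rewrite scalerA -scalerDl; congr (_ *: _).
by rewrite /hform is_formC is_formDl mulrDr mulrCA -!is_formC.
Qed.

Lemma hform_deg (x z : helt V) : hform x z != 0 -> tag x = - d - tag z.
Proof.
move=> h; apply/eqP; rewrite -(inj_eq (addIr (tag z))) subrK; apply: contraNT h => h.
by rewrite /hform is_form_deg.
Qed.

Lemma form_elt_homog (z : helt V) : homog (d + 1 + tag z) (form_elt R z).
Proof.
move=> w; rewrite form_eltE; case: w => [|x [|y w]]; rewrite ?eqxx //.
have [->|/hform_deg e _] := eqVneq (hform x z) 0; first by rewrite scale0r eqxx.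
by rewrite wdeg_seq1 /wdeg1 e opprD !opprK addrCA addrA.
Qed.
End FormElt.

Notation T := (tens V (scalars k)).

Lemma hform_sym (x y : helt V) : hform x y = ksgn (tag x * tag y) * hform y x.
Proof. exact: is_formC. Qed.

Lemma hat_formE p (D : T -> T) w z : hat_form p D w z =
  ksgn (wdesusp w + p * (d + 1 + tag z) + wpairs w) *: D (form_elt (scalars k) z) w.
Proof. by []. Qed.

(** The signs of the desuspensions occur on both sides and cancel, leaving the
    degrees in [W] only. *)
Lemma is_cyclicE p (D : T -> T) : is_cyclic p D <-> forall u y z,
  D (form_elt _ z) (rcons u y) =
    ksgn (wdeg1 y * (wdeg u + wdeg1 z) + (p + 1) * (wdeg1 y + wdeg1 z)) *:
      D (form_elt _ y) (z :: u) :> k^o.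
Proof.
have sgnS n : (-1) ^+ n = ksgn n%:Z :> k by [].
suff h u y z : hat_form p D (rcons u y) z =
      ksgn (tag z * (\sum_(x <- rcons u y) tag x)) *:
      ((-1) ^+ (size u).+1 *: hat_form p D (z :: u) y) <->
   D (form_elt _ z) (rcons u y) =
    ksgn (wdeg1 y * (wdeg u + wdeg1 z) + (p + 1) * (wdeg1 y + wdeg1 z)) *:
      D (form_elt _ y) (z :: u) :> k^o.
  by split=> H u y z; apply/h/H.
rewrite !hat_formE sgnS !scalerA -!ksgnD.
set A := (wdesusp (rcons u y) + _ + _); set B := (X in _ = ksgn X *: _ <-> _).
set C := (X in _ <-> _ = ksgn X *: _).
have parE : par B = par A (+) par C.
  rewrite /A /B /C /= wdesusp_rcons wpairs_rcons !big_rcons /=.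
  rewrite ?(parD, parM, parN, par_nat, par1) par_wdeg.
  by par_cases.
have -> : ksgn B = ksgn A * ksgn C :> k by rewrite !ksgnE parE signr_addb.
by rewrite -scalerA; split=> [/ksgn_inj_scale|->].
Qed.

(** The two contractions of [omega] with a letter. *)
Lemma slot_omega (y : helt V) :
  slot [::] [:: y] (omega V (scalars k)) =
    ksgn (1 + d * tag y) *: form_elt (scalars k) y.
Proof.
apply: tensP => w; rewrite tensZE slotE form_eltE.
case: w => [|x [|x' w]]; rewrite ?scaler0 // omegaE /= scalerA.
have [->|/hform_deg e] := eqVneq (hform x y) 0; first by rewrite !mulr0.
by congr (_ * _ *: _); apply: ksgn_par; rewrite /wdeg1 e; par_cases.
Qed.

Lemma lead_omega (x : helt V) :
  lead x (omega V (scalars k)) = ksgn (1 + d + tag x) *: form_elt (scalars k) x.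
Proof.
apply: tensP => w; rewrite tensZE leadE form_eltE.
case: w => [|y [|y' w]]; rewrite ?scaler0 // omegaE /= scalerA.
have [e|] := eqVneq (hform y x) 0; first by rewrite hform_sym e !mulr0.
move=> /hform_deg e; rewrite hform_sym mulrA -ksgnD; congr (_ * _ *: _).
by apply: ksgn_par; rewrite /wdeg1 e; par_cases.
Qed.

Lemma omega_size (w : seq (helt V)) : (size w != 2)%N -> omega V (scalars k) w = 0.
Proof. by case: w => [|x [|y [|z w]]]. Qed.

Lemma slot_omega0 (u t : seq (helt V)) :
  (size u + size t != 1)%N -> slot u t (omega V (scalars k)) = 0.
Proof.
move=> h; apply: tensP => w; rewrite tens0E slotE.
case: w => [|x [|x' w]] //; rewrite omega_size // size_cat /=.
by rewrite addnS eqSS.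
Qed.

Section Derivation.
Variables (p : int) (D : T -> T).
Hypothesis Dder : is_derivation p D.

Let Dlin : tlinear D. Proof. by case: Dder. Qed.
Let Dhom q f : homog q f -> homog (q + p) (D f). Proof. by case: Dder => ? ? h _; exact: h. Qed.

Lemma form_deg (w : seq (helt V)) (z : helt V) :
  D (form_elt _ z) w != 0 -> wdeg w = d + 1 + tag z + p.
Proof. by apply: Dhom; exact: form_elt_homog. Qed.

(** As [omega] has length two, only the subwords missing exactly the first or the
    last letter contribute. *)
Lemma derivation_omega x v y :
  D (omega V (scalars k)) (x :: rcons v y) =
    ksgn (1 + d * tag y) *: D (form_elt (scalars k) y) (x :: v)
    + ksgn (p * wdeg1 x + 1 + d + tag x) *: D (form_elt (scalars k) x) (rcons v y).
Proof.
rewrite (derivation_cons _ _ _ Dder) lead_omega (tlinZ Dlin) tensZE scalerA -ksgnD !addrA.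
congr (_ + _); rewrite (bigD1 (inord (size v))) //= [X in _ + X]big1 ?addr0.
  rewrite inordK ?size_rcons ?ltnS ?leqnSn //.
  rewrite -cats1 take_size_cat // drop_size_cat // slot_omega (tlinZ Dlin).
  exact: tensZE.
move=> i ni; rewrite slot_omega0 ?(tlin0 Dlin) ?tens0E //= size_drop.
have szv : size (rcons v y) = (size v).+1 by rewrite size_rcons.
apply: contra ni; rewrite add0n => /eqP h; apply/eqP/val_inj => /=.
by rewrite inordK ?szv //; have := ltn_ord i; lia.
Qed.

Lemma derivation_omega1 w : (size w <= 1)%N -> D (omega V (scalars k)) w = 0.
Proof.
case: w => [|x [|//]] _; first exact: tens_nil.
rewrite (derivation_cons _ _ _ Dder) big_ord1 /= tens_nil scaler0 addr0.
by rewrite slot_omega0 // (tlin0 Dlin) tens0E.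
Qed.

(** Both conditions say that the function [<\hat D(x_1, ..., x_n), x_(n+1)>] is
    invariant under rotation. *)
Lemma cyclic_omega : is_cyclic p D <-> D (omega V (scalars k)) = 0.
Proof.
rewrite is_cyclicE.
suff h v x y : D (form_elt _ x) (rcons v y) =
    ksgn (wdeg1 y * (wdeg v + wdeg1 x) + (p + 1) * (wdeg1 y + wdeg1 x)) *:
      D (form_elt _ y) (x :: v) :> k^o <-> D (omega V (scalars k)) (x :: rcons v y) = 0.
  split=> H; last by move=> u y z; apply/h; rewrite H tens0E.
  apply: tensP => w; rewrite tens0E; case: w => [|x w]; first exact: tens_nil.
  by case: (lastP w) => [|v y]; [exact: derivation_omega1|apply/h/H].
rewrite derivation_omega.
set A := D (form_elt _ y) (x :: v); set B := D (form_elt _ x) (rcons v y).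
set e := (X in B = ksgn X *: _ <-> _).
have [A0|nA] := eqVneq A 0.
  rewrite A0 !scaler0 add0r; split=> [->|]; first by rewrite scaler0.
  by move=> h; apply: (@ksgn_inj_scale k k^o (p * wdeg1 x + 1 + d + tag x)); rewrite scaler0.
have /(congr1 par) := form_deg nA; rewrite wdeg_cons => dg.
have -> : ksgn e *: A = ksgn (p * wdeg1 x + 1 + d + tag x) *: - (ksgn (1 + d * tag y) *: A).
  rewrite -scaleN1r !scalerA -[-1]/(ksgn 1 : k) -!ksgnD; congr (_ *: _).
  apply: ksgn_par; move: dg; rewrite /e ?(parD, parM, parN, par_nat, par0, par1) /=.
  case: (par (tag x)); case: (par (tag y)); case: (par p); case: (par d); by case: (par (wdeg v)).
split=> [->|].
  by rewrite scalerA ksgnK scale1r subrr.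
move/eqP; rewrite addrC addr_eq0 => /eqP/(congr1 ( *:%R (ksgn (p * wdeg1 x + 1 + d + tag x)))).
by rewrite scalerA ksgnK scale1r.
Qed.
End Derivation.
End Cyclic.

(** * Continuous maps and brackets of derivations *)

Section Neighbourhoods.
Variables (k : fieldType) (R : afa k).
Implicit Types (i : afa_I R) (r s : R).

Lemma nbhs0_0 i : afa_nbhs0 i 0. Proof. by split; rewrite linear0. Qed.
Lemma nbhs0D i r s : afa_nbhs0 i r -> afa_nbhs0 i s -> afa_nbhs0 i (r + s).
Proof. by move=> [r1 r2] [s1 s2]; split; rewrite linearD /= ?r1 ?r2 ?s1 ?s2 addr0. Qed.
Lemma nbhs0Z i (a : k) r : afa_nbhs0 i r -> afa_nbhs0 i (a *: r).
Proof. by move=> [r1 r2]; split; rewrite linearZ /= ?r1 ?r2 scaler0. Qed.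
Lemma nbhs0B i r s : afa_nbhs0 i r -> afa_nbhs0 i s -> afa_nbhs0 i (r - s).
Proof. by move=> hr hs; apply: nbhs0D => //; rewrite -scaleN1r; exact: nbhs0Z. Qed.
Lemma nbhs0_sum i (I : Type) (s : seq I) (P : pred I) (F : I -> R) :
  (forall j, P j -> afa_nbhs0 i (F j)) -> afa_nbhs0 i (\sum_(j <- s | P j) F j).
Proof. by move=> h; elim/big_ind: _ => //; [exact: nbhs0_0 | exact: nbhs0D]. Qed.
Lemma nbhs0_le i j r : afa_le i j -> afa_nbhs0 j r -> afa_nbhs0 i r.
Proof. by move=> ij [r1 r2]; split=> //; rewrite -(afa_pr_tr r ij) r2 linear0. Qed.

(** The projections are extended by [0] to the unit, so that they factor
    through the projection onto the augmentation ideal. *)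
Lemma pr_alg i (a : k) : afa_pr i a%:A = 0.
Proof. by rewrite linearZ /= afa_pr1 scaler0. Qed.
Lemma eps_alg (a : k) : afa_eps R a%:A = a.
Proof. by rewrite linearZ /= rmorph1; exact: mulr1. Qed.

Definition augm r : R := r - (afa_eps R r)%:A.
Lemma eps_augm r : afa_eps R (augm r) = 0.
Proof. by rewrite /augm linearB /= eps_alg subrr. Qed.
Lemma pr_augm i r : afa_pr i (augm r) = afa_pr i r.
Proof. by rewrite /augm linearB /= pr_alg subr0. Qed.
Lemma augmK r : (afa_eps R r)%:A + augm r = r.
Proof. by rewrite addrC subrK. Qed.

Lemma pr_mul i r s : afa_pr i (r * s) =
  (afa_eps R r : k) *: afa_pr i s + (afa_eps R s : k) *: afa_pr i r
  + na_mul (afa_pr i r) (afa_pr i s).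
Proof.
have -> : r * s = ((afa_eps R r : k) * afa_eps R s)%:A + (afa_eps R r : k) *: augm s
                  + (afa_eps R s : k) *: augm r + augm r * augm s.
  rewrite -{1}(augmK r) -{1}(augmK s); move: (augm r) (augm s) (afa_eps R r) (afa_eps R s).
  move=> x y a b; rewrite mulrDl !mulrDr -!scalerAl -!scalerAr !mul1r mulr1.
  by rewrite scalerA !addrA.
rewrite 3!linearD /= pr_alg add0r afa_prM ?eps_augm // 2!linearZ /=.
by rewrite !pr_augm.
Qed.

Lemma na_mul0l (A : nilAlg k) (x : A) : na_mul 0 x = 0.
Proof. by have := na_mulDl (-1) 0 0 x; rewrite scaler0 addr0 scaleN1r addNr. Qed.
Lemma na_mul0r (A : nilAlg k) (x : A) : na_mul x 0 = 0.
Proof. by rewrite na_mulC na_mul0l. Qed.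

Lemma nbhs0Ml i r s : afa_nbhs0 i s -> afa_nbhs0 i (r * s).
Proof.
move=> [s1 s2]; split; first by rewrite rmorphM /= s1 mulr0.
by rewrite pr_mul s1 s2 scaler0 scale0r na_mul0r !addr0.
Qed.

(** By uniqueness in the limit property, only zero has zero projections. *)
Lemma nbhs0_sep r : (forall i, afa_nbhs0 i r) -> r = 0.
Proof.
move=> h; have [i0] := afa_inh R.
have [|s [_ su]] := @afa_lim k R (fun i => 0) _.
  by move=> i j _; rewrite linear0.
rewrite -(su r); last by split=> [|i]; [case: (h i0) | case: (h i)].
by apply: su; split=> [|i]; rewrite linear0.
Qed.

Lemma nbhs0_eq r s : (forall i, afa_nbhs0 i (r - s)) -> r = s.
Proof. by move=> h; apply/eqP; rewrite -subr_eq0; apply/eqP/nbhs0_sep. Qed.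

Lemma eps_pr_eq r s : afa_eps R r = afa_eps R s ->
  (forall i, afa_pr i r = afa_pr i s) -> r = s.
Proof.
by move=> h1 h2; apply: nbhs0_eq => i; split; rewrite linearB /= ?h1 ?h2 subrr.
Qed.
End Neighbourhoods.

Section Tprod.
Variables (k : fieldType) (d : int) (V : invSpace k d) (R : comAlgType k).
Implicit Types f g h : tens V R.

Lemma tprodDl f g h : tprod (f + g) h = tprod f h + tprod g h.
Proof.
apply: tensP => w; rewrite tensDE !tprodE -big_split; apply: eq_bigr => i _.
by rewrite tensDE mulrDl.
Qed.
Lemma tprodDr f g h : tprod f (g + h) = tprod f g + tprod f h.
Proof.
apply: tensP => w; rewrite tensDE !tprodE -big_split; apply: eq_bigr => i _.
by rewrite tensDE mulrDr.
Qed.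
Lemma tprodSl r f g : tprod (tscale r f) g = tscale r (tprod f g).
Proof.
apply: tensP => w; rewrite tscaleE !tprodE mulr_sumr; apply: eq_bigr => i _.
by rewrite tscaleE mulrA.
Qed.
Lemma tprodSr r f g : tprod f (tscale r g) = tscale r (tprod f g).
Proof.
apply: tensP => w; rewrite tscaleE !tprodE mulr_sumr; apply: eq_bigr => i _.
by rewrite tscaleE mulrCA.
Qed.
Lemma tprodZl (a : k) f g : tprod (a *: f) g = a *: (tprod f g).
Proof.
apply: tensP => w; rewrite tensZE !tprodE scaler_sumr; apply: eq_bigr => i _.
by rewrite tensZE scalerAl.
Qed.
Lemma tprodZr (a : k) f g : tprod f (a *: g) = a *: (tprod f g).
Proof.
apply: tensP => w; rewrite tensZE !tprodE scaler_sumr; apply: eq_bigr => i _.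
by rewrite tensZE scalerAr.
Qed.
Lemma tprodNl f g : tprod (- f) g = - (tprod f g).
Proof. by rewrite -scaleN1r tprodZl scaleN1r. Qed.
Lemma tprodNr f g : tprod f (- g) = - (tprod f g).
Proof. by rewrite -scaleN1r tprodZr scaleN1r. Qed.
Lemma tscaleDr r f g : tscale r (f + g) = tscale r f + tscale r g.
Proof. by apply: tensP => w; rewrite tensDE !tscaleE tensDE mulrDr. Qed.
Lemma tscaleZ r (a : k) f : tscale r (a *: f) = a *: tscale r f.
Proof. by apply: tensP => w; rewrite tensZE !tscaleE tensZE scalerAr. Qed.
Lemma starD f g : star (f + g) = star f + star g.
Proof. by apply: tensP => w; rewrite tensDE !starE tensDE scalerDr. Qed.
Lemma starS r f : star (tscale r f) = tscale r (star f).
Proof. by apply: tensP => w; rewrite tscaleE !starE tscaleE scalerAr. Qed.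
End Tprod.

Section Operators.
Variables (k : fieldType) (d : int) (V : invSpace k d).

Section Cont.
Variables (R S Q : afa k).

Lemma tcont_comb (a : k) (D E : tens V R -> tens V S) :
  tcont D -> tcont E -> tcont (fun f => a *: D f + E f).
Proof.
move=> hD hE j w; have [i [L hL]] := hD j w; have [i' [L' hL']] := hE j w.
have [l il il'] := afa_dir i i'; exists l, (L ++ L') => f hf.
rewrite tensDE tensZE; apply: nbhs0D; first apply: nbhs0Z.
  by apply: hL => u uL; apply: nbhs0_le il _; apply: hf; rewrite mem_cat uL.
by apply: hL' => u uL; apply: nbhs0_le il' _; apply: hf; rewrite mem_cat uL orbT.
Qed.

Lemma tcont_comp (D : tens V S -> tens V Q) (E : tens V R -> tens V S) :
  tcont D -> tcont E -> tcont (fun f => D (E f)).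
Proof.
move=> hD hE j w; have [i [L hL]] := hD j w.
suff [l [M hM]] : exists (l : afa_I R) (M : seq (seq (helt V))), forall f : tens V R,
    (forall u, u \in M -> afa_nbhs0 l (f u)) ->
    forall u, u \in L -> afa_nbhs0 i (E f u).
  by exists l, M => f /hM; exact: hL.
elim: L {hL} => [|v L [l [M hM]]]; first by have [l] := afa_inh R; exists l, [::].
have [l' [M' hM']] := hE i v; have [l2 h1 h2] := afa_dir l l'.
exists l2, (M ++ M') => f hf u; rewrite inE => /orP[/eqP ->|].
  by apply: hM' => x xM; apply: nbhs0_le h2 _; apply: hf; rewrite mem_cat xM orbT.
by apply: hM => x xM; apply: nbhs0_le h1 _; apply: hf; rewrite mem_cat xM.
Qed.
End Cont.

Variable R : afa k.
Notation TR := (tens V R).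
Implicit Types D E : TR -> TR.

Lemma tlinear_comb (a : k) D E : tlinear D -> tlinear E -> tlinear (fun f => a *: D f + E f).
Proof.
move=> hD hE; split=> [f g|r f].
  by rewrite (tlinD hD) (tlinD hE) scalerDr addrACA.
by rewrite (tlinS hD) (tlinS hE) tscaleDr tscaleZ.
Qed.
Lemma tlinear_comp D E : tlinear D -> tlinear E -> tlinear (fun f => D (E f)).
Proof. by move=> hD hE; split=> [f g|r f];
  rewrite ?(tlinD hE) ?(tlinD hD) ?(tlinS hE) ?(tlinS hD). Qed.

Lemma derivation_comb p (a : k) D E : is_derivation p D -> is_derivation p E ->
  is_derivation p (fun f => a *: D f + E f).
Proof.
move=> [Dl Dc Dh DL] [El Ec Eh EL]; split.
- exact: tlinear_comb.
- exact: tcont_comb.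
- by move=> q f hf; apply: homogD; [apply: homogZ; exact: Dh | exact: Eh].
move=> q f g hf; rewrite (DL q) // (EL q) // tprodDl tprodDr tprodZl tprodZr.
by rewrite !scalerDr !scalerA [a * _]mulrC addrACA.
Qed.

Lemma derivation0 p : is_derivation p (fun _ : TR => 0).
Proof.
split.
- split=> [f g|r f]; first by rewrite addr0.
  by apply: tensP => w; rewrite tscaleE tens0E mulr0.
- by move=> j w; have [i] := afa_inh R; exists i, [::] => f _; rewrite tens0E; exact: nbhs0_0.
- by move=> q f _; exact: homog0.
- move=> q f g _; rewrite -[0]/(0 : TR) -(scale0r (0 : TR)) tprodZl tprodZr !scale0r.
  by rewrite scaler0 addr0.
Qed.

Definition bracket p q D E : TR -> TR :=
  fun f => D (E f) - ksgn (p * q) *: E (D f).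

Lemma bracketE p q D E f : bracket p q D E f = - ksgn (p * q) *: E (D f) + D (E f).
Proof. by rewrite scaleNr addrC. Qed.

Lemma tlinear_bracket p q D E : tlinear D -> tlinear E -> tlinear (bracket p q D E).
Proof.
move=> hD hE; rewrite (funext (bracketE p q D E)).
by apply: tlinear_comb; exact: tlinear_comp.
Qed.
Lemma tcont_bracket p q D E : tcont D -> tcont E -> tcont (bracket p q D E).
Proof.
move=> hD hE; rewrite (funext (bracketE p q D E)).
by apply: tcont_comb; exact: tcont_comp.
Qed.

Lemma derivation_bracket p q D E : is_derivation p D -> is_derivation q E ->
  is_derivation (p + q) (bracket p q D E).
Proof.
move=> [Dl Dc Dh DL] [El Ec Eh EL]; split.
- exact: tlinear_bracket.
- exact: tcont_bracket.
- move=> r f hf; apply: homogB; last apply: homogZ.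
    by rewrite [p + q]addrC addrA; apply/Dh/Eh.
  by rewrite addrA; apply/Eh/Dh.
move=> r f g hf; rewrite /bracket (EL r) // (DL r) //.
rewrite !(tlinD Dl) !(tlinD El) (tlinZ Dl) (tlinZ El).
rewrite (DL _ _ _ (Eh _ _ hf)) (EL _ _ _ (Dh _ _ hf)) (DL r) // (EL r) // tprodDl tprodDr tprodNl tprodNr tprodZl tprodZr.
have -> : (p + q) * r = p * r + q * r by rewrite mulrDl.
have -> : p * (r + q) = p * r + p * q by rewrite mulrDr.
have -> : q * (r + p) = q * r + p * q by rewrite mulrDr [q * p]mulrC.
rewrite !ksgnD; apply: tensP => w; rewrite !(tensDE, tensNE, tensZE).
set a1 := tprod (D (E f)) g w; set a2 := tprod (E f) (D g) w.
set a3 := tprod (D f) (E g) w; set a4 := tprod f (D (E g)) w.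
set a5 := tprod (E (D f)) g w; set a6 := tprod f (E (D g)) w.
rewrite !ksgnE; case: (par (p * q)); case: (par (p * r)); case: (par (q * r));
  rewrite /= ?(expr0, expr1, mulr1, mul1r, mulrNN, mulN1r) ?(scale1r, scaleN1r); ring.
Qed.
End Operators.

(** * The differential graded Lie algebra *)
Section DgLie.
Variables (k : fieldType) (d : int) (V : invSpace k d).
Notation T := (tens V (scalars k)).
Notation Der := (@Der_cycl k d V (scalars k)).

(** In this form cyclicity is visibly stable under combinations and brackets. *)
Lemma Der_cyclP p (D : T -> T) : Der p D <->
  [/\ is_derivation p D, D (omega V (scalars k)) = 0 & forall f, D (star f) = star (D f)].
Proof. by split=> -[h1 h2 h3]; split=> //; apply/(cyclic_omega h1). Qed.

Lemma Der_comb p (a : k) D E : Der p D -> Der p E -> Der p (fun f => a *: D f + E f).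
Proof.
move=> /Der_cyclP[D1 D2 D3] /Der_cyclP[E1 E2 E3]; apply/Der_cyclP; split.
- exact: derivation_comb.
- by rewrite D2 E2 scaler0 addr0.
- by move=> f; rewrite D3 E3 starD starZ.
Qed.

Lemma Der0 p : Der p (fun=> 0).
Proof.
apply/Der_cyclP; split=> //; first exact: derivation0.
by move=> f; rewrite -(scale0r 0) starZ !scale0r.
Qed.

Lemma Der_bracket p q D E : Der p D -> Der q E -> Der (p + q) (bracket p q D E).
Proof.
move=> /Der_cyclP[D1 D2 D3] /Der_cyclP[E1 E2 E3]; apply/Der_cyclP; split.
- exact: derivation_bracket.
- case: D1 E1 => Dl _ _ _ [El _ _ _].
  by rewrite /bracket D2 E2 (tlin0 Dl) (tlin0 El) scaler0 subr0.
- by move=> f; rewrite /bracket D3 E3 D3 E3 starD -!scaleN1r !starZ.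
Qed.

Lemma Der_lin p D : Der p D -> tlinear D. Proof. by case=> -[]. Qed.

Lemma scaleE (a : k) (x : scalars k) : a *: x = (a : scalars k) * x.
Proof. by []. Qed.

(** Identities between signed sums, checked on each word and for all values of
    the signs. *)
Ltac sgn_lin := apply: tensP => w; rewrite ?(tensDE, tensNE, tensZE, tens0E) ?scaleE;
  rewrite ?ksgnE ?par1;
  repeat match goal with |- context [par ?n] => case: (par n) end;
  rewrite ?(expr0, expr1); ring.

Section Identities.
Variables (x y z : T -> T) (xl : tlinear x) (yl : tlinear y) (zl : tlinear z).
Variables p q r : int.

Lemma bracket_lin (a : k) f :
  bracket p q (fun g => a *: x g + y g) z f =
  a *: bracket p q x z f + bracket p q y z f.
Proof. rewrite /bracket (tlinD zl) (tlinZ zl); sgn_lin. Qed.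

Lemma bracket_linr (a : k) f :
  bracket p q z (fun g => a *: x g + y g) f =
  a *: bracket p q z x f + bracket p q z y f.
Proof. rewrite /bracket (tlinD zl) (tlinZ zl); sgn_lin. Qed.

Lemma bracketC f : bracket p q x y f = - ksgn (p * q) *: bracket q p y x f.
Proof. rewrite /bracket [q * p]mulrC; sgn_lin. Qed.

Lemma bracket_jacobi f :
  bracket p (q + r) x (bracket q r y z) f =
    bracket (p + q) r (bracket p q x y) z f
    + ksgn (p * q) *: bracket q (p + r) y (bracket p r x z) f.
Proof.
rewrite /bracket (tlinB xl) (tlinB yl) (tlinB zl) (tlinZ xl) (tlinZ yl) (tlinZ zl).
have -> : (p + q) * r = p * r + q * r by rewrite mulrDl.
have -> : q * (p + r) = p * q + q * r by rewrite mulrDr [q * p]mulrC.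
have -> : p * (q + r) = p * q + p * r by rewrite mulrDr.
rewrite !ksgnD; sgn_lin.
Qed.

Variables (m : T -> T) (ml : tlinear m).

Lemma bracket_sqr f : (forall g, m (m g) = 0) ->
  bracket 1 (p + 1) m (bracket 1 p m x) f = 0.
Proof.
move=> mm; rewrite /bracket (tlinB ml) (tlinZ ml) !mm (tlin0 xl) !mul1r ksgnD.
sgn_lin.
Qed.

Lemma bracket_leibniz f :
  bracket 1 (p + q) m (bracket p q x y) f =
  bracket (p + 1) q (bracket 1 p m x) y f
  + ksgn p *: bracket p (q + 1) x (bracket 1 q m y) f.
Proof.
rewrite /bracket (tlinB xl) (tlinB yl) (tlinB ml) (tlinZ xl) (tlinZ yl) (tlinZ ml).
rewrite [(p + 1) * q]mulrDl [p * (q + 1)]mulrDr !mul1r mulr1 !ksgnD; sgn_lin.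
Qed.
End Identities.

Variables (m : T -> T) (hm : cycl_Ainf m).

Lemma Der_dgLie_is_dgLie : is_dgLie (Der_dgLie m).
Proof.
have [m1 mm] := hm; have ml := Der_lin m1.
split.
- by move=> p; split; [exact: Der0 | move=> a x y; exact: Der_comb].
- split=> [p q x y|p x] hx; first exact: Der_bracket.
  by rewrite addrC; exact: Der_bracket.
- split=> [p q a x y z hx hy hz|p a x y hx hy]; apply: funext => f.
    exact: (bracket_lin x y (Der_lin hz)).
  exact: (bracket_linr x y ml).
- split=> [p q x y hx hy|p q r x y z hx hy hz]; apply: funext => f.
    exact: (bracketC x y p q f).
  exact: (bracket_jacobi (Der_lin hx) (Der_lin hy) (Der_lin hz)).
split=> [p x hx|p q x y hx hy]; apply: funext => f.
  exact: (bracket_sqr (Der_lin hx) p ml f mm).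
exact: (bracket_leibniz (Der_lin hx) (Der_lin hy) p q ml).
Qed.
End DgLie.

(** * Extension of scalars *)

Lemma vectP (k : fieldType) (U : vectType k) (x y : U) :
  (forall i, coord (vbasis {:U}) i x = coord (vbasis {:U}) i y) -> x = y.
Proof.
by move=> h; rewrite (coord_vbasis (memvf x)) (coord_vbasis (memvf y));
  apply: eq_bigr => i _; rewrite h.
Qed.

(** ** The finite dimensional quotients of a coefficient algebra *)
Section Unitization.
Variables (k : fieldType) (A : nilAlg k).

(** The target of the coefficient algebra at a finite level, where the
    augmentation is kept along with the projection. *)
Definition unitz : vectType k := (k^o * A)%type.
Implicit Types x y z : unitz.

Definition bmul x y : unitz :=
  (x.1 * y.1, (x.1 : k) *: y.2 + (y.1 : k) *: x.2 + na_mul x.2 y.2).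
Definition bone : unitz := (1, 0).

Lemma na_mulZl (a : k) (x y : A) : na_mul (a *: x) y = a *: na_mul x y.
Proof. by have := na_mulDl a x 0 y; rewrite addr0 na_mul0l addr0. Qed.
Lemma na_mulZr (a : k) (x y : A) : na_mul x (a *: y) = a *: na_mul x y.
Proof. by rewrite ![na_mul x _]na_mulC na_mulZl. Qed.
Lemma na_mulAl (x y z : A) : na_mul (x + y) z = na_mul x z + na_mul y z.
Proof. by have := na_mulDl 1 x y z; rewrite !scale1r. Qed.
Lemma na_mulAr (x y z : A) : na_mul z (x + y) = na_mul z x + na_mul z y.
Proof. by rewrite ![na_mul z _]na_mulC na_mulAl. Qed.

Lemma bmulC x y : bmul x y = bmul y x.
Proof.
case: x y => [a x] [b y]; rewrite /bmul /= mulrC na_mulC; congr (_, _ + _).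
exact: addrC.
Qed.

Lemma bmulP (a : k) x y z : bmul (a *: x + y) z = a *: bmul x z + bmul y z.
Proof.
case: x y z => [b x] [c y] [e z]; rewrite /bmul /=; congr (_, _).
  by rewrite mulrDl -scalerAl.
rewrite -[RHS]/(a *: ((b : k) *: z + (e : k) *: x + na_mul x z)
                + ((c : k) *: z + (e : k) *: y + na_mul y z)) na_mulDl.
rewrite -[a *: (b : k^o)]/(a * b) scalerDl !scalerDr !scalerA [e * a]mulrC.
apply: vectP => i; rewrite !(linearD, linearZ) /=; ring.
Qed.

Lemma bmulA x y z : bmul x (bmul y z) = bmul (bmul x y) z.
Proof.
case: x y z => [a x] [b y] [c z]; rewrite /bmul /=; congr (_, _); first by rewrite mulrA.
rewrite !na_mulAl !na_mulAr !na_mulZl !na_mulZr na_mulA; apply: vectP => i.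
by rewrite !(linearD, linearZ) /=; ring.
Qed.

Lemma bmul1 x : bmul x bone = x.
Proof.
by case: x => [a x]; rewrite /bmul /= mulr1 scaler0 add0r scale1r na_mul0r addr0.
Qed.
End Unitization.

Section Unitization2.
Variables (k : fieldType) (A : nilAlg k).
Implicit Types x y z : unitz A.
Lemma bmulPr (a : k) x y z : bmul z (a *: x + y) = a *: bmul z x + bmul z y.
Proof. by rewrite ![bmul z _]bmulC bmulP. Qed.
Lemma bmul0r x : bmul x 0 = 0.
Proof. by have := bmulPr (-1) 0 0 x; rewrite scaler0 addr0 scaleN1r addNr. Qed.
Lemma bmul0l x : bmul 0 x = 0. Proof. by rewrite bmulC bmul0r. Qed.
Lemma bmulDr x y z : bmul z (x + y) = bmul z x + bmul z y.
Proof. by have := bmulPr 1 x y z; rewrite !scale1r. Qed.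
Lemma bmulZr (a : k) x z : bmul z (a *: x) = a *: bmul z x.
Proof. by have := bmulPr a x 0 z; rewrite !addr0 bmul0r addr0. Qed.
Lemma bmulDl x y z : bmul (x + y) z = bmul x z + bmul y z.
Proof. by rewrite ![bmul _ z]bmulC bmulDr. Qed.
Lemma bmulZl (a : k) x z : bmul (a *: x) z = a *: bmul x z.
Proof. by rewrite ![bmul _ z]bmulC bmulZr. Qed.
Lemma bmul_sumr (I : Type) (s : seq I) (F : I -> unitz A) z :
  bmul z (\sum_(i <- s) F i) = \sum_(i <- s) bmul z (F i).
Proof. by elim/big_rec2: _ => [|i y x _ <-]; rewrite ?bmul0r ?bmulDr. Qed.
Lemma bmul_suml (I : Type) (s : seq I) (F : I -> unitz A) z :
  bmul (\sum_(i <- s) F i) z = \sum_(i <- s) bmul (F i) z.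
Proof. by rewrite bmulC bmul_sumr; apply: eq_bigr => i _; rewrite bmulC. Qed.
Lemma unitz_coord (x : unitz A) :
  x = \sum_(c < \dim {:unitz A}) coord (vbasis {:unitz A}) c x *: (vbasis {:unitz A})`_c.
Proof. exact/coord_vbasis/memvf. Qed.

Definition ucoord (c : 'I_(\dim {:unitz A})) : {linear unitz A -> k^o} :=
  HB.pack (fun x => coord (vbasis {:unitz A}) c x : k^o)
   (GRing.isLinear.Build k (unitz A) k^o _ (fun x => coord (vbasis {:unitz A}) c x : k^o)
      (fun a x y => linearP (coord (vbasis {:unitz A}) c) a x y)).
End Unitization2.

Section Levels.
Variables (k : fieldType) (R : afa k).

(** Unlike the projection alone, this map is multiplicative on the whole algebra
    ([lev_mul]). *)
Definition lev_fun (i : afa_I R) (r : R) : unitz (afa_A i) := (afa_eps R r, afa_pr i r).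
Lemma lev_is_linear i : linear (lev_fun i).
Proof. by move=> a r s; rewrite /lev_fun !linearP. Qed.
Definition lev i : {linear R -> unitz (afa_A i)} :=
  HB.pack (lev_fun i) (GRing.isLinear.Build k R _ _ (lev_fun i) (@lev_is_linear i)).

Lemma levE i r : lev i r = (afa_eps R r, afa_pr i r). Proof. by []. Qed.

Lemma levD i r s : lev i (r + s) = lev i r + lev i s. Proof. exact: linearD. Qed.
Lemma levB i r s : lev i (r - s) = lev i r - lev i s. Proof. exact: linearB. Qed.
Lemma levZ i a r : lev i (a *: r) = a *: lev i r. Proof. exact: linearZ. Qed.
Lemma lev0 i : lev i 0 = 0. Proof. exact: linear0. Qed.
Lemma lev_sum i (I : Type) (s : seq I) (F : I -> R) :
  lev i (\sum_(j <- s) F j) = \sum_(j <- s) lev i (F j).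
Proof. exact: linear_sum. Qed.
Lemma lev_mul i r s : lev i (r * s) = bmul (lev i r) (lev i s).
Proof. by rewrite !levE /bmul /= rmorphM pr_mul. Qed.
Lemma lev_one i : lev i 1 = bone (afa_A i).
Proof. by rewrite levE rmorph1 afa_pr1. Qed.
Lemma lev_alg i (a : k) : lev i a%:A = a *: bone (afa_A i).
Proof. by rewrite levZ lev_one. Qed.
Lemma lev0P i r : lev i r = 0 <-> afa_nbhs0 i r.
Proof. by rewrite levE; split=> [[]|[-> ->]]. Qed.
Lemma lev_inj r s : (forall i, lev i r = lev i s) -> r = s.
Proof. by move=> h; apply: nbhs0_eq => i; apply/lev0P; rewrite levB h subrr. Qed.

Definition utr (i j : afa_I R) (x : unitz (afa_A j)) : unitz (afa_A i) := (x.1, afa_tr i j x.2).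
Lemma utr_linear i j : linear (@utr i j).
Proof. by move=> a x y; rewrite /utr /= linearP. Qed.
Lemma utr_sum i j (I : Type) (s : seq I) (F : I -> unitz (afa_A j)) :
  utr i (\sum_(c <- s) F c) = \sum_(c <- s) utr i (F c).
Proof.
have u0 : @utr i j 0 = 0 by rewrite /utr /= linear0.
elim/big_rec2: _ => [//|c y x _ <-]; have := @utr_linear i j 1 (F c) x.
by rewrite !scale1r.
Qed.
Lemma utrZ i j (a : k) (x : unitz (afa_A j)) : utr i (a *: x) = a *: utr i x.
Proof. by rewrite /utr /= linearZ. Qed.
Lemma utr_bmul i j x y : afa_le i j -> @utr i j (bmul x y) = bmul (utr i x) (utr i y).
Proof. by move=> ij; rewrite /utr /bmul /= !linearD !linearZ /= afa_trM. Qed.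
Lemma utr_lev i j r : afa_le i j -> utr i (lev j r) = lev i r.
Proof. by move=> ij; rewrite /utr /= afa_pr_tr. Qed.

Lemma lev_lim (a : forall i, unitz (afa_A i)) :
  (forall i j, afa_le i j -> utr i (a j) = a i) -> exists r : R, forall i, lev i r = a i.
Proof.
move=> h; have [i0] := afa_inh R.
have [|r [[r0 hr] _]] := @afa_lim k R (fun i => (a i).2).
  by move=> i j ij; rewrite -(h i j ij).
exists ((a i0).1%:A + r) => i; rewrite levD lev_alg !levE r0 hr.
have [j h0 h1] := afa_dir i0 i.
have e : (a i0).1 = (a i).1 by rewrite -(h _ _ h0) -(h _ _ h1).
rewrite [X in X + _](_ : _ = ((a i0).1, 0)); last first.
  by rewrite -[LHS]/((a i0).1 * 1, (a i0).1 *: 0) mulr1 scaler0.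
by rewrite -[LHS]/((a i0).1 + 0, 0 + (a i).2) addr0 add0r e; case: (a i).
Qed.

(** The projections need not be surjective.  Elements whose images span a subspace
    of maximal dimension have the same span as the whole image. *)
Lemma lev_lift i : exists n (s : 'I_n -> R) (l : 'I_n -> {linear unitz (afa_A i) -> k^o}),
  forall r, lev i r = \sum_b l b (lev i r) *: lev i (s b).
Proof.
pose P n := `[< exists s : seq R, \dim <<map (lev i) s>> = n >].
have exP : exists n, P n by exists (\dim <<map (lev i) [::]>>); apply/asboolP; exists [::].
have ub n : P n -> (n <= \dim {:unitz (afa_A i)})%N.
  by move=> /asboolP[s <-]; apply/dimvS/subvf.
have [N /asboolP[s sN] maxN] := ex_maxnP exP ub.
pose X := in_tuple (map (lev i) s).
pose l b : {linear unitz (afa_A i) -> k^o} := HB.pack (fun x => coord X b x : k^o)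
   (GRing.isLinear.Build k (unitz (afa_A i)) k^o _ (fun x => coord X b x : k^o)
      (fun a x y => linearP (coord X b) a x y)).
exists (size (map (lev i) s)), (fun b => s`_b), l => r.
have rX : lev i r \in <<X>>%VS.
  have sub : (<<map (lev i) s>> <= <<map (lev i) (r :: s)>>)%VS.
    by apply: sub_span => x xs; rewrite inE xs orbT.
  have /eqP -> : (<<X>> == <<map (lev i) (r :: s)>>)%VS.
    rewrite eqEdim sub /= sN; apply: maxN; apply/asboolP; by exists (r :: s).
  by apply: memv_span; rewrite mem_head.
rewrite {1}(coord_span rX); apply: eq_bigr => b _; congr (_ *: _).
rewrite /X /= (nth_map 0) //; by rewrite -(size_map (lev i)).
Qed.
End Levels.

(** ** Density of the constant tensors *)
Section Density.
Variables (k : fieldType) (d : int) (V : invSpace k d).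
Notation T := (tens V (scalars k)).

Section OneAlgebra.
Variable R : afa k.
Notation TR := (tens V R).

Lemma alg_linear : linear (fun a : k^o => a%:A : R).
Proof. by move=> a x y; rewrite scalerDl scalerA. Qed.
Definition alg_lin : {linear k^o -> R} :=
  HB.pack (fun a : k^o => a%:A : R)
    (GRing.isLinear.Build k k^o R _ (fun a : k^o => a%:A : R) alg_linear).

Definition const (f : T) : TR := tmap alg_lin f.

Lemma constE f w : const f w = (f w : k)%:A. Proof. by []. Qed.
Lemma constP (a : k) f g : const (a *: f + g) = a *: const f + const g.
Proof.
by apply: tensP => w; rewrite !(tensDE, tensZE, constE) scalerDl scalerA.
Qed.
Lemma const_homog q f : homog q f -> homog q (const f).
Proof. by rewrite !homogP => h w /h; rewrite constE => ->; rewrite scale0r. Qed.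
Lemma const_prod f g : const (tprod f g) = tprod (const f) (const g).
Proof.
apply: tensP => w; rewrite constE !tprodE scaler_suml; apply: eq_bigr => i _.
by rewrite !constE -scalerAl mul1r scalerA.
Qed.
Lemma const_star f : const (star f) = star (const f).
Proof. by apply: tensP => w; rewrite constE !starE constE scalerA. Qed.
Lemma const_omega : const (omega V (scalars k)) = omega V R.
Proof.
by apply: tensP => -[|x [|y [|z w]]]; rewrite constE !omegaE ?scale0r // /= [X in X *: _]mulr1.
Qed.
Lemma const_form z : const (form_elt (scalars k) z) = form_elt R z.
Proof.
by apply: tensP => -[|x [|y w]]; rewrite constE !form_eltE ?scale0r // /= [X in X *: _]mulr1.
Qed.

(** The coefficient algebra is spanned by finitely many elements at a finite
    level, and the coordinates of a tensor along them are tensors over [k]. *)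
Lemma dense (i : afa_I R) (f : TR) : exists s : seq (R * T),
  (forall q t, homog q f -> t \in s -> homog q t.2) /\
  forall w, afa_nbhs0 i ((f - \sum_(t <- s) tscale t.1 (const t.2)) w).
Proof.
have [n [s [l hl]]] := lev_lift i.
exists [seq (s b, tmap (l b) (tmap (lev i) f) : T) | b <- index_enum 'I_n]; split.
  move=> q t /homogP hf /mapP[b _ ->]; apply/homogP => w /hf e.
  by rewrite -[LHS]/(l b (lev i (f w))) e lev0 linear0.
move=> w; apply/lev0P; rewrite tensBE tens_sumE big_map levB lev_sum.
rewrite {1}hl; apply/eqP; rewrite subr_eq0; apply/eqP.
apply: eq_bigr => b _; rewrite tscaleE constE.
by rewrite -scalerAr mulr1 levZ.
Qed.
End OneAlgebra.

Section Semilinear.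
Variables (R S : afa k) (phi : R -> S).
(** The map [phi] is the identity for linear operators, the augmentation for
    reductions, and a change of coefficients for base change. *)
Definition semilin (P : tens V R -> tens V S) :=
  (forall f g, P (f + g) = P f + P g) /\ forall r f, P (tscale r f) = tscale (phi r) (P f).

Lemma semilinB P f g : semilin P -> P (f - g) = P f - P g.
Proof.
move=> hP; apply/eqP; rewrite eq_sym subr_eq; apply/eqP.
by rewrite -hP.1 subrK.
Qed.
Lemma semilin0 P : semilin P -> P 0 = 0.
Proof. by move=> hP; have := semilinB 0 0 hP; rewrite !subrr. Qed.
Lemma semilin_sum P (I : Type) (s : seq I) (F : I -> tens V R) : semilin P ->
  P (\sum_(i <- s) F i) = \sum_(i <- s) P (F i).
Proof.
by move=> hP; elim/big_rec2: _ => [|i y x _ <-]; rewrite ?(semilin0 hP) ?hP.1.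
Qed.

(** The difference vanishes on the approximations of [f], and is small on the
    remainder by continuity.  The predicate [C] leaves room for an agreement on
    homogeneous constant tensors only. *)
Lemma dense_eq_gen (C : T -> Prop) P1 P2 (f : tens V R) : semilin P1 -> semilin P2 ->
  tcont P1 -> tcont P2 -> (forall f, C f -> P1 (const R f) = P2 (const R f)) ->
  (forall i, exists s : seq (R * T), (forall t, t \in s -> C t.2) /\
     forall w, afa_nbhs0 i ((f - \sum_(t <- s) tscale t.1 (const R t.2)) w)) ->
  P1 f = P2 f.
Proof.
move=> l1 l2 c1 c2 h D; apply: tensP => w; apply: nbhs0_eq => j.
have [i1 [L1 h1]] := c1 j w; have [i2 [L2 h2]] := c2 j w.
have [i le1 le2] := afa_dir i1 i2; have [s [sC hs]] := D i.
pose g := \sum_(t <- s) tscale t.1 (const R t.2).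
have -> : P1 f w - P2 f w = P1 (f - g) w - P2 (f - g) w.
  rewrite (semilinB _ _ l1) (semilinB _ _ l2) !tensBE.
  have -> : P1 g = P2 g.
    rewrite /g (semilin_sum _ _ l1) (semilin_sum _ _ l2); apply: eq_big_seq => t ts.
    by rewrite l1.2 l2.2 h //; exact: sC.
  by rewrite opprB addrA subrK.
apply: nbhs0B; [apply: h1 => u _; exact: nbhs0_le le1 _ | apply: h2 => u _; exact: nbhs0_le le2 _].
Qed.

Lemma dense_eq P1 P2 (f : tens V R) : semilin P1 -> semilin P2 ->
  tcont P1 -> tcont P2 -> (forall f, P1 (const R f) = P2 (const R f)) -> P1 f = P2 f.
Proof.
move=> l1 l2 c1 c2 h; apply: (dense_eq_gen (C := fun=> True)) => // i.
by have [s [_ hs]] := dense i f; exists s.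
Qed.

Lemma dense_eq_homog q P1 P2 (f : tens V R) : semilin P1 -> semilin P2 ->
  tcont P1 -> tcont P2 -> (forall f, homog q f -> P1 (const R f) = P2 (const R f)) ->
  homog q f -> P1 f = P2 f.
Proof.
move=> l1 l2 c1 c2 h hf; apply: (dense_eq_gen (C := homog q)) => // i.
by have [s [sh hs]] := dense i f; exists s; split=> // t; exact: sh.
Qed.
End Semilinear.
End Density.

(** ** Extending a continuous map linearly *)
Section Extension.
Variables (k : fieldType) (d : int) (V : invSpace k d) (R : afa k).
Notation T := (tens V (scalars k)).
Notation TR := (tens V R).

Definition uval (i : afa_I R) (f : TR) (c : 'I_(\dim {:unitz (afa_A i)})) : T :=
  tmap (ucoord c) (tmap (lev i) f).
Arguments uval i f c : clear implicits.

Section Extend.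
Variable E : T -> TR.
Hypothesis Elin : forall (a : k) f g, E (a *: f + g) = a *: E f + E g.
Hypothesis Econt : tcont E.

Let E0 : E 0 = 0.
Proof. by have := Elin (-1) 0 0; rewrite scaler0 addr0 scaleN1r addNr. Qed.
Let ED f g : E (f + g) = E f + E g.
Proof. by have := Elin 1 f g; rewrite !scale1r. Qed.
Let EZ a f : E (a *: f) = a *: E f.
Proof. by have := Elin a f 0; rewrite !addr0 E0 addr0. Qed.
Let Esum (I : Type) (s : seq I) (F : I -> T) :
  E (\sum_(i <- s) F i) = \sum_(i <- s) E (F i).
Proof. by elim/big_rec2: _ => [|i y x _ <-]; rewrite ?E0 ?ED. Qed.

(** The linear extension of [E] at a finite level: [f] is expanded on a basis,
    with coefficients that are tensors over [k]. *)
Definition ext_lev (i : afa_I R) (f : TR) (w : seq (helt V)) : unitz (afa_A i) :=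
  \sum_c bmul (lev i (E (uval i f c) w)) (vbasis {:unitz (afa_A i)})`_c.

(** The formula holds for all spanning expansions and not only for the chosen
    basis.  Linearity over the coefficient algebra and compatibility of the levels
    both follow from this freedom. *)
Lemma ext_levE i (f : TR) w (I : Type) (s : seq I) (g : I -> T) (b : I -> unitz (afa_A i)) :
  (forall u, lev i (f u) = \sum_(c <- s) (g c u : k) *: b c) ->
  ext_lev i f w = \sum_(c <- s) bmul (lev i (E (g c) w)) (b c).
Proof.
move=> h; rewrite /ext_lev.
have uvE c : uval i f c = \sum_(j <- s) (ucoord c (b j) : k) *: g j.
  apply: tensP => u; rewrite tens_sumE -[LHS]/(ucoord c (lev i (f u))) h linear_sum.
  by apply: eq_bigr => j _; rewrite tensZE [LHS]linearZ; exact: mulrC.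
transitivity (\sum_c \sum_(j <- s) bmul (lev i (E (g j) w))
     ((ucoord c (b j) : k) *: (vbasis {:unitz (afa_A i)})`_c)).
  apply: eq_bigr => c _; rewrite uvE Esum tens_sumE lev_sum bmul_suml.
  apply: eq_bigr => j _; rewrite EZ tensZE levZ bmulZl bmulZr; by [].
rewrite exchange_big; apply: eq_bigr => j _.
by rewrite -bmul_sumr -unitz_coord.
Qed.

Lemma ext_lev_utr i j (f : TR) w : afa_le i j -> utr i (ext_lev j f w) = ext_lev i f w.
Proof.
move=> ij; rewrite [RHS](@ext_levE i f w _ (index_enum 'I_(\dim {:unitz (afa_A j)}))
  (fun c => uval j f c) (fun c => utr i (vbasis {:unitz (afa_A j)})`_c)); last first.
  move=> u; rewrite -(utr_lev _ ij) {1}[lev j (f u)]unitz_coord.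
  by rewrite utr_sum; apply: eq_bigr => c _; rewrite utrZ.
by rewrite utr_sum; apply: eq_bigr => c _; rewrite utr_bmul // utr_lev.
Qed.

Lemma ext_exists : exists D : TR -> TR, [/\ tlinear D, tcont D,
  forall g, D (const R g) = E g &
  forall i f w, lev i (D f w) = ext_lev i f w].
Proof.
pose v f w := projT1 (cid (lev_lim (fun i j ij => ext_lev_utr f w ij))).
have vE f w i : lev i (v f w) = ext_lev i f w by rewrite /v; case: cid.
have vml f : multilinear (v f).
  move=> i a x y u t; apply: lev_inj => j; rewrite levD levZ !vE /ext_lev scaler_sumr.
  rewrite -big_split; apply: eq_bigr => c _.
  by rewrite tens_multilinear levD levZ bmulP.
have v0 f : v f [::] = 0.
  apply: lev_inj => j; rewrite lev0 vE /ext_lev big1 // => c _.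
  by rewrite tens_nil lev0 bmul0l.
pose D f : TR := mk_tens (vml f) (v0 f).
have DE i f w : lev i (D f w) = ext_lev i f w by exact: vE.
exists D; split=> //.
- split=> [f g|r f]; apply: tensP => w; apply: lev_inj => i.
    rewrite tensDE levD !DE /ext_lev -big_split; apply: eq_bigr => c _.
    have -> : uval i (f + g) c = uval i f c + uval i g c.
      apply: tensP => u; rewrite tensDE -[LHS]/(ucoord c (lev i ((f + g) u))).
      by rewrite tensDE levD linearD.
    by rewrite ED tensDE levD bmulDl.
  rewrite tscaleE lev_mul !DE.
  rewrite (@ext_levE i _ w _ (index_enum _) (fun c => uval i f c)
    (fun c => bmul (lev i r) (vbasis {:unitz (afa_A i)})`_c)).
    rewrite /ext_lev bmul_sumr; apply: eq_bigr => c _.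
    by rewrite bmulA [X in bmul X _]bmulC -bmulA.
  move=> u; rewrite tscaleE lev_mul {1}[lev i (f u)]unitz_coord bmul_sumr.
  by apply: eq_bigr => c _; rewrite bmulZr.
- move=> i w; have [[] [L hL]] := Econt i w; exists i, L => f hf.
  apply/lev0P; rewrite DE /ext_lev big1 // => c _.
  suff /lev0P -> : afa_nbhs0 i (E (uval i f c) w) by rewrite bmul0l.
  apply: hL => u /hf /lev0P e; split=> //.
  by rewrite -[LHS]/(ucoord c (lev i (f u))) e linear0.
- move=> g; apply: tensP => w; apply: lev_inj => i; rewrite DE.
  rewrite (@ext_levE i _ w unit [:: tt] (fun=> g) (fun=> bone _)).
    by rewrite big_seq1 bmul1.
  by move=> u; rewrite big_seq1 constE lev_alg.
Qed.
End Extend.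

Lemma tcont_const : tcont (const R : T -> TR).
Proof.
move=> j w; exists tt, [:: w] => f hf; have [e _] := hf w (mem_head _ _).
by rewrite constE; move: e => /= ->; rewrite scale0r; exact: nbhs0_0.
Qed.

(** By density the operator is the extension of its restriction to constant
    tensors, whose values at a finite level are given by a formula. *)
Lemma lev_lc (D : TR -> TR) i (f : TR) w (I : Type) (s : seq I) (g : I -> T)
    (b : I -> unitz (afa_A i)) : tlinear D -> tcont D ->
  (forall u, lev i (f u) = \sum_(c <- s) (g c u : k) *: b c) ->
  lev i (D f w) = \sum_(c <- s) bmul (lev i (D (const R (g c)) w)) (b c).
Proof.
move=> Dl Dc h.
have El (a : k) f1 f2 : D (const R (a *: f1 + f2)) = a *: D (const R f1) + D (const R f2).
  by rewrite constP (tlinD Dl) (tlinZ Dl).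
have Ec : tcont (fun f => D (const R f)) by apply: tcont_comp => //; exact: tcont_const.
have [D' [D'l D'c D'E D'lev]] := ext_exists El Ec.
have -> : D f = D' f by apply: (dense_eq (phi := idfun)) => // f'; rewrite D'E.
by rewrite D'lev; exact: ext_levE.
Qed.

Lemma lev_lc_coord (D : TR -> TR) i (f : TR) w : tlinear D -> tcont D ->
  lev i (D f w) =
   \sum_c bmul (lev i (D (const R (uval i f c)) w)) (vbasis {:unitz (afa_A i)})`_c.
Proof. by move=> Dl Dc; apply: lev_lc => // u; exact: unitz_coord. Qed.

(** *** Continuity of the operations *)
Lemma tcont_id : tcont (fun f : TR => f).
Proof. by move=> j w; exists j, [:: w] => f; apply; exact: mem_head. Qed.

Lemma tcont_prodr (h : TR) : tcont (fun g => tprod h g).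
Proof.
move=> j w; exists j, [seq drop i w | i <- iota 0 (size w).+1] => f hf.
rewrite tprodE; apply: nbhs0_sum => i _; apply/nbhs0Ml/hf/mapP.
by exists (nat_of_ord i) => //; rewrite mem_iota add0n ltn_ord.
Qed.
Lemma tcont_prodl (h : TR) : tcont (fun g => tprod g h).
Proof.
move=> j w; exists j, [seq take i w | i <- iota 0 (size w).+1] => f hf.
rewrite tprodE; apply: nbhs0_sum => i _; rewrite mulrC; apply/nbhs0Ml/hf/mapP.
by exists (nat_of_ord i) => //; rewrite mem_iota add0n ltn_ord.
Qed.
Lemma tcont_star : tcont (fun f : TR => star f).
Proof.
move=> j w; exists j, [:: rev (map (@helt_star k d V) w)] => f hf.
by rewrite starE; apply/nbhs0Z/hf; exact: mem_head.
Qed.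
Lemma tlinear_prodr (h : TR) : tlinear (fun g => tprod h g).
Proof. by split=> *; rewrite ?tprodDr ?tprodSr. Qed.
Lemma tlinear_prodl (h : TR) : tlinear (fun g => tprod g h).
Proof. by split=> *; rewrite ?tprodDl ?tprodSl. Qed.
Lemma tlinear_star : tlinear (fun f : TR => star f).
Proof. by split=> *; rewrite ?starD ?starS. Qed.

(** *** Identities that hold when they hold for constant tensors *)
Section FromConstants.
Variables (D : TR -> TR) (Dl : tlinear D) (Dc : tcont D).

(** Both sides are linear and continuous in each argument, so that density is
    applied to one factor after the other. *)
Lemma lc_leibniz p :
  (forall q f g, homog q f ->
    D (const R (tprod f g)) = tprod (D (const R f)) (const R g)
      + ksgn (p * q) *: tprod (const R f) (D (const R g))) ->
  forall q f g, homog q f ->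
    D (tprod f g) = tprod (D f) g + ksgn (p * q) *: tprod f (D g).
Proof.
move=> h q f g hf.
have step (f0 : T) (g0 : TR) : homog q f0 -> D (tprod (const R f0) g0) =
    tprod (D (const R f0)) g0 + ksgn (p * q) *: tprod (const R f0) (D g0).
  move=> hf0; rewrite addrC.
  apply: (dense_eq (phi := idfun) (P1 := fun g => D (tprod (const R f0) g))
    (P2 := fun g => ksgn (p * q) *: tprod (const R f0) (D g) + tprod (D (const R f0)) g)).
  - exact: (tlinear_comp Dl (tlinear_prodr (const R f0))).
  - apply: tlinear_comb; last exact: tlinear_prodr.
    exact: (tlinear_comp (tlinear_prodr (const R f0)) Dl).
  - exact: (tcont_comp Dc (tcont_prodr (const R f0))).
  - apply: tcont_comb; last exact: tcont_prodr.
    exact: (tcont_comp (tcont_prodr (const R f0)) Dc).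
  - by move=> f1; rewrite -const_prod (h q) // addrC.
rewrite addrC.
apply: (dense_eq_homog (phi := idfun) (q := q) (P1 := fun f => D (tprod f g))
    (P2 := fun f => ksgn (p * q) *: tprod f (D g) + tprod (D f) g)) => //.
- exact: (tlinear_comp Dl (tlinear_prodl g)).
- apply: tlinear_comb; first exact: tlinear_prodl.
  exact: (tlinear_comp (tlinear_prodl g) Dl).
- exact: (tcont_comp Dc (tcont_prodl g)).
- apply: tcont_comb; first exact: tcont_prodl.
  exact: (tcont_comp (tcont_prodl g) Dc).
- by move=> f1 hf1; rewrite step // addrC.
Qed.

Lemma lc_mult :
  (forall f g, D (const R (tprod f g)) = tprod (D (const R f)) (D (const R g))) ->
  forall f g, D (tprod f g) = tprod (D f) (D g).
Proof.
move=> h f g.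
have step (f0 : T) (g0 : TR) : D (tprod (const R f0) g0) = tprod (D (const R f0)) (D g0).
  apply: (dense_eq (phi := idfun) (P1 := fun g => D (tprod (const R f0) g))
    (P2 := fun g => tprod (D (const R f0)) (D g))).
  - exact: (tlinear_comp Dl (tlinear_prodr (const R f0))).
  - exact: (tlinear_comp (tlinear_prodr _) Dl).
  - exact: (tcont_comp Dc (tcont_prodr (const R f0))).
  - exact: (tcont_comp (tcont_prodr _) Dc).
  - by move=> f1; rewrite -const_prod.
apply: (dense_eq (phi := idfun) (P1 := fun f => D (tprod f g))
    (P2 := fun f => tprod (D f) (D g))) => //.
- exact: (tlinear_comp Dl (tlinear_prodl g)).
- exact: (tlinear_comp (tlinear_prodl _) Dl).
- exact: (tcont_comp Dc (tcont_prodl g)).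
- exact: (tcont_comp (tcont_prodl _) Dc).
Qed.

Lemma lc_star : (forall f, D (const R (star f)) = star (D (const R f))) ->
  forall f, D (star f) = star (D f).
Proof.
move=> h f; apply: (dense_eq (phi := idfun) (P1 := fun f => D (star f))
    (P2 := fun f => star (D f))) => //.
- exact: (tlinear_comp Dl tlinear_star).
- exact: (tlinear_comp tlinear_star Dl).
- exact: (tcont_comp Dc tcont_star).
- exact: (tcont_comp tcont_star Dc).
- by move=> f0; rewrite -const_star.
Qed.

Lemma lc_homog p : (forall q f, homog q f -> homog (q + p) (D (const R f))) ->
  forall q f, homog q f -> homog (q + p) (D f).
Proof.
move=> h q f /homogP hf; apply/homogP => w hw; apply: lev_inj => i.
rewrite lev0 lev_lc_coord // big1 // => c _.
have /homogP -> // : homog (q + p) (D (const R (uval i f c))).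
  apply: h; apply/homogP => u /hf e.
  by rewrite -[LHS]/(ucoord c (lev i (f u))) e lev0 linear0.
by rewrite lev0 bmul0l.
Qed.

Lemma lc_eq (D' : TR -> TR) : tlinear D' -> tcont D' ->
  (forall f, D (const R f) = D' (const R f)) -> forall f, D f = D' f.
Proof. by move=> D'l D'c h f; apply: (dense_eq (phi := idfun)). Qed.
End FromConstants.
End Extension.

(** * Deformations and Maurer--Cartan elements *)

Section Components.
Variables (k : fieldType) (d : int) (V : invSpace k d) (R : afa k).
Notation T := (tens V (scalars k)).
Notation TR := (tens V R).

Definition acoord (A : nilAlg k) (c : 'I_(\dim {:A})) : {linear A -> k^o} :=
  HB.pack (fun x => coord (vbasis {:A}) c x : k^o)
   (GRing.isLinear.Build k A k^o _ (fun x => coord (vbasis {:A}) c x : k^o)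
      (fun a x y => linearP (coord (vbasis {:A}) c) a x y)).

(** The coordinates of an element of [R]: its augmentation and, at each finite
    level, the coordinates of its projection. *)
Definition lam (o : option {i : afa_I R & 'I_(\dim {:afa_A i})}) : {linear R -> k^o} :=
  if o is Some (existT i b) then (acoord b \o afa_pr i : {linear R -> k^o})
  else afa_eps R.

Lemma lamS i b r : lam (Some (existT _ i b)) r = coord (vbasis {:afa_A i}) b (afa_pr i r).
Proof. by []. Qed.

Lemma lamD o r s : lam o (r + s) = lam o r + lam o s. Proof. exact: linearD. Qed.
Lemma lamZ o a r : lam o (a *: r) = a *: lam o r. Proof. exact: linearZ. Qed.
Lemma lam0 o : lam o 0 = 0. Proof. exact: linear0. Qed.
Lemma lam_sum o (I : Type) (s : seq I) (F : I -> R) :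
  lam o (\sum_(j <- s) F j) = \sum_(j <- s) (lam o (F j) : scalars k).
Proof. exact: linear_sum. Qed.
Lemma lam_inj r s : (forall o, lam o r = lam o s) -> r = s.
Proof.
move=> h; apply: eps_pr_eq; first exact: (h None).
by move=> i; apply: vectP => b; exact: (h (Some (existT _ i b))).
Qed.

Lemma lam_cont o : exists i, forall r : R, afa_nbhs0 i r -> lam o r = 0.
Proof.
case: o => [[i b]|]; first by exists i => r [_ hr]; rewrite lamS hr linear0.
by have [i] := afa_inh R; exists i => r [].
Qed.

(** Over [k], the conditions defining cyclic derivations are linear in the
    operator; an operator with coefficients is tested on its coordinates. *)
Definition lam_op o (D : TR -> TR) : T -> T := fun f => tmap (lam o) (D (const R f)).

Lemma lam_opE o D f w : lam_op o D f w = lam o (D (const R f) w). Proof. by []. Qed.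

Lemma lam_hat_form o p D w z :
  lam o (hat_form p D w z) = hat_form p (lam_op o D) w z.
Proof. by rewrite /hat_form lamZ lam_opE const_form. Qed.

Lemma lam_cyclic p D : is_cyclic p D <-> forall o, is_cyclic p (lam_op o D).
Proof.
split=> [h o u y z|h u y z].
  by rewrite -!lam_hat_form (h u y z) !lamZ.
by apply: lam_inj => o; rewrite [RHS]lamZ [X in _ = _ *: X]lamZ !lam_hat_form; exact: h.
Qed.

Lemma tcont_lam o (D : TR -> TR) : tcont D -> tcont (lam_op o D).
Proof.
move=> Dc; apply/tcont_scalars => w; have [i hi] := lam_cont o.
have [j [L hL]] := tcont_comp Dc (@tcont_const k d V R) i w; exists L => f hf.
by rewrite lam_opE; apply: hi; apply: hL => u /hf ->; exact: nbhs0_0.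
Qed.

Lemma tlinear_lam (D : TR -> TR) o : tlinear D -> tlinear (lam_op o D).
Proof.
move=> Dl; split=> [f g|a f]; apply: tensP => w; rewrite ?tensDE ?tscaleE !lam_opE.
  have := constP R 1 f g; rewrite !scale1r => ->.
  by rewrite (tlinD Dl) tensDE lamD.
have -> : const R (tscale a f) = (a : k) *: const R f.
  by apply: tensP => u; rewrite constE tscaleE tensZE constE scalerA.
by rewrite (tlinZ Dl) tensZE lamZ.
Qed.

Lemma derivation_lam p (D : TR -> TR) o : is_derivation p D -> is_derivation p (lam_op o D).
Proof.
case=> Dl Dc Dh DL; split.
- exact: tlinear_lam.
- exact: tcont_lam.
- move=> q f /(const_homog (R := R))/Dh/homogP h; apply/homogP => w /h e.
  by rewrite lam_opE e lam0.
- move=> q f g hf; apply: tensP => w.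
  rewrite lam_opE const_prod (DL q) ?tensDE ?tensZE; last exact: const_homog.
  rewrite lamD lamZ !tprodE !lam_sum; congr (_ + _ *: _).
    by apply: eq_bigr => i _; rewrite constE -scalerAr mulr1 lamZ [RHS]mulrC.
  by apply: eq_bigr => i _; rewrite constE -scalerAl mul1r lamZ.
Qed.

Lemma Der_lam p (D : TR -> TR) o : Der_cycl p D -> Der_cycl p (lam_op o D).
Proof.
case=> Dder /lam_cyclic/(_ o) Dcyc Ds; split => //; first exact: derivation_lam.
by move=> f; apply: tensP => w; rewrite lam_opE const_star Ds !starE lamZ.
Qed.

Lemma lam_Der p (D : TR -> TR) : tlinear D -> tcont D ->
  (forall o, Der_cycl p (lam_op o D)) -> Der_cycl p D.
Proof.
move=> Dl Dc h; split; last 1 first.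
- apply: lc_star => // f; apply: tensP => w; apply: lam_inj => o.
  rewrite -lam_opE; have [_ _ ->] := h o.
  by rewrite !starE lamZ.
- split=> //.
    apply: lc_homog => // q f hf; have hh o : homog (q + p) (lam_op o D f).
      by have [[_ _ h' _] _ _] := h o; exact: h'.
    apply/homogP => w hw; apply: lam_inj => o; rewrite lam0 -lam_opE.
    by have /homogP -> := hh o.
  apply: lc_leibniz => // q f g hf; apply: tensP => w; apply: lam_inj => o.
  rewrite -lam_opE; have [[_ _ _ E] _ _] := h o; rewrite (E q) //.
  rewrite !tensDE !tensZE lamD lamZ !tprodE !lam_sum; congr (_ + _ *: _).
    by apply: eq_bigr => i _; rewrite constE -scalerAr mulr1 lamZ lam_opE [LHS]mulrC.
  by apply: eq_bigr => i _; rewrite constE -scalerAl mul1r lamZ lam_opE.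
- by apply/lam_cyclic => o; have [] := h o.
Qed.
End Components.

(** ** Tensors with a finite dimensional algebra *)
Section Tev.
Variables (k : fieldType) (d : int) (V : invSpace k d).
Notation T := (tens V (scalars k)).
Notation L := (T -> T).
Implicit Types (A B : nilAlg k) (f : T) (w : seq (helt V)).

(** The element of [A] obtained by evaluating the first factor of
    [x : (T -> T) (x) A] at [f] and [w]. *)
Definition tev A (x : tensA L A) f w : A :=
  \sum_a (x a f w : k) *: (vbasis {:A})`_a.

Lemma tevD A (x y : tensA L A) f w : tev (x + y) f w = tev x f w + tev y f w.
Proof.
rewrite /tev -big_split; apply: eq_bigr => a _ /=; rewrite -scalerDl; congr (_ *: _).
by rewrite ffunE -[LHS]/((x a f + y a f) w) tensDE.
Qed.
Lemma tevZ A (c : k) (x : tensA L A) f w : tev (c *: x) f w = c *: tev x f w.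
Proof.
rewrite /tev scaler_sumr; apply: eq_bigr => a _; rewrite scalerA; congr (_ *: _).
by rewrite ffunE -[LHS]/((c *: x a f) w) tensZE.
Qed.
Lemma tev0 A f w : tev (0 : tensA L A) f w = 0.
Proof. by have := tevZ 0 (0 : tensA L A) f w; rewrite !scale0r. Qed.
Lemma tevB A (x y : tensA L A) f w : tev (x - y) f w = tev x f w - tev y f w.
Proof. by rewrite -scaleN1r tevD tevZ scaleN1r. Qed.
Lemma tev_sum A (I : Type) (s : seq I) (P : pred I) (F : I -> tensA L A) f w :
  tev (\sum_(i <- s | P i) F i) f w = \sum_(i <- s | P i) tev (F i) f w.
Proof. by elim/big_rec2: _ => [|i y x _ <-]; rewrite ?tev0 ?tevD. Qed.
Lemma tev_pure A (l : L) (b : A) f w : tev (tens_pure l b) f w = (l f w : k) *: b.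
Proof.
rewrite {2}(coord_vbasis (memvf b)) scaler_sumr; apply: eq_bigr => a _.
rewrite scalerA; congr (_ *: _); rewrite ffunE.
rewrite -[LHS]/((coord (vbasis {:A}) a b *: l f) w) tensZE; exact: mulrC.
Qed.
Lemma tev_coord A (x : tensA L A) f w a :
  coord (vbasis {:A}) a (tev x f w) = x a f w.
Proof. by rewrite /tev coord_sum_free //; exact: basis_free (vbasisP _). Qed.
Lemma tev_inj A (x y : tensA L A) : (forall f w, tev x f w = tev y f w) -> x = y.
Proof.
move=> h; apply/ffunP => a; apply: funext => f; apply: tensP => w.
by rewrite -!tev_coord h.
Qed.
Lemma tev_map A B (F : {linear A -> B}) (x : tensA L A) f w :
  tev (tens_map F x) f w = F (tev x f w).
Proof.
rewrite /tens_map tev_sum /tev linear_sum; apply: eq_bigr => c _.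
by rewrite -/(tev _ f w) tev_pure linearZ.
Qed.

Variable m : T -> T.
Notation gL := (Der_dgLie m).

Lemma tev_br A p q (x y : tensA L A) f w :
  tev (@dg_br k (tens_dgLie gL A) p q x y) f w =
  \sum_a \sum_b (bracket p q (x a) (y b) f w : k) *:
     na_mul (vbasis {:A})`_a (vbasis {:A})`_b.
Proof.
rewrite /= tev_sum; apply: eq_bigr => a _; rewrite tev_sum; apply: eq_bigr => b _.
exact: tev_pure.
Qed.

Lemma tev_d A p (x : tensA L A) f w :
  tev (@dg_d k (tens_dgLie gL A) p x) f w =
  \sum_a (bracket 1 p m (x a) f w : k) *: (vbasis {:A})`_a.
Proof. by apply: eq_bigr => a _; rewrite ffunE. Qed.
End Tev.

Section FamOf.
Variables (k : fieldType) (d : int) (V : invSpace k d) (R : afa k).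
Notation T := (tens V (scalars k)).
Notation TR := (tens V R).
Variable m : T -> T.
Notation fam := (fam (Der_dgLie m) R).

(** The family of components of an operator; the augmentation of the operator
    is not recorded. *)
Definition fam_of (D : TR -> TR) : fam := fun i =>
  [ffun a : 'I_(\dim {:afa_A i}) => lam_op (Some (existT _ i a)) D] : tensA (T -> T) (afa_A i).

Lemma tev_fam D i f w : tev (fam_of D i) f w = afa_pr i (D (const R f) w).
Proof.
rewrite [RHS](coord_vbasis (memvf _)); apply: eq_bigr => a _.
by rewrite ffunE.
Qed.

Lemma fam_of_compatible D : compatible (fam_of D).
Proof.
by move=> i j ij; apply: tev_inj => f w; rewrite tev_map !tev_fam afa_pr_tr.
Qed.

(** At a finite level a tensor is the sum of its reduction and of terms carried by
    a basis of the nilpotent algebra; an operator with a known reduction treats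
    these two kinds of terms differently. *)
Lemma lev_parts (D : TR -> TR) i (g : TR) w : tlinear D -> tcont D ->
  lev i (D g w) = lev i (D (const R (tred g)) w)
    + \sum_a bmul (lev i (D (const R (tmap (acoord a) (tmap (afa_pr i) g))) w))
               ((0, (vbasis {:afa_A i})`_a) : unitz (afa_A i)).
Proof.
move=> Dl Dc.
pose gg (o : option 'I_(\dim {:afa_A i})) : T :=
  if o is Some a then tmap (acoord a) (tmap (afa_pr i) g) else tred g.
pose bb (o : option 'I_(\dim {:afa_A i})) : unitz (afa_A i) :=
  if o is Some a then (0, (vbasis {:afa_A i})`_a) else bone _.
rewrite (@lev_lc k d V R D i g w _ (None :: map some (index_enum _)) gg bb) //.
  by rewrite big_cons big_map /= bmul1.
move=> u; rewrite big_cons big_map levE.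
have -> : (afa_eps R (g u), afa_pr i (g u)) =
    ((afa_eps R (g u) : k) *: bone (afa_A i)) + ((0, afa_pr i (g u)) : unitz (afa_A i)).
  rewrite -[RHS]/((afa_eps R (g u) : k) * 1 + 0, (afa_eps R (g u) : k) *: 0 + afa_pr i (g u)).
  by rewrite mulr1 addr0 scaler0 add0r.
congr (_ + _); rewrite {1}(coord_vbasis (memvf (afa_pr i (g u)))).
elim/big_rec2: _ => [//|a y1 y2 _ <-].
set c := gg (Some a) u; rewrite -[RHS]/((c : k) * 0 + 0, (c : k) *: (vbasis {:afa_A i})`_a + y1).
by rewrite mulr0 addr0.
Qed.
End FamOf.

Section Compose.
Variables (k : fieldType) (d : int) (V : invSpace k d).
Notation T := (tens V (scalars k)).
Variables (A : nilAlg k) (m : T -> T).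
Notation L := (T -> T).
Notation gL := (Der_dgLie m).

(** The values of the composite of two elements of [(T -> T) (x) A]. *)
Definition tcomp (x y : tensA L A) f w : A :=
  \sum_b na_mul (tev x (y b f) w) (vbasis {:A})`_b.

Lemma na_mul_suml (I : Type) (s : seq I) (F : I -> A) z :
  na_mul (\sum_(i <- s) F i) z = \sum_(i <- s) na_mul (F i) z.
Proof. by elim/big_rec2: _ => [|i y x _ <-]; rewrite ?na_mul0l ?na_mulAl. Qed.

Lemma tcompE (x y : tensA L A) f w : tcomp x y f w =
  \sum_a \sum_b (x a (y b f) w : k) *: na_mul (vbasis {:A})`_a (vbasis {:A})`_b.
Proof.
rewrite exchange_big; apply: eq_bigr => b _; rewrite na_mul_suml.
by apply: eq_bigr => a _; rewrite na_mulZl.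
Qed.

Lemma tev_br_comp p q (x y : tensA L A) f w :
  tev (@dg_br k (tens_dgLie gL A) p q x y) f w =
  tcomp x y f w - ksgn (p * q) *: tcomp y x f w.
Proof.
rewrite tev_br tcompE [X in _ - _ *: X]tcompE [X in _ - _ *: X]exchange_big.
rewrite scaler_sumr -sumrB; apply: eq_bigr => a _.
rewrite scaler_sumr -sumrB; apply: eq_bigr => b _.
rewrite /bracket tensBE tensZE scalerBl -[X in _ - X *: _]/(_ * _) -scalerA; congr (_ - _ *: (_ *: _)).
exact: na_mulC.
Qed.

Lemma tev_d_comp p (x : tensA L A) f w :
  tev (@dg_d k (tens_dgLie gL A) p x) f w =
  (\sum_a (m (x a f) w : k) *: (vbasis {:A})`_a) - ksgn p *: tev x (m f) w.
Proof.
rewrite tev_d /tev scaler_sumr -sumrB; apply: eq_bigr => a _.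
by rewrite /bracket tensBE tensZE mul1r scalerBl scalerA.
Qed.

Lemma tev_MC (char0 : [pchar k] =i pred0) (x : tensA L A) f w :
  tev ((@dg_d k (tens_dgLie gL A) 1 x : tensA L A)
       + 2^-1 *: (@dg_br k (tens_dgLie gL A) 1 1 x x : tensA L A)) f w =
  (\sum_a (m (x a f) w : k) *: (vbasis {:A})`_a) + tev x (m f) w + tcomp x x f w.
Proof.
rewrite tevD tevZ tev_d_comp tev_br_comp -[ksgn 1]/(-1).
rewrite !scaleN1r !opprK; congr (_ + _).
rewrite -mulr2n -scaler_nat scalerA mulVf ?scale1r //.
by have /pcharf0P -> := char0.
Qed.
End Compose.

Section Deformations.
Variables (k : fieldType) (char0 : [pchar k] =i pred0) (d : int) (V : invSpace k d).
Notation T := (tens V (scalars k)).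
Variables (m : T -> T) (hm : cycl_Ainf m) (R : afa k).
Notation TR := (tens V R).
Notation fam_of := (@fam_of k d V R m).

Lemma Der_tcont (S : afa k) p (D : tens V S -> tens V S) : Der_cycl p D -> tcont D.
Proof. by case=> -[]. Qed.
Lemma Der_tlinear (S : afa k) p (D : tens V S -> tens V S) : Der_cycl p D -> tlinear D.
Proof. by case=> -[]. Qed.

Lemma tred_const (f : T) : tred (const R f) = f.
Proof. by apply: tensP => w; rewrite -[LHS]/(afa_eps R (const R f w)) constE eps_alg. Qed.

Lemma op_lev (D : TR -> TR) (D0 : T -> T) i f w : (forall f, tred (D f) = D0 (tred f)) ->
  lev i (D (const R f) w) = ((D0 f w : k^o), tev (fam_of D i) f w).
Proof.
by move=> Dred; rewrite levE tev_fam -[afa_eps R _]/(tred (D (const R f)) w) Dred tred_const.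
Qed.

(** For [D = D0 + x] and [E = E0 + y] this is the expansion of [D E] into
    [D0 E0 + (D0 y + x E0 + x y)]. *)
Lemma op_comp_lev (D E : TR -> TR) (D0 E0 : T -> T) i f w : tlinear D -> tcont D ->
  (forall f, tred (D f) = D0 (tred f)) -> (forall f, tred (E f) = E0 (tred f)) ->
  lev i (D (E (const R f)) w) =
  ((D0 (E0 f) w : k^o), (\sum_a (D0 (fam_of E i a f) w : k) *: (vbasis {:afa_A i})`_a)
     + tev (fam_of D i) (E0 f) w + tcomp (fam_of D i) (fam_of E i) f w).
Proof.
move=> Dl Dc Dred Ered; rewrite lev_parts // Ered tred_const (op_lev _ _ _ Dred).
have -> (x : k^o) y1 y2 y3 : (x, y1 + y2 + y3) =
   ((x, y2) : unitz (afa_A i)) + ((0, y1 + y3) : unitz (afa_A i)).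
  by rewrite -[RHS]/(x + 0, y2 + (y1 + y3)) addr0 addrCA addrA.
congr (_ + _); rewrite /tcomp -big_split.
elim/big_rec2: _ => [//|a y1 y2 _ ->].
rewrite -[LHS]/((bmul _ _).1 + 0, (bmul _ _).2 + y2).
have <- : fam_of E i a f = tmap (acoord a) (tmap (afa_pr i) (E (const R f))).
  by apply: tensP => u; rewrite ffunE.
by rewrite (op_lev _ _ _ Dred) /bmul /= mulr0 scale0r !addr0.
Qed.

(** For [m1 = m + xi] and [m^2 = 0], the equation [m1^2 = 0] reads
    [m xi + xi m + xi^2 = 0]. *)
Lemma deformation_MC (m1 : TR -> TR) : is_deformation m m1 -> MC_lim (fam_of m1).
Proof.
case=> -[m1D m1s] m1r; split; first exact: fam_of_compatible.
move=> i; split=> [c|]; first by rewrite ffunE; exact: Der_lam.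
apply: tev_inj => f w; rewrite tev_MC // tev0.
have := op_comp_lev i f w (Der_tlinear m1D) (Der_tcont m1D) m1r m1r.
by rewrite m1s tens0E lev0 => -[_ <-].
Qed.

Definition eps_scalars (r : R) : scalars k := afa_eps R r.

Lemma tred_semilin : semilin eps_scalars (@tred k d V R).
Proof.
split=> [f g|r f]; apply: tensP => w; rewrite ?tensDE ?tscaleE.
  by rewrite -[LHS]/(afa_eps R ((f + g) w)) tensDE linearD.
by rewrite -[LHS]/(afa_eps R (tscale r f w)) tscaleE rmorphM.
Qed.

Lemma tred_tcont : tcont (@tred k d V R).
Proof.
move=> [] w; have [i] := afa_inh R; exists i, [:: w] => f hf.
have [e _] := hf w (mem_head _ _).
by rewrite -[tred f w]/(afa_eps R (f w)) e; exact: nbhs0_0.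
Qed.

(** Both sides are semilinear along the augmentation, so that density applies. *)
Lemma lc_tred (D : TR -> TR) (D0 : T -> T) : tlinear D -> tcont D -> tlinear D0 -> tcont D0 ->
  (forall f, tred (D (const R f)) = D0 f) -> forall f, tred (D f) = D0 (tred f).
Proof.
move=> Dl Dc D0l D0c h f.
apply: (dense_eq (phi := eps_scalars) (P1 := fun f => tred (D f)) (P2 := fun f => D0 (tred f))).
- by split=> *; rewrite ?Dl.1 ?Dl.2 ?tred_semilin.1 ?tred_semilin.2.
- by split=> *; rewrite ?tred_semilin.1 ?tred_semilin.2 ?D0l.1 ?D0l.2.
- exact: tcont_comp tred_tcont Dc.
- exact: tcont_comp D0c tred_tcont.
- by move=> g; rewrite h tred_const.
Qed.

(** On constant tensors the prescribed values are compatible families, hence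
    elements of the limit; the resulting map then extends by [ext_exists]. *)
Lemma op_exists (m0 : T -> T) (xi : fam (Der_dgLie m) R) : tlinear m0 -> tcont m0 ->
  compatible xi -> (forall i a, tlinear (xi i a) /\ tcont (xi i a)) ->
  exists D : TR -> TR, [/\ tlinear D, tcont D, forall f, tred (D f) = m0 (tred f)
    & fam_of D = xi].
Proof.
move=> m0l m0c xc xlc.
have tevlin i (a : k) f g w : tev (xi i) (a *: f + g) w = a *: tev (xi i) f w + tev (xi i) g w.
  rewrite /tev scaler_sumr -big_split; apply: eq_bigr => c _ /=.
  have [h _] := xlc i c.
  by rewrite (tlinD h) (tlinZ h) tensDE tensZE scalerDl scalerA.
have ex f w : exists r : R, forall i, lev i r = ((m0 f w : k^o), tev (xi i) f w).
  apply: lev_lim => i j ij; rewrite /utr /=; congr (_, _).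
  by rewrite -(xc i j ij) tev_map.
pose e f w := projT1 (cid (ex f w)).
have eE f w i : lev i (e f w) = ((m0 f w : k^o), tev (xi i) f w) by rewrite /e; case: cid.
have eml f : multilinear (e f).
  move=> i a x y u v; apply: lev_inj => j; rewrite levD levZ !eE tens_multilinear.
  congr (_, _); rewrite /= /tev scaler_sumr -big_split; apply: eq_bigr => c _ /=.
  by rewrite tens_multilinear scalerDl scalerA.
have e0 f : e f [::] = 0.
  apply: lev_inj => j; rewrite lev0 eE tens_nil; congr (_, _).
  by rewrite /tev big1 // => c _; rewrite tens_nil scale0r.
pose E f : TR := mk_tens (eml f) (e0 f).
have EE f w i : lev i (E f w) = ((m0 f w : k^o), tev (xi i) f w) by exact: eE.
have Elin (a : k) f g : E (a *: f + g) = a *: E f + E g.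
  apply: tensP => w; apply: lev_inj => i; rewrite tensDE tensZE levD levZ !EE.
  by rewrite tevlin (tlinD m0l) (tlinZ m0l) tensDE tensZE.
have Econt : tcont E.
  move=> i w; exists tt.
  exists (tsupport m0c w ++ flatten [seq tsupport (xlc i a).2 w | a <- index_enum _]) => f hf.
  have hf' u : u \in tsupport m0c w ++ flatten [seq tsupport (xlc i a).2 w | a <- index_enum _] ->
      f u = (0 : T) u by move=> /hf[? _]; rewrite tens0E.
  apply/lev0P; rewrite EE; congr (_, _).
    rewrite (tsupport_eq m0l (Dcont := m0c) (g := 0)) ?(tlin0 m0l) ?tens0E //.
    by move=> u hu; apply: hf'; rewrite mem_cat hu.
  rewrite /tev big1 // => a _.
  rewrite (tsupport_eq (xlc i a).1 (Dcont := (xlc i a).2) (g := 0)).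
    by rewrite (tlin0 (xlc i a).1) tens0E scale0r.
  move=> u hu; apply: hf'; rewrite mem_cat; apply/orP; right.
  by apply/flattenP; exists (tsupport (xlc i a).2 w) => //; apply: map_f; exact: mem_index_enum.
have [D [Dl Dc DE _]] := ext_exists Elin Econt.
exists D; split=> //.
  apply: lc_tred => // f; apply: tensP => w.
  have [i] := afa_inh R; have := EE f w i; rewrite levE => -[h _].
  by rewrite DE -[LHS]/(afa_eps R (E f w)) h.
apply: functional_extensionality_dep => i; apply: tev_inj => f w.
by rewrite tev_fam DE; have := EE f w i; rewrite levE => -[].
Qed.

Lemma MC_deformation (xi : fam (Der_dgLie m) R) : MC_lim xi ->
  exists2 m1 : TR -> TR, is_deformation m m1 & fam_of m1 = xi.
Proof.
case=> xc xMC; have mD : Der_cycl 1 m by case: hm.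
have xD i a : Der_cycl 1 (xi i a) by have [h _] := xMC i; exact: h.
have [|D [Dl Dc Dr DE]] := op_exists (Der_tlinear mD) (Der_tcont mD) xc.
  by move=> i a; split; [exact: Der_tlinear (xD i a) | exact: Der_tcont (xD i a)].
exists D => //; split=> //; split.
  apply: lam_Der => // -[[i a]|].
    by have <- : xi i a = lam_op (Some (existT _ i a)) D by rewrite -DE ffunE.
  have <- // : m = lam_op None D.
  by apply: funext => f; rewrite -[RHS]/(tred (D (const R f))) Dr tred_const.
move=> f; apply: (lc_eq (tlinear_comp Dl Dl) (tcont_comp Dc Dc)
   (D' := fun=> 0)) => [|| g].
- by have [] := @derivation0 k d V R 0.
- by have [] := @derivation0 k d V R 0.
apply: tensP => w; apply: lev_inj => i; rewrite (op_comp_lev _ _ _ Dl Dc Dr Dr) tens0E lev0.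
have [_ mm] := hm; rewrite mm tens0E -(tev_MC m char0) DE.
by have [_ ->] := xMC i; rewrite tev0.
Qed.
End Deformations.

(** ** Base change *)

Section DefEquiv.
Variables (k : fieldType) (d : int) (V : invSpace k d) (R : afa k).
Notation TR := (tens V R).
Implicit Types phi psi : TR -> TR.

Lemma morphism_id (m1 : TR -> TR) : is_morphism m1 m1 (fun f => f).
Proof. by split=> //; split=> //; exact: tcont_id. Qed.

Lemma morphism_comp (m1 m2 m3 : TR -> TR) phi psi :
  is_morphism m1 m2 phi -> is_morphism m2 m3 psi -> is_morphism m1 m3 (fun f => phi (psi f)).
Proof.
move=> [[pl pc] ph pM pI [ps po]] [[ql qc] qh qM qI [qs qo]]; split.
- by split; [exact: tlinear_comp | exact: tcont_comp].
- by move=> q f /qh /ph.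
- by move=> f g; rewrite qM pM.
- by move=> f; rewrite pI qI.
- by split=> [f|]; rewrite ?qs ?ps ?qo ?po.
Qed.

Lemma def_equiv_refl (m1 : TR -> TR) : def_equiv m1 m1.
Proof.
exists (fun f => f) => //; split; first exact: morphism_id.
by exists (fun f => f); split=> //; exact: morphism_id.
Qed.

Lemma def_equiv_sym (m1 m2 : TR -> TR) : def_equiv m1 m2 -> def_equiv m2 m1.
Proof.
move=> [phi [hphi [psi [hpsi phiK psiK]]] red]; exists psi.
  by split=> //; exists phi.
by move=> f; rewrite -red psiK.
Qed.

Lemma def_equiv_trans (m1 m2 m3 : TR -> TR) : def_equiv m1 m2 -> def_equiv m2 m3 -> def_equiv m1 m3.
Proof.
move=> [phi [hphi [psi [hpsi phiK psiK]]] red] [phi' [hphi' [psi' [hpsi' phiK' psiK']]] red'].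
exists (fun f => phi (phi' f)); last by move=> f; rewrite red red'.
split; first exact: morphism_comp hphi hphi'.
exists (fun f => psi' (psi f)); split; first exact: morphism_comp hpsi' hpsi.
- by move=> f; rewrite phiK phiK'.
- by move=> f; rewrite psiK' psiK.
Qed.
End DefEquiv.

Section BaseChange.
Variables (k : fieldType) (char0 : [pchar k] =i pred0) (d : int) (V : invSpace k d).
Notation T := (tens V (scalars k)).
Variables (R S : afa k) (phi : afaHom R S).
Notation TR := (tens V R).
Notation TS := (tens V S).
Notation tphi := (tmap phi : TR -> TS).

Lemma ah_alg (a : k) : phi a%:A = a%:A.
Proof. by rewrite linearZ rmorph1. Qed.
Lemma tphiE (f : TR) w : tphi f w = phi (f w). Proof. by []. Qed.
Lemma tphi_const f : tphi (const R f) = const S f.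
Proof. by apply: tensP => w; rewrite tphiE !constE ah_alg. Qed.
Lemma tphi_semilin : semilin phi tphi.
Proof.
split=> [f g|r f]; apply: tensP => w; rewrite ?tensDE ?tscaleE !tphiE.
  by rewrite tensDE; exact: linearD.
by rewrite tscaleE; exact: rmorphM.
Qed.
Lemma tphi_tcont : tcont tphi.
Proof.
move=> j w; have [i hi] := ah_cont phi j; exists i, [:: w] => f hf.
by rewrite tphiE; apply/hi/hf; exact: mem_head.
Qed.
Lemma tphiZ (a : k) f : tphi (a *: f) = a *: tphi f.
Proof. by apply: tensP => w; rewrite tensZE !tphiE tensZE; exact: linearZ. Qed.
Lemma tphi_prod f g : tphi (tprod f g) = tprod (tphi f) (tphi g).
Proof.
apply: tensP => w; rewrite tphiE !tprodE.
have h : {morph phi : x y / x + y} by exact: linearD.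
rewrite (big_morph _ h (linear0 _)); apply: eq_bigr => i _.
exact: rmorphM.
Qed.
Lemma tphi_star f : tphi (star f) = star (tphi f).
Proof. by apply: tensP => w; rewrite tphiE !starE; exact: linearZ. Qed.
Lemma tphi_homog q f : homog q f -> homog q (tphi f).
Proof.
by move=> /homogP h; apply/homogP => w /h e; rewrite tphiE e; exact: linear0.
Qed.
Lemma tphi_form z : tphi (form_elt R z) = form_elt S z.
Proof. by rewrite -(@const_form k d V R) -(@const_form k d V S) tphi_const. Qed.
Lemma tphi_omega : tphi (omega V R) = omega V S.
Proof. by rewrite -(@const_omega k d V R) -(@const_omega k d V S) tphi_const. Qed.

Lemma base_change_dense (D : TR -> TR) (D' : TS -> TS) :
  tlinear D -> tcont D -> tlinear D' -> tcont D' ->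
  (forall f, D' (const S f) = tphi (D (const R f))) -> base_change phi D D'.
Proof.
move=> Dl Dc D'l D'c h f.
apply: (dense_eq (phi := phi) (P1 := fun f => D' (tphi f)) (P2 := fun f => tphi (D f))).
- split=> [g1 g2|r g]; first by rewrite tphi_semilin.1 D'l.1.
  by rewrite tphi_semilin.2 D'l.2.
- split=> [g1 g2|r g]; first by rewrite Dl.1 tphi_semilin.1.
  by rewrite Dl.2 tphi_semilin.2.
- exact: tcont_comp D'c tphi_tcont.
- exact: tcont_comp tphi_tcont Dc.
- by move=> g; rewrite tphi_const h.
Qed.

(** The base change is the linear extension of [D] followed by [phi] on constant
    tensors. *)
Lemma base_change_exists (D : TR -> TR) : tlinear D -> tcont D ->
  exists D' : TS -> TS, [/\ tlinear D', tcont D' & base_change phi D D'].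
Proof.
move=> Dl Dc.
have Elin (a : k) f g : tphi (D (const R (a *: f + g))) =
    a *: tphi (D (const R f)) + tphi (D (const R g)).
  by rewrite constP (tlinD Dl) (tlinZ Dl) tphi_semilin.1 tphiZ.
have Ec : tcont (fun f => tphi (D (const R f))).
  exact: tcont_comp tphi_tcont (tcont_comp Dc (@tcont_const k d V R)).
have [D' [D'l D'c D'E _]] := ext_exists Elin Ec.
by exists D'; split=> //; exact: base_change_dense.
Qed.

Section Transfer.
Variables (D : TR -> TR) (D' : TS -> TS).
Hypotheses (D'l : tlinear D') (D'c : tcont D') (bc : base_change phi D D').

Lemma bc_const f : D' (const S f) = tphi (D (const R f)).
Proof. by rewrite -tphi_const bc. Qed.

Lemma bc_homog p : (forall q f, homog q f -> homog (q + p) (D f)) ->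
  forall q f, homog q f -> homog (q + p) (D' f).
Proof.
move=> h; apply: lc_homog => // q f hf; rewrite bc_const; apply/tphi_homog/h.
exact: const_homog.
Qed.

Lemma bc_star : (forall f, D (star f) = star (D f)) -> forall f, D' (star f) = star (D' f).
Proof.
move=> h; apply: lc_star => // f.
by rewrite !bc_const const_star h tphi_star.
Qed.

Lemma bc_Der p : Der_cycl p D -> Der_cycl p D'.
Proof.
case=> -[Dl Dc Dh DL] Dcyc Ds; split; last exact: bc_star.
  split=> //; first exact: bc_homog.
  apply: lc_leibniz => // q f g hf; rewrite !bc_const const_prod (DL q); last exact: const_homog.
  by rewrite tphi_semilin.1 tphiZ !tphi_prod !tphi_const.
move=> u y z; have hE w x : hat_form p D' w x = phi (hat_form p D w x).
  by rewrite /hat_form -tphi_form bc; apply/esym; exact: linearZ.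
rewrite !hE (Dcyc u y z).
have pZ (a : k) r : phi (a *: r) = a *: phi r by exact: linearZ.
by rewrite !pZ.
Qed.

Lemma bc_tred (D0 : T -> T) : tlinear D0 -> tcont D0 ->
  (forall f, tred (D f) = D0 (tred f)) -> forall f, tred (D' f) = D0 (tred f).
Proof.
move=> D0l D0c h; apply: lc_tred => // f.
rewrite bc_const -[f in RHS](@tred_const k d V R) -h.
by apply: tensP => w; exact: ah_eps.
Qed.
End Transfer.

Lemma bc_comp (D E : TR -> TR) (D' E' : TS -> TS) :
  base_change phi D D' -> base_change phi E E' ->
  base_change phi (fun f => D (E f)) (fun f => D' (E' f)).
Proof. by move=> h1 h2 f; rewrite h2 h1. Qed.

Lemma bc_eq (D : TR -> TR) (D' D'' : TS -> TS) : tlinear D' -> tcont D' ->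
  tlinear D'' -> tcont D'' -> base_change phi D D' -> base_change phi D D'' ->
  forall f, D' f = D'' f.
Proof.
move=> D'l D'c D''l D''c h1 h2; apply: lc_eq => // f.
by rewrite (bc_const h1) (bc_const h2).
Qed.

Lemma bc_morphism (m1 m1' th : TR -> TR) (m2 m2' th' : TS -> TS) :
  tlinear m2 -> tcont m2 -> tlinear m2' -> tcont m2' -> tlinear th' -> tcont th' ->
  base_change phi m1 m2 -> base_change phi m1' m2' -> base_change phi th th' ->
  is_morphism m1 m1' th -> is_morphism m2 m2' th'.
Proof.
move=> l2 c2 l2' c2' lt ct b b' bt [_ hh hM hI [hs ho]]; split=> //.
- move=> q f hf; rewrite -[q]addr0; move: q f hf; apply: (bc_homog lt ct bt).
  by move=> q f; rewrite addr0; exact: hh.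
- apply: lc_mult => // f g.
  by rewrite !(bc_const bt) const_prod hM tphi_prod.
- move=> f; apply: (bc_eq (D' := fun f => m2 (th' f)) (D'' := fun f => th' (m2' f))
    (D := fun f => m1 (th f))).
  + exact: tlinear_comp.
  + exact: tcont_comp.
  + exact: tlinear_comp.
  + exact: tcont_comp.
  + exact: bc_comp.
  + by move=> g; rewrite b' bt hI.
- split; first exact: (bc_star lt ct bt).
  by rewrite -tphi_omega bt ho.
Qed.

Variables (m : T -> T) (hm : cycl_Ainf m).

Lemma m_lin : tlinear m. Proof. by have [[[]]] := hm. Qed.
Lemma m_cont : tcont m. Proof. by have [[[]]] := hm. Qed.
Lemma defo_lin (Q : afa k) (m1 : tens V Q -> tens V Q) : is_deformation m m1 -> tlinear m1.
Proof. by case=> -[[[]]]. Qed.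
Lemma defo_cont (Q : afa k) (m1 : tens V Q -> tens V Q) : is_deformation m m1 -> tcont m1.
Proof. by case=> -[[[]]]. Qed.

Lemma base_change_defo (m1 : TR -> TR) : is_deformation m m1 ->
  exists2 m2 : TS -> TS, is_deformation m m2 & base_change phi m1 m2.
Proof.
move=> h1; have [[D1 s1] r1] := h1.
have [m2 [l2 c2 b2]] := base_change_exists (defo_lin h1) (defo_cont h1).
exists m2 => //; split; last exact: (bc_tred l2 c2 b2 m_lin m_cont).
split; first exact: (bc_Der l2 c2 b2).
have [l0 c0 _ _] := @derivation0 k d V S 0.
apply: (bc_eq (D := fun f => m1 (m1 f)) (D' := fun f => m2 (m2 f)) (D'' := fun=> 0)) => //.
- exact: tlinear_comp.
- exact: tcont_comp.
- exact: bc_comp.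
- by move=> f; rewrite s1 (semilin0 tphi_semilin).
Qed.

Lemma base_change_equiv (m1 m1' : TR -> TR) (m2 m2' : TS -> TS) :
  is_deformation m m1 -> is_deformation m m1' -> is_deformation m m2 -> is_deformation m m2' ->
  base_change phi m1 m2 -> base_change phi m1' m2' -> def_equiv m1 m1' -> def_equiv m2 m2'.
Proof.
move=> h1 h1' h2 h2' b b' [th [thM [ps [psM thK psK]]] red].
have [[tl tc] _ _ _ _] := thM; have [[pl pc] _ _ _ _] := psM.
have [th' [l c bt]] := base_change_exists tl tc.
have [ps' [l' c' bp]] := base_change_exists pl pc.
have [[L2 C2] [L2' C2']] := ((defo_lin h2, defo_cont h2), (defo_lin h2', defo_cont h2')).
have lid : tlinear (fun f : TS => f) by [].
exists th'; last first.
  by apply: (bc_tred (D0 := fun f => f) l c bt) => //; exact: tcont_id.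
split; first exact: (bc_morphism L2 C2 L2' C2' l c b b' bt).
exists ps'; split; first exact: (bc_morphism L2' C2' L2 C2 l' c' b' b bp).
- move=> f; apply: (bc_eq (D := fun f => f) (D' := fun f => ps' (th' f)) (D'' := fun f => f)) => //.
  + exact: tlinear_comp.
  + exact: tcont_comp.
  + exact: tcont_id.
  + by move=> g; rewrite bt bp thK.
- move=> f; apply: (bc_eq (D := fun f => f) (D' := fun f => th' (ps' f)) (D'' := fun f => f)) => //.
  + exact: tlinear_comp.
  + exact: tcont_comp.
  + exact: tcont_id.
  + by move=> g; rewrite bp bt psK.
Qed.

(** Under the correspondence between operators and families, base change is the
    map [id (x) phi]. *)
Lemma push_base_change (m1 : TR -> TR) (m2 : TS -> TS) :
  is_deformation m m1 -> is_deformation m m2 ->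
  push phi (fam_of m m1) (fam_of m m2) <-> base_change phi m1 m2.
Proof.
move=> h1 h2.
have eps1 f w : afa_eps R (m1 (const R f) w) = m f w.
  have [i] := afa_inh R.
  by have [e _] := op_lev m i f w h1.2.
have eps2 f w : afa_eps S (m2 (const S f) w) = m f w.
  have [i] := afa_inh S.
  by have [e _] := op_lev m i f w h2.2.
(* a finite expansion of the values at level [i] remains one at level [j] *)
have approx i j (s : seq (dg_amb (Der_dgLie m) * R)) f w :
    (forall r, afa_nbhs0 i r -> afa_nbhs0 j (phi r)) ->
    (forall t, t \in s -> afa_eps R t.2 = 0) ->
    afa_pr i (m1 (const R f) w) = \sum_(t <- s) (t.1 f w : k) *: afa_pr i t.2 ->
    afa_pr j (phi (m1 (const R f) w)) = \sum_(t <- s) (t.1 f w : k) *: afa_pr j (phi t.2).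
  move=> hij s0 h; pose r := augm (m1 (const R f) w) - \sum_(t <- s) (t.1 f w : k) *: t.2.
  have ri : afa_nbhs0 i r.
    split; rewrite /r linearB linear_sum /=.
      rewrite eps_augm big_seq big1 ?subr0 // => t /s0 e.
      by rewrite linearZ /= e scaler0.
    rewrite pr_augm h; apply/eqP; rewrite subr_eq0; apply/eqP/eq_bigr => t _.
    by rewrite linearZ.
  have [_] := hij _ ri.
  have -> : phi r = phi (m1 (const R f) w) - (m f w : k)%:A
       - \sum_(t <- s) (t.1 f w : k) *: phi t.2.
    rewrite /r /augm !linearB /= ah_alg eps1; congr (_ - _).
    by rewrite linear_sum; apply: eq_bigr => t _; exact: linearZ.
  rewrite !linearB /= pr_alg subr0 linear_sum => /eqP; rewrite subr_eq0 => /eqP ->.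
  by apply: eq_bigr => t _; rewrite linearZ.
split=> [h|bch].
  apply: base_change_dense; [exact: defo_lin h1|exact: defo_cont h1|exact: defo_lin h2
    |exact: defo_cont h2|].
  move=> f; apply: tensP => w; apply: eps_pr_eq => [|j].
    by rewrite eps2 tphiE ah_eps eps1.
  have [i [hij [s [s0 hx hy]]]] := h j.
  rewrite -(tev_fam m) hy tev_sum tphiE (approx i j s) //.
    by apply: eq_bigr => t _; rewrite tev_pure.
  by rewrite -(tev_fam m) hx tev_sum; apply: eq_bigr => t _; rewrite tev_pure.
move=> j; have [i hij] := ah_cont phi j; exists i; split=> //.
have [n [s [l hl]]] := lev_lift i.
pose x1 : tensA (T -> T) (afa_A i) := fam_of m m1 i.
(* the coordinates of [m1] along a family spanning level [i] *)
pose Lb b : T -> T := \sum_(a < \dim {:afa_A i}) (l b ((0, (vbasis {:afa_A i})`_a) : unitz (afa_A i)) : k)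
   *: (x1 a : T -> T).
have LbE c f w : (Lb c f w : k) = l c ((0, tev x1 f w) : unitz (afa_A i)).
  have -> : ((0, tev x1 f w) : unitz (afa_A i)) =
     \sum_(a < \dim {:afa_A i}) (x1 a f w : k) *: ((0, (vbasis {:afa_A i})`_a) : unitz (afa_A i)).
    rewrite /tev; elim/big_rec2: _ => [//|a y1 y2 _ <-].
    by rewrite -[RHS]/(_ * 0 + 0, _ *: _ + y2) mulr0 addr0.
  rewrite linear_sum /Lb fct_sumE tens_sumE; apply: eq_bigr => a _.
  by rewrite linearZ; exact: mulrC.
have xE f w : afa_pr i (m1 (const R f) w) =
    \sum_b (Lb b f w : k) *: afa_pr i (augm (s b)).
  have : (0, afa_pr i (m1 (const R f) w)) = lev i (augm (m1 (const R f) w)).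
    by rewrite levE eps_augm pr_augm.
  rewrite hl => /(congr1 snd) /= ->.
  have sndP : {morph (fun x : unitz (afa_A i) => x.2) : x y / x + y} by [].
  rewrite [LHS](big_morph _ sndP erefl); apply: eq_bigr => b _.
  by rewrite LbE tev_fam -[lev_fun _ _]/(lev i (augm (m1 (const R f) w))) levE eps_augm !pr_augm.
exists [seq ((Lb b : dg_amb (Der_dgLie m)), augm (s b)) | b <- index_enum 'I_n]; split.
- by move=> t /mapP[b _ ->]; rewrite eps_augm.
- apply: tev_inj => f w; rewrite tev_fam xE big_map tev_sum; apply: eq_bigr => b _.
  by rewrite tev_pure.
apply: tev_inj => f w; rewrite tev_fam (bc_const bch) tphiE.
rewrite (approx i j [seq ((Lb b : dg_amb (Der_dgLie m)), augm (s b)) | b <- index_enum 'I_n]) //.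
- by rewrite tev_sum; apply: eq_bigr => t _; rewrite tev_pure.
- by move=> t /mapP[c _ ->]; rewrite eps_augm.
- by rewrite xE big_map.
Qed.
End BaseChange.

(** ** Pronilpotent operators *)
Section Pronilpotent.
Variables (k : fieldType) (d : int) (V : invSpace k d) (R : afa k).
Notation T := (tens V (scalars k)).
Notation TR := (tens V R).

(** Equality modulo the [i]th basic neighbourhood. *)
Definition feq (i : afa_I R) (f g : TR) := forall w, lev i (f w) = lev i (g w).

Lemma feq_refl i f : feq i f f. Proof. by []. Qed.
Lemma feq_sym i f g : feq i f g -> feq i g f. Proof. by move=> h w; rewrite h. Qed.
Lemma feq_trans i f g h : feq i f g -> feq i g h -> feq i f h.
Proof. by move=> h1 h2 w; rewrite h1 h2. Qed.
Lemma feq_eq f g : (forall i, feq i f g) -> f = g.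
Proof. by move=> h; apply: tensP => w; apply: lev_inj => i; exact: h. Qed.
Lemma feqD i f f' g g' : feq i f f' -> feq i g g' -> feq i (f + g) (f' + g').
Proof. by move=> h1 h2 w; rewrite !tensDE !levD h1 h2. Qed.
Lemma feqZ i (a : k) f f' : feq i f f' -> feq i (a *: f) (a *: f').
Proof. by move=> h1 w; rewrite !tensZE !levZ h1. Qed.
Lemma feq_sum i (I : Type) (s : seq I) (P : pred I) (F G : I -> TR) :
  (forall j, P j -> feq i (F j) (G j)) ->
  feq i (\sum_(j <- s | P j) F j) (\sum_(j <- s | P j) G j).
Proof.
move=> h; elim/big_rec2: _ => [|j x y Pj e]; first exact: feq_refl.
by apply: feqD => //; exact: h.
Qed.
Lemma feq_prod i f f' g g' : feq i f f' -> feq i g g' -> feq i (tprod f g) (tprod f' g').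
Proof.
move=> h1 h2 w; rewrite !tprodE !lev_sum; apply: eq_bigr => j _.
by rewrite !lev_mul h1 h2.
Qed.
Lemma feq_lc i (D : TR -> TR) f g : tlinear D -> tcont D -> feq i f g -> feq i (D f) (D g).
Proof.
move=> Dl Dc h w; rewrite !lev_lc_coord //; apply: eq_bigr => c _.
suff -> : @uval k d V R i f c = @uval k d V R i g c by [].
by apply: tensP => u; rewrite -[LHS]/(ucoord c (lev i (f u))) h.
Qed.

(** These are the operators whose exponential converges. *)
Definition small (X : TR -> TR) := forall f, tred (X f) = 0.

Lemma smallE X f w : small X -> afa_eps R (X f w) = 0.
Proof. by move=> h; rewrite -[LHS]/(tred (X f) w) h tens0E. Qed.

(** The annihilators of the powers of a nilpotent algebra form an increasing
    filtration. *)
Definition kills (A : nilAlg k) n (a : A) :=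
  forall s : seq A, (n <= size s)%N -> foldl (@na_mul k A) a s = 0.

Lemma foldlD (A : nilAlg k) (s : seq A) x y :
  foldl (@na_mul k A) (x + y) s = foldl (@na_mul k A) x s + foldl (@na_mul k A) y s.
Proof. by elim: s x y => //= z s IH x y; rewrite na_mulAl IH. Qed.
Lemma foldlZ (A : nilAlg k) (s : seq A) (c : k) x :
  foldl (@na_mul k A) (c *: x) s = c *: foldl (@na_mul k A) x s.
Proof. by elim: s x => //= z s IH x; rewrite na_mulZl IH. Qed.
Lemma foldl0 (A : nilAlg k) (s : seq A) : foldl (@na_mul k A) 0 s = 0.
Proof. by have := foldlZ s 0 0; rewrite !scale0r. Qed.
Lemma foldl_sum (A : nilAlg k) (s : seq A) (I : Type) (r : seq I) (F : I -> A) :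
  foldl (@na_mul k A) (\sum_(i <- r) F i) s = \sum_(i <- r) foldl (@na_mul k A) (F i) s.
Proof. by elim/big_rec2: _ => [|i y x _ <-]; rewrite ?foldl0 ?foldlD. Qed.
Lemma foldlM (A : nilAlg k) (s : seq A) x y :
  foldl (@na_mul k A) (na_mul x y) s = na_mul x (foldl (@na_mul k A) y s).
Proof. by elim: s x y => //= z s IH x y; rewrite -na_mulA IH. Qed.

Section Filtration.
Variables (i : afa_I R) (N : nat).
Hypothesis nilp : forall (x : afa_A i) s, (N <= size s)%N -> foldl (@na_mul k _) x s = 0.

(** Tensors with values in a step of the filtration.  Beyond the nilpotency index
    [N] the condition is empty, so that tensors with nonzero reduction qualify
    too. *)
Definition ann n (f : TR) := (n <= N)%N -> forall w,
  afa_eps R (f w) = 0 /\ kills n (afa_pr i (f w)).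

Lemma ann_top n f : (N < n)%N -> ann n f.
Proof. by move=> h; rewrite /ann leqNgt h. Qed.
Lemma annP n (a : k) f g : ann n f -> ann n g -> ann n (a *: f + g).
Proof.
move=> hf hg nN w; have [e1 k1] := hf nN w; have [e2 k2] := hg nN w.
rewrite tensDE tensZE !linearD !linearZ /= e1 e2 scaler0 addr0; split=> // s hs.
by rewrite foldlD foldlZ k1 // k2 // scaler0 addr0.
Qed.
Lemma ann0 f : ann 0 f -> feq i f 0.
Proof.
move=> h w; have [e hk] := h (leq0n _) w; rewrite tens0E lev0 levE e.
by have /= -> := hk [::] (leqnn _).
Qed.

Let part (f : TR) (a : 'I_(\dim {:afa_A i})) : T := tmap (acoord a) (tmap (afa_pr i) f).

(** Each coordinate of the sum is the image under [Z] of a coordinate of the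
    products of [f] with [s], which vanish. *)
Lemma ann_lin n f (Z : T -> T) w s : (n <= N)%N -> tlinear Z -> ann n f -> (n <= size s)%N ->
  \sum_a (Z (part f a) w : k) *: foldl (@na_mul k _) (vbasis {:afa_A i})`_a s = 0.
Proof.
move=> nN Zl hf hs; apply: vectP => b; rewrite linear_sum linear0.
pose E (a : 'I_(\dim {:afa_A i})) : k :=
  coord (vbasis {:afa_A i}) b (foldl (@na_mul k _) (vbasis {:afa_A i})`_a s).
transitivity (Z (\sum_a E a *: part f a) w : k).
  rewrite (tlin_sum Zl) tens_sumE; apply: eq_bigr => a _.
  by rewrite (tlinZ Zl) tensZE [LHS]linearZ; exact: mulrC.
suff -> : \sum_a E a *: part f a = 0 by rewrite (tlin0 Zl) tens0E.
apply: tensP => u; rewrite tens0E tens_sumE.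
have [_ /(_ s hs) h] := hf nN u.
have := congr1 (coord (vbasis {:afa_A i}) b) h.
rewrite {1}(coord_vbasis (memvf (afa_pr i (f u)))) foldl_sum linear_sum linear0 => e.
rewrite -[RHS]e; apply: eq_bigr => a _; rewrite tensZE foldlZ [RHS]linearZ; exact: mulrC.
Qed.

Lemma part_lev (D : TR -> TR) n f w : (n <= N)%N -> tlinear D -> tcont D -> ann n f ->
  lev i (D f w) = \sum_a bmul (lev i (D (const R (part f a)) w))
               ((0, (vbasis {:afa_A i})`_a) : unitz (afa_A i)).
Proof.
move=> nN Dl Dc hf; rewrite lev_parts //.
have -> : tred f = 0 by apply: tensP => u; rewrite tens0E; have [] := hf nN u.
have -> : const R (0 : T) = 0 by apply: tensP => u; rewrite constE !tens0E scale0r.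
by rewrite (tlin0 Dl) tens0E lev0 add0r.
Qed.

Lemma ann_mul n f (D : TR -> TR) w s : (n <= N)%N -> tlinear D -> ann n f ->
  (n <= (size s).+1)%N ->
  \sum_a na_mul (afa_pr i (D (const R (part f a)) w))
     (foldl (@na_mul k _) (vbasis {:afa_A i})`_a s) = 0.
Proof.
move=> nN Dl hf hs.
pose e (c : 'I_(\dim {:afa_A i})) := (vbasis {:afa_A i})`_c.
transitivity (\sum_(c < \dim {:afa_A i}) \sum_(a < \dim {:afa_A i}) (lam_op (Some (existT _ i c)) D (part f a) w : k) *:
    foldl (@na_mul k _) (e a) (rcons s (e c))).
  rewrite exchange_big; apply: eq_bigr => a _.
  rewrite {1}(coord_vbasis (memvf (afa_pr i _))) na_mul_suml; apply: eq_bigr => c _.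
  by rewrite na_mulZl foldl_rcons na_mulC.
rewrite big1 // => c _; apply: (@ann_lin n f _ w _ nN _ hf); first exact: tlinear_lam.
by rewrite size_rcons.
Qed.

(** A value of [X] lies in the ideal and contributes one more factor. *)
Lemma ann_small n f (X : TR -> TR) : tlinear X -> tcont X -> small X ->
  ann n.+1 f -> ann n (X f).
Proof.
move=> Xl Xc Xs hf nN w; split; first exact: smallE.
move=> s hs; have [nN'|Nn] := ltnP n N; last by apply: nilp; exact: leq_trans hs.
have := part_lev w nN' Xl Xc hf; rewrite levE => /(congr1 snd) /= ->.
have sndP : {morph (fun x : unitz (afa_A i) => x.2) : x y / x + y} by [].
rewrite [X in foldl _ X s](big_morph _ sndP erefl) foldl_sum.
rewrite -[RHS](@ann_mul n.+1 f X w s nN' Xl hf) //; apply: eq_bigr => a _.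
by rewrite /= smallE // !scale0r !add0r foldlM.
Qed.

Lemma ann_lc n f (D : TR -> TR) : tlinear D -> tcont D -> ann n f -> ann n (D f).
Proof.
move=> Dl Dc hf nN w.
have := part_lev w nN Dl Dc hf; rewrite levE => e; split.
  rewrite -[LHS]/((afa_eps R (D f w), afa_pr i (D f w)).1) e.
  have fstP : {morph (fun x : unitz (afa_A i) => x.1) : x y / x + y} by [].
  by rewrite (big_morph _ fstP erefl) big1 // => a _; rewrite /= mulr0.
move=> s hs; have /= -> := congr1 snd e.
have sndP : {morph (fun x : unitz (afa_A i) => x.2) : x y / x + y} by [].
rewrite (big_morph _ sndP erefl) foldl_sum.
transitivity (\sum_a ((lam_op None D (part f a) w : k) *:
      foldl (@na_mul k _) (vbasis {:afa_A i})`_a s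
   + na_mul (afa_pr i (D (const R (part f a)) w))
     (foldl (@na_mul k _) (vbasis {:afa_A i})`_a s))).
  by apply: eq_bigr => a _; rewrite /= scale0r addr0 foldlD foldlZ foldlM.
rewrite big_split (@ann_lin n f (lam_op None D) w s nN _ hf hs); last exact: tlinear_lam.
by rewrite [LHS]add0r (@ann_mul n f D w s nN Dl hf) // leqW.
Qed.

(** Every tensor satisfies [ann n] for [n] beyond the nilpotency index, and
    [ann 0] means vanishing at the given level: an operator lowering by more than
    the index is zero there ([lowers_zero]). *)
Definition lowers j (Z : TR -> TR) := forall n f, ann (n + j) f -> ann n (Z f).

Lemma lowers_small X : tlinear X -> tcont X -> small X -> lowers 1 X.
Proof. by move=> Xl Xc Xs n f; rewrite addn1; exact: ann_small. Qed.
Lemma lowers_lc D : tlinear D -> tcont D -> lowers 0 D.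
Proof. by move=> Dl Dc n f; rewrite addn0; exact: ann_lc. Qed.
Lemma lowers_comp j j' Z Z' : lowers j Z -> lowers j' Z' -> lowers (j + j') (fun f => Z (Z' f)).
Proof. by move=> h h' n f hf; apply/h/h'; rewrite -addnA. Qed.
Lemma lowers_comb j (a : k) Z Z' : lowers j Z -> lowers j Z' ->
  lowers j (fun f => a *: Z f + Z' f).
Proof. by move=> h h' n f hf; apply: annP; [exact: h|exact: h']. Qed.
Lemma lowers_iter X n : lowers 1 X -> lowers n (fun f => iter n X f).
Proof.
move=> h; elim: n => [|n IH] n' f; first by rewrite addn0.
by rewrite addnS -addSn => /IH; rewrite -addn1 => /h.
Qed.
Lemma lowers_zero j Z f : lowers j Z -> (N < j)%N -> feq i (Z f) 0.
Proof. by move=> h Nj; apply/ann0/h/ann_top. Qed.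
End Filtration.

Definition nilidx (i : afa_I R) := projT1 (cid (na_nilp (afa_A i))).
Lemma nilidxP i (x : afa_A i) s : (nilidx i <= size s)%N -> foldl (@na_mul k _) x s = 0.
Proof. by rewrite /nilidx; case: cid => N hN; exact: hN. Qed.

Definition lowers_all j Z := forall i, lowers i (nilidx i) j Z.

(** At each level the terms eventually vanish, so that the partial sums are
    stationary and define an element of the limit. *)
Lemma series_exists (Z : nat -> TR -> TR) :
  (forall n, tlinear (Z n)) -> (forall n, tcont (Z n)) -> (forall n, lowers_all n (Z n)) ->
  exists D : TR -> TR, [/\ tlinear D, tcont D &
    forall i K f, (nilidx i < K)%N -> feq i (D f) (\sum_(n < K) Z n f)].
Proof.
move=> Zl Zc Zlow.
pose P K f := \sum_(n < K) Z n f.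
(* all partial sums beyond the nilpotency index agree *)
have stable i K f : (nilidx i < K)%N -> feq i (P K f) (P (nilidx i).+1 f).
  move=> hK; rewrite /P -(subnKC hK); elim: (K - _)%N => [|n IH]; first by rewrite addn0.
  rewrite addnS big_ord_recr /=; apply: (feq_trans _ IH).
  rewrite -[X in feq _ _ X]addr0; apply: feqD; first exact: feq_refl.
  by apply: lowers_zero (Zlow _ i) _; rewrite ltnS leq_addr.
have ex f w : exists r : R, forall i, lev i r = lev i (P (nilidx i).+1 f w).
  apply: lev_lim => i j ij; rewrite utr_lev //.
  rewrite -(stable i (maxn (nilidx i) (nilidx j)).+1) ?ltnS ?leq_maxl //.
  apply/esym; rewrite -!(utr_lev _ ij); congr utr; apply: stable.
  by rewrite ltnS leq_maxr.
pose e f w := projT1 (cid (ex f w)).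
have eE f w i : lev i (e f w) = lev i (P (nilidx i).+1 f w) by rewrite /e; case: cid.
have Pl K : tlinear (P K).
  split=> [f g|r f]; rewrite /P.
    by rewrite -big_split; apply: eq_bigr => n _; rewrite (tlinD (Zl n)).
  apply: tensP => w; rewrite tscaleE !tens_sumE mulr_sumr; apply: eq_bigr => n _.
  by rewrite (tlinS (Zl n)) tscaleE.
have Pc K : tcont (P K).
  elim: K => [|K IH].
    have [_ c0 _ _] := @derivation0 k d V R 0.
    by have -> : P 0%N = fun=> 0 by apply: funext => f; rewrite /P big_ord0.
  have -> : P K.+1 = fun f => 1 *: P K f + Z K f.
    by apply: funext => f; rewrite /P big_ord_recr scale1r.
  exact: tcont_comb.
have eml f : multilinear (e f).
  move=> i a x y u v; apply: lev_inj => j; rewrite levD levZ !eE tens_multilinear.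
  by rewrite levD levZ.
have e0 f : e f [::] = 0 by apply: lev_inj => j; rewrite eE !tens_nil.
pose D f : TR := mk_tens (eml f) (e0 f).
have DE i f w : lev i (D f w) = lev i (P (nilidx i).+1 f w) by exact: eE.
exists D; split.
- split=> [f g|r f]; apply: tensP => w; apply: lev_inj => i.
    by rewrite tensDE levD !DE (tlinD (Pl _)) tensDE levD.
  by rewrite tscaleE lev_mul !DE (tlinS (Pl _)) tscaleE lev_mul.
- move=> i w; have [i' [L hL]] := Pc (nilidx i).+1 i w; exists i', L => f /hL h.
  by apply/lev0P; rewrite DE; apply/lev0P.
- by move=> i K f hK w; rewrite DE; apply/esym/stable.
Qed.
End Pronilpotent.

(** ** Exponentials *)

Lemma triangle_sum (U : zmodType) (F : nat -> nat -> U) M :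
  \sum_(n < M) \sum_(a < n.+1) F a (n - a)%N = \sum_(a < M) \sum_(b < M - a) F a b.
Proof.
elim: M => [|M IH]; first by rewrite !big_ord0.
rewrite big_ord_recr IH [RHS]big_ord_recr /= subSnn big_ord1.
rewrite [X in _ + X = _]big_ord_recr /= subnn addrA; congr (_ + _).
rewrite -big_split; apply: eq_bigr => a _ /=.
by rewrite subSn ?big_ord_recr // ltnW.
Qed.

(** The Cauchy product of two sums whose terms vanish from index [K] on. *)
Lemma diag_sum (U : zmodType) (F : nat -> nat -> U) K :
  (forall a b, (K <= a)%N || (K <= b)%N -> F a b = 0) ->
  \sum_(n < K + K) \sum_(a < n.+1) F a (n - a)%N = \sum_(a < K) \sum_(b < K) F a b.
Proof.
move=> F0; rewrite triangle_sum big_split_ord /= [X in _ + X]big1 ?addr0; last first.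
  by move=> a _; rewrite big1 // => b _; rewrite F0 // leq_addr.
apply: eq_bigr => -[a aK] _ /=; rewrite -addnBA 1?ltnW // big_split_ord /=.
by rewrite [X in _ + X]big1 ?addr0 // => b _; rewrite F0 // leq_addr orbT.
Qed.

(** If [Z] acts on [F a b] as the derivation [F a b |-> (a+1) F (a+1) b + (b+1) F a (b+1)],
    its divided powers on [F 0 0] are given by the binomial formula. *)
Lemma divided_binomial (k : fieldType) (char0 : [pchar k] =i pred0) (U : lmodType k)
    (F : nat -> nat -> U) (X : nat -> U) (Z : U -> U) :
  (forall x y, Z (x + y) = Z x + Z y) -> Z 0 = 0 ->
  (forall a b, Z (F a b) = a.+1%:R *: F a.+1 b + b.+1%:R *: F a b.+1) ->
  X 0%N = F 0%N 0%N -> (forall n, n.+1%:R *: X n.+1 = Z (X n)) ->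
  forall n, X n = \sum_(a < n.+1) F a (n - a)%N.
Proof.
move=> ZD Z0 ZF X0 XS; elim=> [|n IH]; first by rewrite big_ord1.
have nz : n.+1%:R != 0 :> k by have /pcharf0P -> := char0.
apply: (scalerI nz); rewrite XS IH (big_morph Z ZD Z0).
under eq_bigr => a _ do rewrite ZF.
rewrite big_split /=.
have -> : \sum_(a < n.+1) a.+1%:R *: F a.+1 (n - a)%N =
          \sum_(a < n.+2) a%:R *: F a (n.+1 - a)%N :> U.
  by rewrite [RHS]big_ord_recl scale0r add0r; apply: eq_bigr.
have -> : \sum_(a < n.+1) (n - a).+1%:R *: F a (n - a).+1 =
          \sum_(a < n.+2) (n.+1 - a)%:R *: F a (n.+1 - a)%N :> U.
  rewrite [RHS]big_ord_recr /= subnn scale0r addr0; apply: eq_bigr => -[a an] _ /=.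
  by rewrite subSn.
rewrite -big_split scaler_sumr; apply: eq_bigr => -[a an] _ /=.
by rewrite -scalerDl -natrD subnKC // ltnW.
Qed.

Section Exp.
Variables (k : fieldType) (char0 : [pchar k] =i pred0) (d : int) (V : invSpace k d).
Variable R : afa k.
Notation T := (tens V (scalars k)).
Notation TR := (tens V R).

Definition lc (D : TR -> TR) := tlinear D /\ tcont D.

Lemma lc_comp D E : lc D -> lc E -> lc (fun f => D (E f)).
Proof. by move=> [h1 h2] [h3 h4]; split; [exact: tlinear_comp | exact: tcont_comp]. Qed.
Lemma lc_comb a D E : lc D -> lc E -> lc (fun f => a *: D f + E f).
Proof. by move=> [h1 h2] [h3 h4]; split; [exact: tlinear_comb | exact: tcont_comb]. Qed.
Lemma lc_id : lc (fun f => f). Proof. by split=> //; exact: tcont_id. Qed.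
Lemma lc_0 : lc (fun _ => 0). Proof. by have [] := @derivation0 k d V R 0. Qed.
Lemma lc_scale a D : lc D -> lc (fun f => a *: D f).
Proof.
by move=> h; have := lc_comb a h lc_0; under eq_fun do rewrite addr0.
Qed.
Lemma lc_sub D E : lc D -> lc E -> lc (fun f => D f - E f).
Proof.
move=> hD hE; have := lc_comb (-1) hE hD; congr lc; apply: funext => f.
by rewrite scaleN1r addrC.
Qed.
Lemma lc_iter n D : lc D -> lc (fun f => iter n D f).
Proof. by move=> h; elim: n => [|n IH]; [exact: lc_id | exact: lc_comp h IH]. Qed.
Lemma lc_sum K (Z : nat -> TR -> TR) : (forall n, lc (Z n)) -> lc (fun f => \sum_(n < K) Z n f).
Proof.
move=> h; elim: K => [|K IH]; first by under eq_fun do rewrite big_ord0; exact: lc_0.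
under eq_fun do rewrite big_ord_recr /=.
have := lc_comb 1 IH (h K); congr lc; apply: funext => f; by rewrite scale1r.
Qed.

Definition divpow (Y : TR -> TR) n f : TR := n`!%:R^-1 *: iter n Y f.

Lemma divpow0 Y f : divpow Y 0 f = f.
Proof. by rewrite /divpow fact0 invr1 scale1r. Qed.
Lemma divpowS Y n f : tlinear Y -> n.+1%:R *: divpow Y n.+1 f = Y (divpow Y n f).
Proof.
move=> Yl; rewrite /divpow (tlinZ Yl) scalerA factS natrM invfM mulrA divff ?mul1r //.
by have /pcharf0P -> := char0.
Qed.
Lemma lc_divpow Y n : lc Y -> lc (divpow Y n).
Proof. by move=> h; exact: lc_scale (lc_iter n h). Qed.

Lemma lowers_divpow Y n : lc Y -> small Y -> lowers_all n (divpow Y n).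
Proof.
move=> [Yl Yc] Ys i.
have h := lowers_iter (n := n) (lowers_small (nilidxP (i := i)) Yl Yc Ys).
have l0 : lowers i (nilidx i) n (fun _ : TR => 0).
  by move=> n' f _ _ w; rewrite tens0E !linear0; split=> // s _; rewrite foldl0.
have := lowers_comb (n`!%:R^-1) h l0; congr lowers; apply: funext => f.
by rewrite addr0.
Qed.

(** The series is finite at each level, and may be cut anywhere beyond the
    nilpotency index. *)
Definition is_exp Y e := lc e /\
  forall i K f, (nilidx i < K)%N -> feq i (e f) (\sum_(n < K) divpow Y n f).

Lemma exp_exists Y : lc Y -> small Y -> exists e, is_exp Y e.
Proof.
move=> Ylc Ys; have [|||D [Dl Dc DE]] := @series_exists k d V R (divpow Y).
- by move=> n; have [] := lc_divpow n Ylc.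
- by move=> n; have [] := lc_divpow n Ylc.
- by move=> n; exact: lowers_divpow.
- by exists D; split.
Qed.

(** The Cauchy product of two series that are finite at the given level. *)
Lemma feq_diag i K (F : nat -> nat -> TR) (X : nat -> TR) :
  (forall a b, (K <= a)%N || (K <= b)%N -> feq i (F a b) 0) ->
  (forall n, X n = \sum_(a < n.+1) F a (n - a)%N) ->
  feq i (\sum_(n < K + K) X n) (\sum_(a < K) \sum_(b < K) F a b).
Proof.
move=> F0 XE w; rewrite !tens_sumE !lev_sum.
under eq_bigr => n _ do rewrite XE tens_sumE lev_sum.
under [RHS]eq_bigr => n _ do rewrite tens_sumE lev_sum.
apply: (diag_sum (F := fun a b => lev i (F a b w))) => a b hab.
by rewrite F0 // tens0E lev0.
Qed.

Lemma divpow_zero Y i n f : lc Y -> small Y -> (nilidx i < n)%N -> feq i (divpow Y n f) 0.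
Proof. by move=> Ylc Ys hn; exact: (lowers_zero f (@lowers_divpow Y n Ylc Ys i) hn). Qed.

Lemma small_neg Y : small Y -> small (fun f : TR => - Y f).
Proof.
move=> h f; apply: tensP => w; rewrite -[LHS]/(afa_eps R ((- Y f) w)) tensNE linearN /=.
by rewrite (smallE _ _ h) oppr0.
Qed.
Lemma lc_neg Y : lc Y -> lc (fun f => - Y f).
Proof. by move=> h; have := lc_scale (-1) h; under eq_fun do rewrite scaleN1r. Qed.

Lemma is_exp_lt Y e i f : is_exp Y e -> feq i (e f) (\sum_(n < (nilidx i).+1) divpow Y n f).
Proof. by case=> _; apply. Qed.
Lemma is_exp_dbl Y e i f : is_exp Y e ->
  feq i (e f) (\sum_(n < (nilidx i).+1 + (nilidx i).+1) divpow Y n f).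
Proof. by case=> _; apply; rewrite addSn ltnS leq_addr. Qed.

(** The terms [(-Y)^a Y^b / (a! b!)] of total degree [n] sum to the divided power
    of [Y - Y]. *)
Lemma exp_neg Y e e' : lc Y -> small Y -> is_exp Y e -> is_exp (fun f => - Y f) e' ->
  forall f, e' (e f) = f.
Proof.
move=> Ylc Ys eP e'P f; apply: feq_eq => i; have [Yl Yc] := Ylc.
have [e'l e'c] := e'P.1.
set Y' := (fun f => - Y f) in e'P *.
have Y'lc : lc Y' by exact: lc_neg.
have Y's : small Y' by exact: small_neg.
pose F a b := divpow Y' a (divpow Y b f).
have Ycomm a g : divpow Y' a (Y g) = Y (divpow Y' a g).
  rewrite /divpow (tlinZ Yl); congr (_ *: _).
  by elim: a => //= a ->; rewrite /Y' (tlinN Yl).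
apply: (feq_trans (is_exp_lt i (e f) e'P)).
apply: (@feq_trans _ _ _ _ _ _ (\sum_(a < (nilidx i).+1) \sum_(b < (nilidx i).+1) F a b)).
  apply: feq_sum => a _; have [al ac] := lc_divpow a Y'lc.
  rewrite /F -(tlin_sum al (index_enum 'I_(nilidx i).+1) xpredT (fun b => divpow Y b f)).
  by apply: feq_lc => //; exact: is_exp_lt.
apply: (@feq_trans _ _ _ _ _ _ (\sum_(n < (nilidx i).+1 + (nilidx i).+1) if nat_of_ord n == 0%N then f else 0)).
  apply: feq_sym; apply: (feq_diag (F := F) (X := fun n => if n == 0%N then f else 0)).
    move=> a b /orP[h|h]; first exact: divpow_zero.
    have [al ac] := lc_divpow a Y'lc.
    rewrite -(tlin0 al); apply: feq_lc => //; exact: divpow_zero.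
  apply: (divided_binomial char0 (Z := fun=> 0)); rewrite ?addr0 //.
  - move=> a b; rewrite /F divpowS; last by case: Y'lc.
    have [al ac] := lc_divpow a Y'lc.
    by rewrite -(tlinZ al) (divpowS _ _ Yl) Ycomm /Y' addNr.
  - by rewrite /F !divpow0.
  - by move=> n; rewrite scaler0.
by rewrite addSn big_ord_recl /= big1 ?addr0.
Qed.

Lemma is_exp_opp Y e : is_exp Y e -> is_exp (fun f => - (- Y f)) e.
Proof. by under [in X in _ -> X]eq_fun do rewrite opprK. Qed.

(** The divided powers of a derivation satisfy the binomial formula on products. *)
Lemma exp_mult Y e : lc Y -> small Y -> is_exp Y e ->
  (forall f g, Y (tprod f g) = tprod (Y f) g + tprod f (Y g)) ->
  forall f g, e (tprod f g) = tprod (e f) (e g).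
Proof.
move=> Ylc Ys eP YL f g; apply: feq_eq => i; have [Yl Yc] := Ylc.
pose F a b := tprod (divpow Y a f) (divpow Y b g).
apply: (feq_trans (is_exp_dbl i (tprod f g) eP)).
apply: (@feq_trans _ _ _ _ _ _ (\sum_(a < (nilidx i).+1) \sum_(b < (nilidx i).+1) F a b)).
  apply: (feq_diag (F := F) (X := fun n => divpow Y n (tprod f g))).
    move=> a b /orP[h|h].
      rewrite -(tlin0 (tlinear_prodl (divpow Y b g))); apply: feq_prod; last exact: feq_refl.
      exact: divpow_zero.
    rewrite -(tlin0 (tlinear_prodr (divpow Y a f))); apply: feq_prod; first exact: feq_refl.
    exact: divpow_zero.
  apply: (divided_binomial char0 (Z := Y)).
  - exact: tlinD.
  - exact: tlin0.
  - by move=> a b; rewrite /F YL -tprodZl -tprodZr !divpowS.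
  - by rewrite /F !divpow0.
  - by move=> n; rewrite divpowS.
apply: feq_sym; apply: (feq_trans (feq_prod (is_exp_lt i f eP) (is_exp_lt i g eP))).
set S := (X in feq i (tprod _ X) _).
rewrite (tlin_sum (tlinear_prodl S) (index_enum _) xpredT (fun n => divpow Y (nat_of_ord n) f)).
apply: feq_sum => a _.
rewrite (tlin_sum (tlinear_prodr (divpow Y a f)) (index_enum _) xpredT
  (fun n => divpow Y (nat_of_ord n) g)).
exact: feq_refl.
Qed.

(** *** Conjugation by an exponential *)
(** The iterated commutators of [Y] with [M]. *)
Fixpoint adpow (Y M : TR -> TR) l : TR -> TR :=
  if l is l'.+1 then fun f => Y (adpow Y M l' f) - adpow Y M l' (Y f) else M.

Lemma lc_adpow Y M l : lc Y -> lc M -> lc (adpow Y M l).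
Proof.
move=> hY hM; elim: l => //= l IH.
by apply: lc_sub; exact: lc_comp.
Qed.

Lemma lowers_adpow Y M l : lc Y -> small Y -> lc M -> lowers_all l (adpow Y M l).
Proof.
move=> [Yl Yc] Ys [Ml Mc] i; elim: l => [|l IH]; first exact: (lowers_lc (i := i) Ml Mc).
have h := lowers_small (nilidxP (i := i)) Yl Yc Ys.
have h1 := lowers_comp h IH; have h2 := lowers_comp IH h; rewrite add1n in h1.
rewrite addn1 in h2; have := lowers_comb (-1) h2 h1; congr lowers; apply: funext => f.
by rewrite scaleN1r addrC.
Qed.

(** Left multiplication by [Y] is the sum of the commuting operations [ad_Y] and
    right multiplication by [Y], so that [e^Y M = (e^(ad_Y) M) e^Y]. *)
Lemma exp_conj Y M e i K f : lc Y -> small Y -> lc M -> is_exp Y e -> (nilidx i < K)%N ->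
  feq i (e (M f)) (\sum_(l < K) l`!%:R^-1 *: adpow Y M l (e f)).
Proof.
move=> Ylc Ys Mlc eP hK; have [Yl Yc] := Ylc.
pose Ad l f := l`!%:R^-1 *: adpow Y M l f.
have Adlc l : lc (Ad l) by exact: lc_scale (lc_adpow l Ylc Mlc).
have Ad0 l g : (nilidx i < l)%N -> feq i (Ad l g) 0.
  move=> hl; rewrite -(scaler0 _ (l`!%:R^-1)); apply: feqZ.
  exact: (lowers_zero g (@lowers_adpow Y M l Ylc Ys Mlc i) hl).
pose F a b := Ad a (divpow Y b f).
have AdS a g : a.+1%:R *: Ad a.+1 g = Y (Ad a g) - Ad a (Y g).
  rewrite /Ad scalerA factS natrM invfM mulrA divff ?mul1r; last first.
    by have /pcharf0P -> := char0.
  by rewrite /= scalerBr (tlinZ Yl).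
apply: (@feq_trans _ _ _ _ _ _ (\sum_(n < K + K) divpow Y n (M f))).
  by case: eP => _; apply; rewrite (leq_trans hK) // leq_addr.
apply: (@feq_trans _ _ _ _ _ _ (\sum_(a < K) \sum_(b < K) F a b)).
  apply: (feq_diag (F := F) (X := fun n => divpow Y n (M f))).
    move=> a b /orP[h|h]; first by apply: Ad0; exact: leq_trans hK h.
    have [al ac] := Adlc a.
    rewrite -(tlin0 al); apply: feq_lc => //; apply: divpow_zero => //.
    exact: leq_trans hK h.
  apply: (divided_binomial char0 (Z := Y)).
  - exact: tlinD.
  - exact: tlin0.
  - move=> a b; have [al ac] := Adlc a.
    by rewrite /F AdS -(tlinZ al) (divpowS _ _ Yl) subrK.
  - by rewrite /F !divpow0 /Ad fact0 invr1 scale1r.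
  - by move=> n; rewrite divpowS.
apply: feq_sum => a _; have [al ac] := Adlc a.
rewrite /F -(tlin_sum al (index_enum 'I_K) xpredT (fun b => divpow Y b f)).
rewrite -/(Ad a (e f)); apply: feq_lc => //; apply: feq_sym.
by case: eP => _; apply.
Qed.
End Exp.

(** ** The gauge action is conjugation by an exponential *)

Section LeibnizAll.
Variables (k : fieldType) (d : int) (V : invSpace k d).
Notation T := (tens V (scalars k)).

(** For a derivation of degree zero, Leibniz' rule holds for all tensors, as they
    are limits of sums of homogeneous ones. *)
Lemma derivation_leibniz0 (D : T -> T) f g : is_derivation 0 D ->
  D (tprod f g) = tprod (D f) g + tprod f (D g).
Proof.
case=> Dl Dc _ DL; apply: tensP => w.
pose L := tsupport Dc.
pose W := [seq take i u | u <- w :: L w, i <- iota 0 (size u).+1]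
          ++ flatten [seq L (take i w) | i <- iota 0 (size w).+1].
(* the degrees of the prefixes on which the values of [f] are needed *)
pose Q := undup (map (@wdeg k d V) W).
pose f' := \sum_(q <- Q) component q f.
have f'E u : u \in W -> f u = f' u.
  move=> uW; rewrite tens_sumE (bigD1_seq (wdeg u)) ?undup_uniq ?mem_undup ?map_f //=.
  rewrite eqxx big1 ?addr0 // => q /negbTE qu.
  by rewrite eq_sym qu.
have tW u i : u \in w :: L w -> (i <= size u)%N -> take i u \in W.
  move=> uL iu; rewrite mem_cat; apply/orP; left; apply/allpairsPdep.
  by exists u, i; split=> //; rewrite mem_iota add0n ltnS.
have D' : D (tprod f' g) = tprod (D f') g + tprod f' (D g).
  rewrite /f' (tlin_sum (tlinear_prodl g)) !(tlin_sum Dl).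
  rewrite (tlin_sum (tlinear_prodl g)) (tlin_sum (tlinear_prodl (D g))) -big_split.
  apply: eq_bigr => q _; rewrite (DL q) ?mul0r ?scale1r //; exact: component_homog.
have -> : D (tprod f g) w = D (tprod f' g) w.
  apply: (tsupport_eq Dl (Dcont := Dc)) => u uL; rewrite !tprodE.
  apply: eq_bigr => i _; rewrite f'E //; apply: tW; last by rewrite -ltnS.
  by rewrite inE uL orbT.
rewrite D' !tensDE !tprodE; congr (_ + _); apply: eq_bigr => i _; congr (_ * _).
  apply: (tsupport_eq Dl (Dcont := Dc)) => u uL; apply/esym/f'E.
  rewrite mem_cat; apply/orP; right; apply/flattenP; exists (L (take i w)) => //.
  by apply/mapP; exists (nat_of_ord i) => //; rewrite mem_iota add0n ltn_ord.
by apply/esym/f'E/tW; rewrite ?mem_head // -ltnS.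
Qed.

Lemma Der_leibniz0 (R : afa k) (D : tens V R -> tens V R) f g : Der_cycl 0 D ->
  D (tprod f g) = tprod (D f) g + tprod f (D g).
Proof.
move=> DD; have Dl := Der_tlinear DD; have Dc := Der_tcont DD.
have base (f0 g0 : T) : D (const R (tprod f0 g0)) =
    tprod (D (const R f0)) (const R g0) + tprod (const R f0) (D (const R g0)).
  apply: tensP => w; apply: lam_inj => o; rewrite -lam_opE.
  have [der _ _] := Der_lam o DD.
  rewrite (derivation_leibniz0 _ _ der) !tensDE lamD !tprodE !lam_sum; congr (_ + _).
    by apply: eq_bigr => i _; rewrite constE -scalerAr mulr1 lamZ lam_opE [LHS]mulrC.
  by apply: eq_bigr => i _; rewrite constE -scalerAl mul1r lamZ lam_opE.
have step (f0 : T) g0 : D (tprod (const R f0) g0) =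
    tprod (D (const R f0)) g0 + tprod (const R f0) (D g0).
  apply: (dense_eq (phi := idfun) (P1 := fun g => D (tprod (const R f0) g))
    (P2 := fun g => tprod (D (const R f0)) g + tprod (const R f0) (D g))).
  - exact: (tlinear_comp Dl (tlinear_prodr (const R f0))).
  - have := tlinear_comb 1 (tlinear_prodr (D (const R f0)))
      (tlinear_comp (tlinear_prodr (const R f0)) Dl).
    by under eq_fun do rewrite scale1r.
  - exact: (tcont_comp Dc (tcont_prodr (const R f0))).
  - have := tcont_comb 1 (tcont_prodr (D (const R f0)))
      (tcont_comp (tcont_prodr (const R f0)) Dc).
    by under eq_fun do rewrite scale1r.
  - by move=> f1; rewrite -const_prod base.
apply: (dense_eq (phi := idfun) (P1 := fun f => D (tprod f g))
    (P2 := fun f => tprod (D f) g + tprod f (D g))).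
- exact: (tlinear_comp Dl (tlinear_prodl g)).
- have := tlinear_comb 1 (tlinear_comp (tlinear_prodl g) Dl) (tlinear_prodl (D g)).
  by under eq_fun do rewrite scale1r.
- exact: (tcont_comp Dc (tcont_prodl g)).
- have := tcont_comb 1 (tcont_comp (tcont_prodl g) Dc) (tcont_prodl (D g)).
  by under eq_fun do rewrite scale1r.
- by move=> f1; rewrite step.
Qed.
End LeibnizAll.

Section Gauge.
Variables (k : fieldType) (char0 : [pchar k] =i pred0) (d : int) (V : invSpace k d).
Variable R : afa k.
Notation T := (tens V (scalars k)).
Notation TR := (tens V R).

Section ExpMorphism.
Variables (Y e : TR -> TR) (YD : Der_cycl 0 Y) (Ys : small Y) (eP : is_exp Y e).

Lemma Der_lc p (D : TR -> TR) : Der_cycl p D -> lc D.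
Proof. by move=> h; split; [exact: Der_tlinear h | exact: Der_tcont h]. Qed.

Lemma exp_homog q f : homog q f -> homog q (e f).
Proof.
move=> hf; apply/homogP => w hw; apply: lev_inj => i; rewrite lev0 (is_exp_lt i f eP).
have /homogP -> // : homog q (\sum_(n < (nilidx i).+1) divpow Y n f); last by rewrite lev0.
apply: homog_sum => n _; apply: homogZ; elim: (nat_of_ord n) => //= n' IH.
by have [[_ _ Yh _] _ _] := YD; rewrite -[q]addr0; exact: Yh.
Qed.

Lemma exp_star f : e (star f) = star (e f).
Proof.
apply: feq_eq => i; apply: (feq_trans (is_exp_lt i _ eP)).
apply: (@feq_trans _ _ _ _ _ _ (star (\sum_(n < (nilidx i).+1) divpow Y n f))); last first.
  move=> w; rewrite !starE !levZ; congr (_ *: _); exact/esym/is_exp_lt.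
rewrite (tlin_sum (@tlinear_star k d V R)); apply: feq_sum => n _.
rewrite /divpow (tlinZ (@tlinear_star k d V R)); apply: feqZ.
suff -> : iter n Y (star f) = star (iter n Y f) by exact: feq_refl.
by elim: (nat_of_ord n) => //= n' ->; have [_ _ ->] := YD.
Qed.

Lemma exp_fix f : Y f = 0 -> e f = f.
Proof.
move=> Yf; apply: feq_eq => i; apply: (feq_trans (is_exp_lt i _ eP)).
rewrite big_ord_recl divpow0 big1 ?addr0; first exact: feq_refl.
move=> n _; rewrite /divpow lift0 iterSr Yf.
have h : iter n Y 0 = 0 by elim: (nat_of_ord n) => //= n' ->; exact: tlin0 (Der_tlinear YD).
by rewrite h scaler0.
Qed.

Lemma exp_tred f : tred (e f) = tred f.
Proof.
apply: tensP => w; rewrite -[LHS]/(afa_eps R (e f w)) -[RHS]/(afa_eps R (f w)).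
have [i] := afa_inh R; have := is_exp_lt i f eP w; rewrite !levE => -[-> _].
rewrite big_ord_recl divpow0 tensDE tens_sumE linearD linear_sum [X in _ + X]big1 ?addr0 //.
move=> n _; rewrite /divpow lift0 iterS tensZE; set a := _^-1.
transitivity (a *: (afa_eps R (Y (iter n Y f) w) : k^o)); first exact: linearZ.
by rewrite (smallE _ _ Ys) scaler0.
Qed.

Lemma Der_omega : Y (omega V R) = 0.
Proof.
rewrite -const_omega; apply: tensP => w; apply: lam_inj => o.
rewrite -lam_opE; have /Der_cyclP[_ -> _] := Der_lam o YD.
by rewrite !tens0E lam0.
Qed.
End ExpMorphism.

Lemma exp_morphism (Y e : TR -> TR) (m1 m2 : TR -> TR) : Der_cycl 0 Y -> small Y ->
  is_exp Y e -> (forall f, m1 (e f) = e (m2 f)) -> is_morphism m1 m2 e.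
Proof.
move=> YD Ys eP h; split=> //; first by case: eP.
- by move=> q f; exact: (exp_homog YD eP).
- apply: (exp_mult char0 (Der_lc YD) Ys eP) => f g; exact: Der_leibniz0.
- by split; [exact: (exp_star YD eP) | apply: (exp_fix YD eP); exact: Der_omega].
Qed.

Lemma Der_neg p (D : TR -> TR) : Der_cycl p D -> Der_cycl p (fun f => - D f).
Proof.
move=> DD; apply: lam_Der; try by case: (lc_neg (Der_lc DD)).
move=> o; have := Der_comb (-1) (Der_lam o DD) (@Der0 k d V p); congr Der_cycl.
apply: funext => f; rewrite addr0 scaleN1r; apply: tensP => w.
by rewrite tensNE !lam_opE tensNE linearN.
Qed.

Variables (m : T -> T) (hm : cycl_Ainf m).
Notation gL := (Der_dgLie m).
Notation fam_of := (@fam_of k d V R m).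

Lemma fam_of_comb a (D E : TR -> TR) i :
  fam_of (fun f => a *: D f + E f) i = a *: fam_of D i + fam_of E i.
Proof.
apply: tev_inj => f w; rewrite tevD tevZ !tev_fam tensDE tensZE linearD.
by rewrite linearZ.
Qed.

Lemma pr_comp (D E : TR -> TR) (D0 E0 : T -> T) i f w : lc D ->
  (forall f, tred (D f) = D0 (tred f)) -> (forall f, tred (E f) = E0 (tred f)) ->
  afa_pr i (D (E (const R f)) w) =
  (\sum_a (D0 (fam_of E i a f) w : k) *: (vbasis {:afa_A i})`_a)
     + tev (fam_of D i) (E0 f) w + tcomp (fam_of D i) (fam_of E i) f w.
Proof.
by move=> [Dl Dc] Dr Er; have := op_comp_lev m i f w Dl Dc Dr Er; rewrite levE => -[].
Qed.

Lemma tev_fam0 (D : TR -> TR) i w : lc D -> tev (fam_of D i) 0 w = 0.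
Proof.
move=> [Dl _]; rewrite /tev big1 // => a _; rewrite ffunE (tlin0 (tlinear_lam _ Dl)).
by rewrite tens0E scale0r.
Qed.

Lemma small_tred (D : TR -> TR) : small D -> forall f, tred (D f) = (fun _ : T => 0) (tred f).
Proof. by []. Qed.

Lemma sum_zero (i : afa_I R) w : \sum_(a < \dim {:afa_A i}) ((0 : T) w : k) *: (vbasis {:afa_A i})`_a = 0.
Proof. by rewrite big1 // => a _; rewrite tens0E scale0r. Qed.

Lemma fam_of_bracket (Y G : TR -> TR) i : lc Y -> lc G -> small Y -> small G ->
  fam_of (fun f => Y (G f) - G (Y f)) i =
  @dg_br k (tens_dgLie gL (afa_A i)) 0 1 (fam_of Y i) (fam_of G i).
Proof.
move=> Ylc Glc Ys Gs; apply: tev_inj => f w.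
rewrite tev_br_comp mul0r scale1r tev_fam tensBE linearB.
rewrite (pr_comp i f w Ylc (small_tred Ys) (small_tred Gs)).
rewrite (pr_comp i f w Glc (small_tred Gs) (small_tred Ys)).
by rewrite !tev_fam0 // !sum_zero !add0r.
Qed.

(** For [G = m + g], the commutator of [Y] with [G] is the bracket of [Y] with [g]
    minus the differential of [Y]. *)
Lemma fam_of_bracket_defo (Y G : TR -> TR) i : lc Y -> lc G -> small Y ->
  (forall f, tred (G f) = m (tred f)) ->
  fam_of (fun f => Y (G f) - G (Y f)) i =
  (@dg_br k (tens_dgLie gL (afa_A i)) 0 1 (fam_of Y i) (fam_of G i) : tensA (T -> T) (afa_A i))
  - @dg_d k (tens_dgLie gL (afa_A i)) 0 (fam_of Y i).
Proof.
move=> Ylc Glc Ys Gr; apply: tev_inj => f w.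
rewrite tevB tev_br_comp mul0r scale1r tev_d_comp scale1r tev_fam tensBE linearB.
rewrite (pr_comp i f w Ylc (small_tred Ys) Gr) (pr_comp i f w Glc Gr (small_tred Ys)).
rewrite tev_fam0 // sum_zero add0r addr0.
by apply: vectP => c; rewrite !(linearD, linearN); ring.
Qed.

Definition adsum (Y M : TR -> TR) K f : TR := \sum_(l < K) l`!%:R^-1 *: adpow Y M l f.

Section GaugePartial.
Variables (Y M : TR -> TR) (Ylc : lc Y) (Mlc : lc M) (Ys : small Y).
Hypothesis Mr : forall f, tred (M f) = m (tred f).

Lemma small_adpow l : small (adpow Y M l.+1).
Proof.
have tB (f g : TR) : tred (f - g) = tred f - tred g.
  by apply: tensP => w; rewrite tensBE -[LHS]/(afa_eps R ((f - g) w)) tensBE linearB.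
have m0 : m 0 = 0 by have [[[ml _ _ _] _ _] _] := hm; exact: tlin0.
elim: l => [|l IH] f /=; rewrite tB Ys.
  by rewrite Mr Ys m0 subr0.
by rewrite (IH (Y f)) subr0.
Qed.

Lemma fam_of_adpow l i : fam_of (adpow Y M l.+1) i =
  iter l (@dg_br k (tens_dgLie gL (afa_A i)) 0 1 (fam_of Y i))
   ((@dg_br k (tens_dgLie gL (afa_A i)) 0 1 (fam_of Y i) (fam_of M i) : tensA (T -> T) (afa_A i))
    - @dg_d k (tens_dgLie gL (afa_A i)) 0 (fam_of Y i)).
Proof.
elim: l => [|l IH]; first exact: fam_of_bracket_defo.
rewrite iterS -IH; apply: fam_of_bracket => //; last exact: small_adpow.
exact (lc_adpow l.+1 Ylc Mlc).
Qed.

(** For [M = m + xi], the terms of [e^(ad_Y) M - m] are those of the gauge action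
    of [Y] on [xi]. *)
Lemma gauge_partialE K i :
  @gauge_partial k (tens_dgLie gL (afa_A i)) (fam_of Y i) (fam_of M i) K =
  fam_of (adsum Y M K.+1) i.
Proof.
elim: K => [|K IH].
  rewrite /gauge_partial big_geq // addr0; congr (fam_of _ i); apply: funext => f.
  by rewrite /adsum big_ord1 fact0 invr1 scale1r.
have -> : adsum Y M K.+2 =
    fun f => K.+1`!%:R^-1 *: adpow Y M K.+1 f + adsum Y M K.+1 f.
  by apply: funext => f; rewrite [LHS]big_ord_recr addrC.
rewrite fam_of_comb -IH fam_of_adpow /gauge_partial big_nat_recr //= addrA.
exact: addrC.
Qed.

Lemma adsum_tred K f : tred (adsum Y M K.+1 f) = m (tred f).
Proof.
apply: tensP => w; rewrite -Mr -[LHS]/(afa_eps R (adsum Y M K.+1 f w)).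
rewrite -[RHS]/(afa_eps R (M f w)) /adsum big_ord_recl fact0 invr1 scale1r tensDE tens_sumE.
rewrite linearD linear_sum [X in _ + X]big1 ?addr0 // => n _; rewrite lift0 tensZE.
set a := _^-1.
transitivity (a *: (afa_eps R (adpow Y M n.+1 f w) : k^o)); first exact: linearZ.
by rewrite (smallE _ _ (small_adpow n)) scaler0.
Qed.

Lemma lc_adsum K : lc (adsum Y M K).
Proof.
apply: (lc_sum K (Z := fun l f => l`!%:R^-1 *: adpow Y M l f)) => l.
exact: lc_scale (lc_adpow l Ylc Mlc).
Qed.
End GaugePartial.

Lemma feq_of_fam (D E : TR -> TR) (D0 : T -> T) i : lc D -> lc E ->
  (forall f, tred (D f) = D0 (tred f)) -> (forall f, tred (E f) = D0 (tred f)) ->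
  fam_of D i = fam_of E i -> forall f, feq i (D f) (E f).
Proof.
move=> [Dl Dc] [El Ec] Dr Er h f w; rewrite !lev_lc_coord //; apply: eq_bigr => c _.
by rewrite (op_lev m _ _ _ Dr) (op_lev m _ _ _ Er) h.
Qed.

Lemma fam_of_feq (D E : TR -> TR) i : (forall f, feq i (D f) (E f)) ->
  fam_of D i = fam_of E i.
Proof.
move=> h; apply: tev_inj => f w; rewrite !tev_fam.
by have := h (const R f) w; rewrite !levE => -[].
Qed.

(** By [exp_conj] the conjugate of [M] by [e^Y] is [e^(ad_Y) M], whose components
    are the values of the gauge action. *)
Lemma gauge_conj (Y e M M' : TR -> TR) : lc Y -> small Y -> is_exp Y e ->
  (forall g, exists f, e f = g) -> lc M -> lc M' ->
  (forall f, tred (M f) = m (tred f)) -> (forall f, tred (M' f) = m (tred f)) ->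
  (forall f, e (M f) = M' (e f)) <->
  (forall i, exists N, forall K, (N <= K)%N ->
    @gauge_partial k (tens_dgLie gL (afa_A i)) (fam_of Y i) (fam_of M i) K = fam_of M' i).
Proof.
move=> Ylc Ys eP esurj Mlc M'lc Mr M'r; split=> [h i|h f].
  exists (nilidx i) => K hK; rewrite gauge_partialE //; apply: fam_of_feq => g.
  have [f <-] := esurj g; rewrite -h; apply: feq_sym.
  exact: exp_conj.
apply: feq_eq => i; have [N hN] := h i; pose K := maxn N (nilidx i).
apply: (feq_trans (exp_conj char0 (K := K.+1) f Ylc Ys Mlc eP _)).
  by rewrite ltnS leq_maxr.
apply: (feq_of_fam (D := adsum Y M K.+1) (D0 := m)) => //.
- exact: lc_adsum.
- exact: adsum_tred.
by rewrite -gauge_partialE // hN // leq_maxl.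
Qed.
End Gauge.

(** ** Logarithms *)

Section BinomialPoly.
Variables (k : fieldType) (char0 : [pchar k] =i pred0).

Lemma natr_neq0 n : n.+1%:R != 0 :> k.
Proof. by have /pcharf0P -> := char0. Qed.

(** The polynomial [t |-> 'C(t, n)]. *)
Fixpoint binp n : {poly k} :=
  if n is n'.+1 then n%:R^-1 *: (binp n' * ('X - n'%:R%:P)) else 1.

Lemma binpE t n : (binp n).[t%:R] = 'C(t, n)%:R.
Proof.
elim: n => [|n IH]; first by rewrite hornerC bin0.
rewrite hornerZ hornerM IH hornerD hornerN hornerX hornerC.
apply: (mulfI (natr_neq0 n)); rewrite mulrA divff ?mul1r ?natr_neq0 //.
rewrite -natrM mul_bin_left natrM mulrC; case: (leqP n t) => h; first by rewrite natrB.
by rewrite bin_small // !mulr0.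
Qed.

Lemma binp_coef0 n : (binp n)`_0 = (n == 0%N)%:R.
Proof. by rewrite -horner_coef0 -[0]/(0%:R) binpE bin0n. Qed.

(** As the coefficient of [t] in [(1 + x)^t], this is the coefficient of [x^n] in
    [log (1 + x)]. *)
Definition ell n : k := (binp n)`_1.

Lemma ell0 : ell 0 = 0. Proof. by rewrite /ell coef1. Qed.
Lemma ellS n : n.+1%:R * ell n.+1 = (n == 0%N)%:R - n%:R * ell n.
Proof.
rewrite /ell /= coefZ mulrA divff ?natr_neq0 // mul1r mulrBr coefB coefMX coefMC /=.
by rewrite binp_coef0 [ell n * _]mulrC mulrC.
Qed.

Lemma poly_nat_eq0 (p : {poly k}) : (forall t : nat, p.[t%:R] = 0) -> p = 0.
Proof.
move=> h; apply/eqP; apply: contraT => p0.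
have := @max_poly_roots _ p [seq i%:R | i <- iota 0 (size p)] p0.
rewrite size_map size_iota ltnn => -> //.
  by apply/allP => _ /mapP[i _ ->]; rewrite /root h.
rewrite map_inj_in_uniq ?iota_uniq // => i j _ _.
wlog le_ij : i j / (i <= j)%N.
  move=> H e; case: (leqP i j) => [|/ltnW] h'; first exact: H.
  by apply/esym/H.
move=> e; have /eqP : (j - i)%:R = 0 :> k by rewrite natrB // e subrr.
have /pcharf0P -> := char0; rewrite subn_eq0 => h'; apply/eqP.
by rewrite eqn_leq le_ij.
Qed.

(** The hypothesis is a polynomial identity in [t], valid at all natural numbers;
    the conclusion compares the coefficients of [t]. *)
Lemma bin_coef1 K (a : nat -> k) (b : nat -> nat -> k) :
  (forall t, \sum_(n < K.+1) 'C(t, n)%:R * a n =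
     \sum_(n < K.+1) \sum_(n' < K.+1) 'C(t, n)%:R * 'C(t, n')%:R * b n n') ->
  \sum_(n < K.+1) ell n * a n =
    \sum_(n < K.+1) ell n * b n 0%N + \sum_(n < K.+1) ell n * b 0%N n.
Proof.
move=> h.
pose p := \sum_(n < K.+1) a n *: binp n -
  \sum_(n < K.+1) \sum_(n' < K.+1) b n n' *: (binp n * binp n').
have : p = 0.
  apply: poly_nat_eq0 => t; rewrite /p hornerD hornerN !horner_sum.
  under eq_bigr => n _ do rewrite hornerZ binpE mulrC.
  under [X in _ - X]eq_bigr => n _.
    rewrite horner_sum; under eq_bigr => n' _ do rewrite hornerZ hornerM !binpE mulrC.
    over.
  by rewrite h subrr.
move/(congr1 (fun q : {poly k} => q`_1)); rewrite /p coefB !coef_sum coef0 => /eqP.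
rewrite subr_eq0 => /eqP e.
transitivity (\sum_(n < K.+1) (a n *: binp n)`_1).
  by apply: eq_bigr => n _; rewrite coefZ mulrC.
rewrite e.
transitivity (\sum_(n < K.+1) \sum_(n' < K.+1)
    (ell n * (n' == 0%N :> nat)%:R + (n == 0%N :> nat)%:R * ell n') * b n n').
  apply: eq_bigr => n _; rewrite coef_sum; apply: eq_bigr => n' _.
  rewrite coefZ mulrC coefM big_ord_recl big_ord1 /= !binp_coef0; congr (_ * _).
  by rewrite addrC.
under eq_bigr => n _ do under eq_bigr => n' _ do rewrite mulrDl.
under eq_bigr => n _ do rewrite big_split /=.
rewrite big_split /=; congr (_ + _).
  apply: eq_bigr => n _; rewrite big_ord_recl /= mulr1 big1 ?addr0 // => i _.
  by rewrite mulr0 mul0r.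
rewrite big_ord_recl /= [X in _ + X]big1 ?addr0; last first.
  by move=> i _; rewrite big1 // => j _; rewrite !mul0r.
by apply: eq_bigr => n _; rewrite mul1r.
Qed.

(** This is [exp (log (1 + x)) = 1 + x].  If [L] is the truncated logarithm and [E]
    its truncated exponential, [(1 + x) L' = 1] gives [(1 + x) E' = E] in low
    degrees, and a recurrence determines the coefficients of [E]. *)
Lemma exp_log_poly K j : (j < K)%N ->
  (\sum_(n < K) n`!%:R^-1 *: (\sum_(l < K) ell l *: 'X^l) ^+ n)`_j =
  ((j == 0%N) || (j == 1%N))%:R.
Proof.
case: K => // K jK; pose L : {poly k} := \sum_(l < K.+1) ell l *: 'X^l.
pose E : {poly k} := \sum_(n < K.+1) n`!%:R^-1 *: L ^+ n; rewrite -/L -/E.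
have L1 : exists L1, L = L1 * 'X.
  exists (\sum_(l < K) ell l.+1 *: 'X^l); rewrite mulr_suml /L big_ord_recl ell0 scale0r add0r.
  by apply: eq_bigr => l _; rewrite -scalerAl -exprSr lift0.
case: L1 => L1 LE.
have coefL i : L`_i = if (i < K.+1)%N then ell i else 0.
  rewrite /L -(poly_def K.+1 ell) coef_poly; by [].
(* (1 + X) L' = 1 up to order K *)
have LD i : (i < K)%N -> ((1 + 'X) * L^`())`_i = (i == 0%N)%:R.
  move=> iK; rewrite mulrDl mul1r coefD coefXM !coef_deriv coefL ltnS iK.
  rewrite -[ell i.+1 *+ _]mulr_natl ellS; case: i iK => [|i] iK /=; first by rewrite mul0r subr0 addr0.
  by rewrite coefL ltnW // -[ell i.+1 *+ _]mulr_natl subrK.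
have ED : E^`() = (\sum_(n < K) n`!%:R^-1 *: L ^+ n) * L^`().
  rewrite /E big_ord_recl derivD derivZ expr0 derivC scaler0 add0r.
  rewrite (big_morph _ (@derivD _) (@deriv0 _)) mulr_suml; apply: eq_bigr => n _.
  rewrite lift0 derivZ deriv_exp -scaler_nat scalerA factS natrM invfM mulrAC.
  by rewrite mulVf ?natr_neq0 // mul1r -scalerAl mulrC.
have lowcoef (p q r : {poly k}) n i : (i < n)%N -> p = q + r * 'X^n -> p`_i = q`_i.
  by move=> hi ->; rewrite coefD coefMXn hi addr0.
have E1 i : (i < K)%N -> ((1 + 'X) * E^`())`_i = E`_i.
  move=> iK; rewrite ED mulrCA.
  have [q qE] : exists q, (1 + 'X) * L^`() = 1 + q * 'X^K.
    exists (\poly_(n < size ((1 + 'X) * L^`())) ((1 + 'X) * L^`())`_(n + K)).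
    apply/polyP => n; rewrite coefD coef1 coefMXn; case: ltnP => nK; first by rewrite LD // addr0.
    have -> : (n == 0%N)%:R = 0 :> k by case: (n) nK iK => //; case: (K).
    rewrite add0r coef_poly subnK //; case: ltnP => // hs.
    by rewrite nth_default // (leq_trans hs) // leq_subr.
  rewrite qE mulrDr mulr1; apply: (lowcoef _ _
    ((\sum_(n < K) n`!%:R^-1 *: L ^+ n) * q - K`!%:R^-1 *: L1 ^+ K) K) => //.
  rewrite /E big_ord_recr /= LE exprMn mulrBl -scalerAl mulrA addrACA.
  by rewrite subrr addr0.
have rec i : (i < K)%N -> i.+1%:R * E`_i.+1 = (1 - i%:R) * E`_i.
  move=> iK; have := E1 i iK; rewrite mulrDl mul1r coefD coefXM !coef_deriv.
  case: i iK => [|i] iK /=.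
    by rewrite addr0 mulr1n => ->; rewrite mulr0n subr0 !mul1r.
  rewrite -[E`_i.+2 *+ _]mulr_natl -[E`_i.+1 *+ _]mulr_natl => e.
  by rewrite mulrBl mul1r -[X in X - _]e addrK.
have E0 : E`_0 = 1.
  rewrite /E coef_sum big_ord_recl big1 ?addr0.
    by rewrite expr0 fact0 invr1 scale1r coef1.
  by move=> n _; rewrite coefZ lift0 exprS LE mulrAC coefMX mulr0.
elim: j jK => [_|j IH jK]; first by rewrite E0.
apply: (mulfI (natr_neq0 j)); rewrite rec ?IH ?(ltnW jK) //.
case: j IH jK => [|[|j]] IH jK /=; rewrite ?subr0 ?subrr ?mul0r ?mulr0 ?mulr1 //.
Qed.
End BinomialPoly.

Section PolyEval.
Variables (k : fieldType) (U : lmodType k) (Z : U -> U).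
Hypotheses (ZD : forall x y, Z (x + y) = Z x + Z y) (ZZ : forall a x, Z (a *: x) = a *: Z x).

(** The action of polynomials in the operator [Z]. *)
Definition peval (p : {poly k}) (x : U) : U := \sum_(j < size p) p`_j *: iter j Z x.

Let Z0 : Z 0 = 0. Proof. by have := ZZ 0 0; rewrite !scale0r. Qed.
Let iterD n x y : iter n Z (x + y) = iter n Z x + iter n Z y.
Proof. by elim: n => //= n ->. Qed.
Let iterZ n a x : iter n Z (a *: x) = a *: iter n Z x.
Proof. by elim: n => //= n ->. Qed.

Lemma peval_bound n (p : {poly k}) x : (size p <= n)%N -> peval p x = \sum_(j < n) p`_j *: iter j Z x.
Proof.
move=> h; rewrite /peval (big_ord_widen _ (fun j => p`_j *: iter j Z x) h) big_mkcond /=.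
apply: eq_bigr => j _; case: ltnP => // hj.
by rewrite nth_default // scale0r.
Qed.

Lemma pevalD p q x : peval (p + q) x = peval p x + peval q x.
Proof.
pose n := maxn (size p) (size q).
rewrite (@peval_bound n (p + q)) ?size_polyD // (@peval_bound n p) ?leq_maxl //.
rewrite (@peval_bound n q) ?leq_maxr // -big_split; apply: eq_bigr => j _ /=.
by rewrite coefD scalerDl.
Qed.
Lemma pevalZ a p x : peval (a *: p) x = a *: peval p x.
Proof.
rewrite (@peval_bound (size p) (a *: p)) ?size_scale_leq // scaler_sumr.
by apply: eq_bigr => j _; rewrite coefZ scalerA.
Qed.
Lemma peval0 x : peval 0 x = 0. Proof. by rewrite /peval size_poly0 big_ord0. Qed.
Lemma peval_sum (I : Type) (s : seq I) (F : I -> {poly k}) x :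
  peval (\sum_(i <- s) F i) x = \sum_(i <- s) peval (F i) x.
Proof. by elim/big_rec2: _ => [|i y z _ <-]; rewrite ?peval0 ?pevalD. Qed.
Lemma pevalXn n x : peval 'X^n x = iter n Z x.
Proof.
rewrite /peval size_polyXn big_ord_recr /= coefXn eqxx scale1r big1 ?add0r // => j _.
by rewrite coefXn (ltn_eqF (ltn_ord j)) scale0r.
Qed.
Lemma peval1 x : peval 1 x = x. Proof. by rewrite -(expr0 'X) pevalXn. Qed.
Lemma pevalXM p x : peval ('X * p) x = Z (peval p x).
Proof.
rewrite (@peval_bound (size p).+1); last first.
  have [->|p0] := eqVneq p 0; first by rewrite mulr0 size_poly0.
  by rewrite mulrC size_mulX.
rewrite big_ord_recl coefXM scale0r add0r (big_morph Z ZD Z0).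
by apply: eq_bigr => j _; rewrite lift0 coefXM ZZ.
Qed.
Lemma pevalM p q x : peval (p * q) x = peval p (peval q x).
Proof.
elim/poly_ind: p => [|p c IH]; first by rewrite mul0r !peval0.
rewrite mulrDl [p * 'X]mulrC -mulrA !pevalD !pevalXM IH mul_polyC pevalZ.
by rewrite -[c%:P]alg_polyC pevalZ peval1.
Qed.
Lemma peval_exp p n x : peval (p ^+ n) x = iter n (peval p) x.
Proof. by elim: n => [|n IH]; rewrite ?peval1 // exprS pevalM IH. Qed.
End PolyEval.

Section Log.
Variables (k : fieldType) (char0 : [pchar k] =i pred0) (d : int) (V : invSpace k d).
Variable R : afa k.
Notation T := (tens V (scalars k)).
Notation TR := (tens V R).

Variable chi : TR -> TR.
Hypotheses (chilc : lc chi) (chihom : forall q f, homog q f -> homog q (chi f))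
  (chiM : forall f g, chi (tprod f g) = tprod (chi f) (chi g))
  (chistar : forall f, chi (star f) = star (chi f))
  (chiomega : chi (omega V R) = omega V R)
  (chired : forall f, tred (chi f) = tred f).

Definition nilpart f := chi f - f.
Notation psi := nilpart.

Lemma nilpart_lc : lc psi. Proof. by apply: lc_sub => //; exact: lc_id. Qed.
Lemma nilpart_small : small psi.
Proof.
move=> f; apply: tensP => w; rewrite -[LHS]/(afa_eps R ((chi f - f) w)) tensBE linearB tens0E.
rewrite -[X in X - _ = _]/(tred (chi f) w) chired; exact: subrr.
Qed.
Let psil : tlinear psi. Proof. by case: nilpart_lc. Qed.
Let psic : tcont psi. Proof. by case: nilpart_lc. Qed.

Lemma nilpart_zero i n f : (nilidx i < n)%N -> feq i (iter n psi f) 0.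
Proof.
exact: lowers_zero (lowers_iter (lowers_small (nilidxP (i := i)) psil psic nilpart_small)).
Qed.

(** This is [chi^t = (1 + psi)^t]. *)
Lemma iter_binomial i K t f : (nilidx i < K)%N ->
  feq i (iter t chi f) (\sum_(n < K) 'C(t, n)%:R *: iter n psi f).
Proof.
move=> hK; case: K hK => // K hK; elim: t => [|t IH].
  rewrite big_ord_recl bin0 scale1r big1 ?addr0; first exact: feq_refl.
  by move=> n _; rewrite bin0n scale0r.
apply: (feq_trans (feq_lc chilc.1 chilc.2 IH)).
rewrite (tlin_sum chilc.1).
have chiE g : chi g = g + psi g by rewrite /nilpart addrC subrK.
rewrite (eq_bigr (fun n : 'I_K.+1 => 'C(t, n)%:R *: iter n psi f
    + 'C(t, n)%:R *: psi (iter n psi f))); last first.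
  by move=> n _; rewrite (tlinZ chilc.1) chiE scalerDr.
rewrite big_split /= big_ord_recl [X in feq i (_ + X) _]big_ord_recr /=.
rewrite [X in feq i _ X]big_ord_recl !bin0 -[X in feq i _ X]addr0 addrA.
apply: feqD; last by rewrite -[X in feq i _ X](scaler0 _ 'C(t, K)%:R); apply: feqZ; exact: (@nilpart_zero i K.+1 f hK).
rewrite -addrA; apply: feqD; first exact: feq_refl.
rewrite -big_split; apply: feq_sum => n _.
by rewrite lift0 binS natrD scalerDl; exact: feq_refl.
Qed.

Variable Y : TR -> TR.
Hypotheses (Ylc : lc Y)
  (YE : forall i K f, (nilidx i < K)%N -> feq i (Y f) (\sum_(n < K) ell k n *: iter n psi f)).

Lemma log_small : small Y.
Proof.
move=> f; apply: tensP => w; rewrite tens0E -[LHS]/(afa_eps R (Y f w)).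
have [i] := afa_inh R; have := YE f (ltnSn (nilidx i)) w; rewrite !levE => -[-> _].
rewrite big_ord_recl ell0 scale0r add0r tens_sumE linear_sum big1 // => n _.
rewrite lift0 iterS tensZE.
transitivity (ell k n.+1 *: (afa_eps R (psi (iter n psi f) w) : k^o)); first exact: linearZ.
by rewrite (smallE _ _ nilpart_small) scaler0.
Qed.

(** For every natural number [t], [chi^t] is multiplicative, and at a finite level
    it is polynomial in [t]; the coefficient of [t] in this identity is Leibniz'
    rule. *)
Lemma log_leibniz f g : Y (tprod f g) = tprod (Y f) g + tprod f (Y g).
Proof.
apply: feq_eq => i; pose K := nilidx i; have hK : (nilidx i < K.+1)%N by [].
apply: (feq_trans (YE (tprod f g) hK)); apply: feq_sym.
apply: (feq_trans (feqD (feq_prod (YE f hK) (feq_refl i g)) (feq_prod (feq_refl i f) (YE g hK)))).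
move=> w; apply: vectP => c; rewrite -/(ucoord c (lev i _)).
pose cc (h : TR) : k := ucoord c (lev i (h w)).
have ccD h1 h2 : cc (h1 + h2) = cc h1 + cc h2 by rewrite /cc tensDE levD linearD.
have ccZ (a : k) h : cc (a *: h) = a * cc h.
  by rewrite /cc tensZE levZ linearZ.
have cc0 : cc 0 = 0 by rewrite /cc tens0E lev0 linear0.
have ccS (n : nat) (F : 'I_n -> TR) : cc (\sum_(j < n) F j) = \sum_(j < n) cc (F j).
  by rewrite (big_morph cc ccD cc0).
have prodS (F G : 'I_K.+1 -> TR) : tprod (\sum_(j < K.+1) F j) (\sum_(j < K.+1) G j) =
    \sum_(j < K.+1) \sum_(l < K.+1) tprod (F j) (G l).
  rewrite (tlin_sum (tlinear_prodl _)); apply: eq_bigr => j _.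
  by rewrite (tlin_sum (tlinear_prodr _)).
have prodSl (F : 'I_K.+1 -> TR) h : tprod (\sum_(j < K.+1) F j) h = \sum_(j < K.+1) tprod (F j) h.
  by rewrite (tlin_sum (tlinear_prodl _)).
have prodSr (F : 'I_K.+1 -> TR) h : tprod h (\sum_(j < K.+1) F j) = \sum_(j < K.+1) tprod h (F j).
  by rewrite (tlin_sum (tlinear_prodr _)).
have ccM h1 h2 : feq i h1 h2 -> cc h1 = cc h2 by move=> h; rewrite /cc h.
(* both sides are a coordinate of [chi^t] applied to the product *)
have key t : \sum_(n < K.+1) 'C(t, n)%:R * cc (iter n psi (tprod f g)) =
   \sum_(n < K.+1) \sum_(n' < K.+1) 'C(t, n)%:R * 'C(t, n')%:R *
      cc (tprod (iter n psi f) (iter n' psi g)).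
  transitivity (cc (iter t chi (tprod f g))).
    rewrite (ccM _ _ (iter_binomial t (tprod f g) hK)) ccS.
    by apply: eq_bigr => n _; rewrite ccZ.
  have -> : iter t chi (tprod f g) = tprod (iter t chi f) (iter t chi g).
    by elim: t => //= t ->; rewrite chiM.
  rewrite (ccM _ _ (feq_prod (iter_binomial t f hK) (iter_binomial t g hK))).
  rewrite prodS ccS; apply: eq_bigr => n _; rewrite ccS; apply: eq_bigr => n' _.
  by rewrite tprodZl tprodZr !ccZ mulrA.
have e := bin_coef1 char0 (a := fun n => cc (iter n psi (tprod f g)))
  (b := fun n n' => cc (tprod (iter n psi f) (iter n' psi g))) key.
rewrite -[LHS]/(cc _) -[RHS]/(cc _) ccD prodSl prodSr !ccS.
transitivity (\sum_(n < K.+1) ell k n * cc (tprod (iter n psi f) g)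
   + \sum_(n < K.+1) ell k n * cc (tprod f (iter n psi g))).
  by congr (_ + _); apply: eq_bigr => n _; rewrite ?tprodZl ?tprodZr ccZ.
by rewrite -e; apply: eq_bigr => n _; rewrite ccZ.
Qed.

Lemma log_homog q f : homog q f -> homog q (Y f).
Proof.
move=> hf; apply/homogP => w hw; apply: lev_inj => i; rewrite lev0 (YE f (ltnSn (nilidx i))).
have /homogP -> // : homog q (\sum_(n < (nilidx i).+1) ell k n *: iter n psi f); last first.
  by rewrite lev0.
apply: homog_sum => n _; apply: homogZ; elim: (nat_of_ord n) => //= n' IH.
by apply: homogB => //; exact: chihom.
Qed.

Lemma log_star f : Y (star f) = star (Y f).
Proof.
apply: feq_eq => i; apply: (feq_trans (YE (star f) (ltnSn (nilidx i)))).
apply: (@feq_trans _ _ _ _ _ _ (star (\sum_(n < (nilidx i).+1) ell k n *: iter n psi f))); last first.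
  by move=> w; rewrite !starE !levZ; congr (_ *: _); apply/esym/YE.
rewrite (tlin_sum (@tlinear_star k d V R)); apply: feq_sum => n _.
rewrite (tlinZ (@tlinear_star k d V R)); apply: feqZ.
suff -> : iter n psi (star f) = star (iter n psi f) by exact: feq_refl.
elim: (nat_of_ord n) => //= n' ->; rewrite /nilpart chistar.
by rewrite -(tlinB (@tlinear_star k d V R)).
Qed.

Lemma log_omega : Y (omega V R) = 0.
Proof.
apply: feq_eq => i; apply: (feq_trans (YE _ (ltnSn (nilidx i)))).
rewrite big1; first exact: feq_refl.
move=> [[|n] hn] _ /=; first by rewrite ell0 scale0r.
rewrite -iterS iterSr /nilpart chiomega subrr -/psi.
have -> : iter n psi 0 = 0 by elim: (n) => //= n' ->; exact: tlin0 psil.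
by rewrite scaler0.
Qed.

Lemma log_Der : Der_cycl 0 Y.
Proof.
have der : is_derivation 0 Y.
  have [Yl Yc] := Ylc; split=> // q f; first by rewrite addr0; exact: log_homog.
  by move=> g _; rewrite mul0r scale1r log_leibniz.
split=> //; last exact: log_star.
apply/lam_cyclic => o; apply/(cyclic_omega (derivation_lam o der)).
apply: tensP => w; rewrite lam_opE const_omega log_omega !tens0E; exact: lam0.
Qed.

(** The truncated series are polynomials in the nilpotent operator [psi], so that
    the formal identity [exp_log_poly] applies. *)
Lemma log_exp : is_exp Y chi.
Proof.
split=> // i K f hK; have [Yl Yc] := Ylc.
have psiD x y : psi (x + y) = psi x + psi y by exact: tlinD.
have psiZ a x : psi (a *: x) = a *: psi x by exact: tlinZ.
pose L : {poly k} := \sum_(l < K) ell k l *: 'X^l.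
have LE g : peval psi L g = \sum_(n < K) ell k n *: iter n psi g.
  rewrite peval_sum; apply: eq_bigr => n _.
  by rewrite pevalZ pevalXn.
have iterE n : feq i (iter n Y f) (peval psi (L ^+ n) f).
  rewrite peval_exp //; elim: n => [|n IH]; first exact: feq_refl.
  rewrite !iterS LE; apply: (feq_trans _ (YE _ hK)).
  exact: feq_lc.
pose E : {poly k} := \sum_(n < K) n`!%:R^-1 *: L ^+ n.
apply: feq_sym; apply: (@feq_trans _ _ _ _ _ _ (peval psi E f)).
  rewrite peval_sum; apply: feq_sum => n _; rewrite pevalZ; apply: feqZ; exact: iterE.
have trunc (p : {poly k}) : feq i (peval psi p f) (\sum_(j < K) p`_j *: iter j psi f).
  rewrite (@peval_bound _ _ psi (K + size p)) ?leq_addl // big_split_ord /=.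
  rewrite -[X in feq i _ X]addr0; apply: feqD; first exact: feq_refl.
  apply: (@feq_trans _ _ _ _ _ _ (\sum_(j < size p) 0)); last by rewrite big1 //; exact: feq_refl.
  apply: feq_sum => j _; rewrite -[X in feq i _ X](scaler0 _ p`_(K + j)); apply: feqZ.
  by apply: nilpart_zero; rewrite (leq_trans hK) // leq_addr.
apply: (feq_trans (trunc E)).
have -> : chi f = peval psi (1 + 'X) f.
  rewrite pevalD peval1 -['X]expr1 pevalXn /=.
  by rewrite /nilpart addrC subrK.
apply: feq_sym; apply: (feq_trans (trunc _)); apply: feq_sym.
apply: feq_sum => j _; rewrite exp_log_poly //.
rewrite coefD coef1 coefX; case: (nat_of_ord j) => [|[|j']] /=; rewrite ?addr0 ?add0r //; exact: feq_refl.
Qed.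
End Log.

Lemma log_exists (k : fieldType) (char0 : [pchar k] =i pred0) (d : int) (V : invSpace k d)
    (R : afa k) (m1 m2 chi : tens V R -> tens V R) :
  is_morphism m1 m2 chi -> (forall f, tred (chi f) = tred f) ->
  exists Y : tens V R -> tens V R, [/\ Der_cycl 0 Y, small Y & is_exp Y chi].
Proof.
move=> [[cl cc] ch cM _ [cs co]] cr; have clc : lc chi by [].
have [pl pc] := nilpart_lc clc.
have Zlc n : lc (fun f => ell k n *: iter n (nilpart chi) f).
  by apply: lc_scale; apply: (lc_iter n (nilpart_lc clc)).
have [|||Y [Yl Yc YE]] := @series_exists k d V R (fun n f => ell k n *: iter n (nilpart chi) f).
- by move=> n; case: (Zlc n).
- by move=> n; case: (Zlc n).
- move=> n i.
  have h := lowers_iter (n := n) (lowers_small (nilidxP (i := i)) pl pc (nilpart_small cr)).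
  have l0 : lowers i (nilidx i) n (fun _ : tens V R => 0).
    by move=> n' f _ _ w; rewrite tens0E !linear0; split=> // s _; rewrite foldl0.
  have := lowers_comb (ell k n) h l0; congr lowers; apply: funext => f.
  by rewrite addr0.
have Ylc : lc Y by [].
exists Y; split.
- exact: (log_Der char0 clc ch cM cs co cr Ylc YE).
- exact: (log_small cr YE).
- exact: (log_exp char0 clc cr Ylc YE).
Qed.

(** ** The equivalence of functors *)

Section GaugeEquivalence.
Variables (k : fieldType) (char0 : [pchar k] =i pred0) (d : int) (V : invSpace k d).
Notation T := (tens V (scalars k)).
Variables (m : T -> T) (hm : cycl_Ainf m) (R : afa k).
Notation TR := (tens V R).
Notation fam_of := (@fam_of k d V R m).

Lemma def_gauge (m1 m2 : TR -> TR) : is_deformation m m1 -> is_deformation m m2 ->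
  def_equiv m1 m2 <-> gauge_equiv (fam_of m1) (fam_of m2).
Proof.
move=> [[d1 s1] r1] [[d2 s2] r2]; have lc1 := Der_lc d1; have lc2 := Der_lc d2.
split=> [[phi [phiM [psi [psiM phiK psiK]]] red]|[y [yc yhom yg]]].
  have red' f : tred (psi f) = tred f by rewrite -red psiK.
  (* morphisms intertwine in the direction opposite to the gauge action, hence [psi] *)
  have [Y [YD Ys Ye]] := log_exists char0 psiM red'.
  exists (fam_of Y); split; first exact: fam_of_compatible.
    by move=> i c; rewrite ffunE; exact: Der_lam.
  apply/(gauge_conj char0 hm (Der_lc YD) Ys Ye _ lc1 lc2 r1 r2).
    by move=> g; exists (phi g); rewrite phiK.
  by move=> f; have [_ _ _ -> _] := psiM.
have tl0 : tlinear (fun _ : T => 0 : T) by have [] := @derivation0 k d V (scalars k) 0.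
have tc0 : tcont (fun _ : T => 0 : T) by have [] := @derivation0 k d V (scalars k) 0.
have [|Y [Yl Yc Ys YE]] := op_exists tl0 tc0 yc.
  move=> i a; have yD : Der_cycl 0 (y i a) by exact: yhom.
  by split; [exact: Der_tlinear yD | exact: Der_tcont yD].
have YD : Der_cycl 0 Y.
  apply: lam_Der => // -[[i a]|].
    have -> : lam_op (Some (existT _ i a)) Y = y i a by rewrite -YE ffunE.
    exact: yhom.
  have -> : lam_op None Y = fun=> 0; last exact: Der0.
  apply: funext => f; rewrite -[LHS]/(tred (Y (const R f))); exact: Ys.
have Ylc : lc Y by [].
have [e eP] := exp_exists Ylc Ys.
have [e' e'P] := exp_exists (lc_neg Ylc) (small_neg Ys).
have eK f : e' (e f) = f by exact: (exp_neg char0 Ylc Ys eP e'P).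
have e'K f : e (e' f) = f.
  exact: (exp_neg char0 (lc_neg Ylc) (small_neg Ys) e'P (is_exp_opp eP)).
have conj f : e (m1 f) = m2 (e f).
  apply: (gauge_conj char0 hm Ylc Ys eP _ lc1 lc2 r1 r2).2 => [g|]; first by exists (e' g).
  by rewrite YE.
exists e'; last by move=> f; exact: (exp_tred (small_neg Ys) e'P).
split.
  apply: (exp_morphism char0 (Der_neg YD) (small_neg Ys) e'P) => f.
  by rewrite -{2}(e'K f) -conj eK.
exists e; split=> //.
by apply: (exp_morphism char0 YD Ys eP) => f; rewrite conj.
Qed.
End GaugeEquivalence.

(** *** Functors of classes *)
Section ClassFunctor.
Variable k : fieldType.

(** A set with an equivalence relation for each coefficient algebra and, for each
    morphism, a correspondence which is total and respects the relations, give
    rise to a functor of equivalence classes.  Both deformation functors have this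
    form. *)
Record class_data := ClassData {
  cd_amb : afa k -> Type;
  cd_X : forall R, set (cd_amb R);
  cd_E : forall R, cd_amb R -> cd_amb R -> Prop;
  cd_B : forall R S, afaHom R S -> cd_amb R -> cd_amb S -> Prop
}.

Definition cd_class (A : class_data) R (x : cd_amb A R) : set (cd_amb A R) :=
  [set y | cd_X y /\ cd_E x y].

Definition class_functor (A : class_data) : setFunctor k :=
  @SetFunctor k (fun R => set (cd_amb A R))
    (fun R => [set C | exists2 x, cd_X x & C = cd_class x])
    (fun R S phi C => [set z | exists x y, [/\ C x, cd_B phi x y, cd_X y & cd_class y z]]).

Record cd_ok (A : class_data) : Prop := CdOk {
  cd_refl : forall R (x : cd_amb A R), cd_X x -> cd_E x x;
  cd_sym : forall R (x y : cd_amb A R), cd_X x -> cd_X y -> cd_E x y -> cd_E y x;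
  cd_trans : forall R (x y z : cd_amb A R), cd_X x -> cd_X y -> cd_X z ->
    cd_E x y -> cd_E y z -> cd_E x z;
  cd_total : forall R S (phi : afaHom R S) (x : cd_amb A R), cd_X x ->
    exists2 y, cd_X y & cd_B phi x y;
  cd_compat : forall R S (phi : afaHom R S) (x x' : cd_amb A R) y y',
    cd_X x -> cd_X x' -> cd_X y -> cd_X y' -> cd_B phi x y -> cd_B phi x' y' ->
    cd_E x x' -> cd_E y y';
  cd_id : forall R (x : cd_amb A R), cd_X x -> cd_B (afaHom_id R) x x;
  cd_comp : forall R S Q (psi : afaHom S Q) (phi : afaHom R S) (x : cd_amb A R) y z,
    cd_X x -> cd_X y -> cd_X z -> cd_B phi x y -> cd_B psi y z ->
    cd_B (afaHom_comp psi phi) x z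
}.

Lemma cd_class_eq (A : class_data) R (x y : cd_amb A R) : cd_ok A -> cd_X x -> cd_X y ->
  cd_E x y -> cd_class x = cd_class y.
Proof.
move=> ok Xx Xy xy; apply/seteqP; split=> z [Xz h]; split=> //.
  by apply: (cd_trans ok Xy Xx Xz) => //; exact: (cd_sym ok).
exact: (cd_trans ok Xx Xy Xz).
Qed.

Lemma class_functor_map (A : class_data) R S (phi : afaHom R S) (x : cd_amb A R) y :
  cd_ok A -> cd_X x -> cd_X y -> cd_B phi x y ->
  @sf_map k (class_functor A) R S phi (cd_class x) = cd_class y.
Proof.
move=> ok Xx Xy xy; apply/seteqP; split=> [z [x' [y' [[Xx' xx'] b' Xy' [Xz yz]]]]|z [Xz yz]].
  split=> //; apply: (cd_trans ok Xy Xy' Xz) => //.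
  exact: (cd_compat ok Xx Xx' Xy Xy' xy b').
by exists x, y; split=> //; split=> //; exact: (cd_refl ok).
Qed.

Lemma class_functor_is_functor (A : class_data) : cd_ok A -> is_functor (class_functor A).
Proof.
move=> ok; split=> [R S phi _ [x Xx ->]|R _ [x Xx ->]|R S Q psi phi _ [x Xx ->]].
- have [y Xy xy] := cd_total ok phi Xx.
  by exists y => //; exact: class_functor_map.
- exact: (class_functor_map ok Xx Xx (cd_id ok Xx)).
have [y Xy xy] := cd_total ok phi Xx; have [z Xz yz] := cd_total ok psi Xy.
rewrite (class_functor_map ok Xx Xy xy) (class_functor_map ok Xy Xz yz).
exact: (class_functor_map ok Xx Xz (cd_comp ok Xx Xy Xz xy yz)).
Qed.

Section Transfer.
Variables (A A' : class_data) (f : forall R, cd_amb A' R -> cd_amb A R).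
Hypotheses (fX : forall R (x : cd_amb A' R), cd_X x -> cd_X (f x))
  (fsurj : forall R (x : cd_amb A R), cd_X x -> exists2 x', cd_X x' & f x' = x)
  (fE : forall R (x y : cd_amb A' R), cd_X x -> cd_X y -> cd_E x y <-> cd_E (f x) (f y))
  (fB : forall R S (phi : afaHom R S) (x : cd_amb A' R) (y : cd_amb A' S),
      cd_X x -> cd_X y -> cd_B phi (f x) (f y) <-> cd_B phi x y).

Lemma cd_ok_transfer : cd_ok A' -> cd_ok A.
Proof.
move=> ok; split.
- by move=> R x /fsurj[x' Xx <-]; apply/fE => //; exact: (cd_refl ok).
- move=> R x y /fsurj[x' Xx <-] /fsurj[y' Xy <-] /fE h; apply/fE => //.
  by apply: (cd_sym ok) => //; exact: h.
- move=> R x y z /fsurj[x' Xx <-] /fsurj[y' Xy <-] /fsurj[z' Xz <-].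
  move=> /(fE Xx Xy) h /(fE Xy Xz) h'; apply/fE => //; exact: (cd_trans ok Xx Xy Xz).
- move=> R S phi x /fsurj[x' Xx <-]; have [y Xy xy] := cd_total ok phi Xx.
  by exists (f y); [exact: fX | exact/fB].
- move=> R S phi x x' y y' /fsurj[a Xa <-] /fsurj[a' Xa' <-] /fsurj[b Xb <-] /fsurj[b' Xb' <-].
  move=> /(fB phi Xa Xb) h /(fB phi Xa' Xb') h' /(fE Xa Xa') e; apply/fE => //.
  exact: (cd_compat ok Xa Xa' Xb Xb' h h').
- by move=> R x /fsurj[x' Xx <-]; apply/fB => //; exact: (cd_id ok).
move=> R S Q psi phi x y z /fsurj[x' Xx <-] /fsurj[y' Xy <-] /fsurj[z' Xz <-].
move=> /(fB phi Xx Xy) h /(fB psi Xy Xz) h'; apply/fB => //.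
exact: (cd_comp ok Xx Xy Xz).
Qed.

(** After passing to classes, it suffices that [f] be onto and reflect the
    relations. *)
Lemma class_nat_equiv : cd_ok A' -> nat_equiv (class_functor A) (class_functor A').
Proof.
move=> ok'; have ok := cd_ok_transfer ok'.
pose Phi R (C : set (cd_amb A R)) : set (cd_amb A' R) := [set x | cd_X x /\ C (f x)].
have PhiE R (x : cd_amb A' R) : cd_X x -> Phi R (cd_class (f x)) = cd_class x.
  move=> Xx; apply/seteqP; split=> y [Xy h]; split=> //; first by apply/fE => //; case: h.
  by split; [exact: fX | exact/fE].
exists Phi; split=> [R|R S phi _ [x /fsurj[x' Xx <-] ->]].
  split.
  - by move=> _ [x /fsurj[x' Xx <-] ->]; exists x' => //; exact: PhiE.
  - move=> C C' /set_mem[x /fsurj[x' Xx <-] ->] /set_mem[y /fsurj[y' Xy <-] ->].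
    rewrite !PhiE // => e; apply: (cd_class_eq ok); try exact: fX.
    apply/fE => //; suff [] : cd_class x' y' by [].
    by rewrite e; split=> //; exact: (cd_refl ok').
  - by move=> _ [x Xx ->]; exists (cd_class (f x)); [exists (f x) => //; exact: fX | exact: PhiE].
have [y Xy xy] := cd_total ok' phi Xx.
rewrite (class_functor_map ok (fX Xx) (fX Xy)); last exact/fB.
by rewrite !PhiE // (class_functor_map ok' Xx Xy xy).
Qed.
End Transfer.
End ClassFunctor.

Section Main.
Variables (k : fieldType) (char0 : [pchar k] =i pred0) (d : int) (V : invSpace k d).
Notation T := (tens V (scalars k)).
Variables (m : T -> T) (hm : cycl_Ainf m).

Definition MC_data : class_data k :=
  @ClassData k (fam (Der_dgLie m)) (@MC_lim k (Der_dgLie m))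
    (@gauge_equiv k (Der_dgLie m)) (@push k (Der_dgLie m)).

Definition defo_data : class_data k :=
  @ClassData k (fun R => tens V R -> tens V R) (@is_deformation k d V m)
    (@def_equiv k d V) (@base_change k d V).

Lemma defo_data_ok : cd_ok defo_data.
Proof.
split=> /=.
- by move=> R x _; exact: def_equiv_refl.
- by move=> R x y _ _; exact: def_equiv_sym.
- by move=> R x y z _ _ _; exact: def_equiv_trans.
- by move=> R S phi x Xx; exact: (base_change_defo phi hm Xx).
- by move=> R S phi x x' y y'; exact: base_change_equiv.
- move=> R x Xx f; have e (g : tens V R) : tmap (afaHom_id R) g = g by exact: tensP.
  by rewrite !e.
move=> R S Q psi phi x y z _ _ _ h h' f.
have e (g : tens V R) : tmap (afaHom_comp psi phi) g = tmap psi (tmap phi g) by exact: tensP.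
by rewrite !e h' h.
Qed.

Lemma functors_equivalent :
  [/\ is_functor (Def_MC (Der_dgLie m)), is_functor (Def_V m)
    & nat_equiv (Def_MC (Der_dgLie m)) (Def_V m)].
Proof.
have ok := defo_data_ok.
pose f R : cd_amb defo_data R -> cd_amb MC_data R := @fam_of k d V R m.
have fX R (x : cd_amb defo_data R) : cd_X x -> cd_X (f R x).
  exact: (deformation_MC char0).
have fsurj R (x : cd_amb MC_data R) : cd_X x -> exists2 x', cd_X x' & f R x' = x.
  by move=> Xx; exact: (MC_deformation char0 hm Xx).
have fE R (x y : cd_amb defo_data R) : cd_X x -> cd_X y -> cd_E x y <-> cd_E (f R x) (f R y).
  exact: (def_gauge char0 hm).
have fB R S (phi : afaHom R S) (x : cd_amb defo_data R) (y : cd_amb defo_data S) :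
    cd_X x -> cd_X y -> cd_B phi (f R x) (f S y) <-> cd_B phi x y.
  by move=> Xx Xy; exact: (push_base_change phi Xx Xy).
split.
- exact: (class_functor_is_functor (cd_ok_transfer fX fsurj fE fB ok)).
- exact: (class_functor_is_functor ok).
- exact: (class_nat_equiv fX fsurj fE fB ok).
Qed.
End Main.

(** * The dihedral complex *)

(** ** Rotations of words *)
Section Rotations.
Variables (k : fieldType) (d : int) (V : invSpace k d).
Notation word := (seq (helt V)).
Notation fn := (word -> scalars k).
Notation rf := (@rot_fun k d V (scalars k)).
Notation T := (tens V (scalars k)).
Implicit Types (F G : fn) (w u v : word).

Lemma rf_cons F x u : rf F (x :: u) = ksgn (wdeg1 x * wdeg u) *: F (rcons u x).
Proof. by []. Qed.

(** The functions are arbitrary, since the rotations are iterated on insertions,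
    which need not be multilinear. *)
Lemma rot_iter F u v : iter (size u) rf F (u ++ v) = ksgn (wdeg u * wdeg v) *: F (v ++ u).
Proof.
elim: u v => [|x u IH] v; first by rewrite wdeg_nil mul0r scale1r cats0.
rewrite iterS cat_cons rf_cons -cats1 -catA IH scalerA -ksgnD -catA /=.
congr (_ *: _); rewrite !wdeg_cat ?wdeg_cons ?wdeg_nil; signs.
Qed.

Lemma rot_iter_take F i w : (i <= size w)%N ->
  iter i rf F w = ksgn (wdeg (take i w) * wdeg (drop i w)) *: F (drop i w ++ take i w).
Proof. by move=> h; rewrite -{1}(cat_take_drop i w) -{1}(size_takel h) rot_iter. Qed.

Lemma iter_size F w : iter (size w) rf F w = F w.
Proof. by rewrite -{2}[w]cats0 rot_iter wdeg_nil mulr0 scale1r. Qed.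

Lemma rot_local n F G : (forall w, size w = n -> F w = G w) ->
  forall i w, size w = n -> iter i rf F w = iter i rf G w.
Proof.
move=> h; elim=> [|i IH] w hw; first exact: h.
case: w hw => [|x u] hw; rewrite !iterS; first by rewrite /= IH.
by rewrite !rf_cons IH // size_rcons.
Qed.

Lemma iter_rotD i F G w : iter i rf (fun u => F u + G u) w = iter i rf F w + iter i rf G w.
Proof.
elim: i w => [|i IH] [|x u] //; rewrite !iterS; first by rewrite /= IH.
by rewrite !rf_cons IH scalerDr.
Qed.
Lemma iter_rotZ i (a : k) F w : iter i rf (fun u => a *: F u) w = a *: iter i rf F w.
Proof.
elim: i w => [|i IH] [|x u] //; rewrite !iterS; first by rewrite /= IH.
by rewrite !rf_cons IH !scalerA mulrC.
Qed.
Lemma iter_rot0 i w : iter i rf (fun=> 0) w = 0.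
Proof. by have := iter_rotZ i 0 (fun=> 0) w; under eq_fun do rewrite scale0r; move=> ->; rewrite scale0r. Qed.
Lemma iter_rot_sum i (I : Type) (s : seq I) (F : I -> fn) w :
  iter i rf (fun u => \sum_(j <- s) F j u) w = \sum_(j <- s) iter i rf (F j) w.
Proof.
elim: s => [|j s IH]; first by under eq_fun do rewrite big_nil; rewrite iter_rot0 big_nil.
by under eq_fun do rewrite big_cons; rewrite iter_rotD IH big_cons.
Qed.

(** The action of the norm element of the cyclic group. *)
Definition cnorm F : fn := fun w => \sum_(i < size w) iter i rf F w.

Lemma cnorm_local n F G : (forall w, size w = n -> F w = G w) ->
  forall w, size w = n -> cnorm F w = cnorm G w.
Proof. by move=> h w hw; apply: eq_bigr => i _; exact: rot_local h _ _ hw. Qed.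
Lemma cnormD F G w : cnorm (fun u => F u + G u) w = cnorm F w + cnorm G w.
Proof. by rewrite /cnorm -big_split; apply: eq_bigr => i _; exact: iter_rotD. Qed.
Lemma cnormZ (a : k) F w : cnorm (fun u => a *: F u) w = a *: cnorm F w.
Proof. by rewrite /cnorm scaler_sumr; apply: eq_bigr => i _; exact: iter_rotZ. Qed.
Lemma cnorm_sum (I : Type) (s : seq I) (F : I -> fn) w :
  cnorm (fun u => \sum_(j <- s) F j u) w = \sum_(j <- s) cnorm (F j) w.
Proof. by rewrite /cnorm exchange_big; apply: eq_bigr => i _; exact: iter_rot_sum. Qed.

Lemma cnorm_rot1 F w : cnorm (rf F) w = cnorm F w.
Proof.
case: w => [|x u]; first by rewrite /cnorm !big_ord0.
rewrite /cnorm [in LHS]big_ord_recr [in RHS]big_ord_recl [LHS]addrC; congr (_ + _).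
  by rewrite -iterSr; exact: (iter_size F (x :: u)).
by apply: eq_bigr => i _; rewrite -iterSr.
Qed.
Lemma cnorm_rot i F w : cnorm (iter i rf F) w = cnorm F w.
Proof. by elim: i => // i IH; rewrite iterS cnorm_rot1. Qed.

Lemma rot_cnorm F w : rf (cnorm F) w = cnorm F w.
Proof.
case: w => [|x u]; first by rewrite /= /cnorm big_ord0.
rewrite -[RHS]cnorm_rot1 rf_cons /cnorm size_rcons scaler_sumr; apply: eq_bigr => i _.
by rewrite -[_ *: _]/(iter i.+1 rf F (x :: u)) iterSr.
Qed.

Lemma iter_inv F i w : (forall u, rf F u = F u) -> iter i rf F w = F w.
Proof. by move=> h; elim: i => // i; rewrite iterSr (funext h). Qed.

Lemma cnorm_inv F w : (forall u, rf F u = F u) -> cnorm F w = (size w)%:R *: F w.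
Proof.
move=> h; rewrite /cnorm (eq_bigr (fun=> F w)) => [|i _]; last exact: iter_inv.
by rewrite sumr_const card_ord scaler_nat.
Qed.
End Rotations.

Section Dihedral.
Variables (k : fieldType) (d : int) (V : invSpace k d).
Notation word := (seq (helt V)).
Notation fn := (word -> scalars k).
Notation rf := (@rot_fun k d V (scalars k)).
Notation sf := (@star_fun k d V (scalars k)).
Notation T := (tens V (scalars k)).
Notation ws w := (rev (map (@helt_star k d V) w)).
Implicit Types (F G : fn) (w u v : word).

Lemma ws_cons x w : ws (x :: w) = rcons (ws w) (helt_star x).
Proof. by rewrite /= rev_cons. Qed.
Lemma ws_rcons w x : ws (rcons w x) = helt_star x :: ws w.
Proof. by rewrite map_rcons rev_rcons. Qed.
Lemma ws_cat u v : ws (u ++ v) = ws v ++ ws u.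
Proof. by rewrite map_cat rev_cat. Qed.
Lemma size_ws w : size (ws w) = size w.
Proof. by rewrite size_rev size_map. Qed.
Lemma wdeg_ws w : wdeg (ws w) = wdeg w.
Proof.
elim: w => // x w IH; rewrite ws_cons wdeg_rcons IH wdeg_cons addrC.
by congr (_ + _).
Qed.
Lemma wpairs_ws w : wpairs (ws w) = wpairs w.
Proof.
elim: w => // x w IH; rewrite ws_cons wpairs_rcons IH wdeg_ws /=.
by rewrite [RHS]addrC; congr (_ + _); rewrite mulrC.
Qed.
Lemma helt_starK : involutive (@helt_star k d V).
Proof. by case=> i x; rewrite /helt_star /= is_starK. Qed.
Lemma wsK w : ws (ws w) = w.
Proof. by rewrite map_rev revK -map_comp -[RHS]map_id; apply: eq_map => x; exact: helt_starK. Qed.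

Lemma sfE F w : sf F w = ksgn ((size w)%:Z + wpairs w) *: F (ws w).
Proof. by []. Qed.

Lemma sfK F w : sf (sf F) w = F w.
Proof. by rewrite !sfE size_ws wpairs_ws wsK scalerA ksgnK scale1r. Qed.

Lemma sf_local n F G : (forall w, size w = n -> F w = G w) ->
  forall w, size w = n -> sf F w = sf G w.
Proof. by move=> h w hw; rewrite !sfE h // size_ws. Qed.
Lemma sfD F G w : sf (fun u => F u + G u) w = sf F w + sf G w.
Proof. by rewrite !sfE scalerDr. Qed.
Lemma sfZ (a : k) F w : sf (fun u => a *: F u) w = a *: sf F w.
Proof. by rewrite !sfE !scalerA mulrC. Qed.

(** The relation [r s r = s] of the dihedral group. *)
Lemma rf_sf_rf F w : rf (sf (rf F)) w = sf F w.
Proof.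
case: w => [|x u]; first by [].
rewrite rf_cons !sfE ws_rcons ws_cons rf_cons wdeg_ws size_rcons wpairs_rcons !scalerA.
rewrite -!ksgnD; congr (_ *: _); rewrite /=.
by apply: ksgn_par; rewrite -[wdeg1 (helt_star x)]/(wdeg1 x); par_cases.
Qed.

Lemma rot_sf_rot i F w : iter i rf (sf (iter i rf F)) w = sf F w.
Proof.
elim: i F w => // i IH F w; rewrite iterSr [iter i.+1 rf F]iterS.
rewrite (_ : rf (sf (rf (iter i rf F))) = sf (iter i rf F)) //.
by apply: funext => u; exact: rf_sf_rf.
Qed.

Lemma cnorm_sf_rot i F w : cnorm (sf (iter i rf F)) w = cnorm (sf F) w.
Proof. by rewrite -(cnorm_rot i) (funext (rot_sf_rot i F)). Qed.

(** Reversal permutes the rotations. *)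
Lemma sf_cnorm F w : sf (cnorm F) w = cnorm (sf F) w.
Proof.
pose n := size w.
have -> : sf (cnorm F) w = \sum_(i < n) sf (iter i rf F) w.
  by rewrite sfE /cnorm size_ws scaler_sumr.
transitivity (cnorm (rf (sf F)) w); last exact: cnorm_rot1.
rewrite /cnorm -/n [RHS](reindex_inj rev_ord_inj); apply: eq_bigr => i _.
rewrite -iterSr -[LHS]iter_size -/n.
have -> : (rev_ord i).+1 = (n - i)%N by rewrite /= subnSK.
by rewrite -{1}(subnK (ltnW (ltn_ord i))) iterD (funext (rot_sf_rot i F)).
Qed.

(** The action of the norm element of the dihedral group. *)
Definition dnorm F : fn := fun w => cnorm F w + cnorm (sf F) w.

Lemma dnorm_add F G w : dnorm (fun u => F u + G u) w = dnorm F w + dnorm G w.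
Proof. by rewrite /dnorm (funext (sfD F G)) !cnormD addrACA. Qed.
Lemma dnorm_scale (a : k) F w : dnorm (fun u => a *: F u) w = a *: dnorm F w.
Proof. by rewrite /dnorm (funext (sfZ a F)) !cnormZ scalerDr. Qed.
Lemma dnorm_local n F G : (forall w, size w = n -> F w = G w) ->
  forall w, size w = n -> dnorm F w = dnorm G w.
Proof. by move=> h w hw; congr (_ + _); apply: cnorm_local hw => // u; exact: sf_local. Qed.
Lemma dnorm_sf F w : dnorm (sf F) w = dnorm F w.
Proof. by rewrite /dnorm (funext (sfK F)) addrC. Qed.
Lemma dnorm_rot i F w : dnorm (iter i rf F) w = dnorm F w.
Proof. by rewrite /dnorm cnorm_rot cnorm_sf_rot. Qed.
Lemma dnorm0 w : dnorm (fun=> 0) w = 0.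
Proof. by have := dnorm_scale 0 (fun=> 0) w; rewrite !scale0r. Qed.

Lemma iter_rot_fun i (f : T) : tens_fun (iter i (@Defs.rot _ _ _ _) f) = iter i rf f.
Proof. by elim: i => //= i <-. Qed.

Lemma dihedral_fun i e (f : T) w :
  dihedral i e f w = iter i rf (if e then sf f else f) w.
Proof. by rewrite /dihedral iter_rot_fun; case: e. Qed.

Hypothesis char0 : [pchar k] =i pred0.

(** Generators [gamma h - h] have norm zero.  Conversely [f] differs from the
    average of its images by such elements, with [h] a multiple of [f]. *)
Lemma dihedral_dnorm (f : T) : (f \in @dihedral_pred k d V) <-> forall w, dnorm f w = 0.
Proof.
split=> [/asboolP hf w|h].
  have [s hs] := hf (size w); rewrite (dnorm_local hs erefl) => {hs}.
  elim: s => [|[[i e] g] s IH].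
    by rewrite -[RHS](dnorm0 w); apply: dnorm_local erefl => u _; rewrite big_nil.
  have eg : dnorm (dihedral i e g) w = dnorm g w.
    rewrite (funext (dihedral_fun i e g)) dnorm_rot; case: e => //.
    exact: dnorm_sf.
  transitivity (dnorm (fun u => (dihedral i e g u + (-1) *: g u) +
      \sum_(t <- s) (dihedral t.1.1 t.1.2 t.2 - t.2) u) w).
    apply: dnorm_local erefl => u _; rewrite big_cons scaleN1r.
    by congr (_ + _); exact: tensBE.
  by rewrite dnorm_add IH dnorm_add dnorm_scale eg scaleN1r subrr addr0.
apply/asboolP => n; case: n => [|n].
  by exists [::] => w /size0nil ->; rewrite tens_nil big_nil.
(* the order of the group acting on words of length [n.+1] is [n.+1.*2] *)
pose c : k := - (n.+1.*2%:R)^-1.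
have c0 : n.+1.*2%:R * c = -1.
  by rewrite /c mulrN mulfV // doubleS (natr_neq0 char0).
exists [seq (nat_of_ord i, e, c *: f) | i <- enum 'I_n.+1, e <- [:: false; true]] => w sw.
pose D i e := dihedral i e (c *: f) w - c *: f w.
rewrite big_allpairs_dep big_enum.
transitivity (\sum_(i < n.+1) (D i false + D i true)); last first.
  apply: eq_bigr => i _; rewrite big_cons big_seq1.
  by congr (_ + _); rewrite /D -tensZE; exact/esym/tensBE.
rewrite /D big_split /= !sumrB !sumr_const card_ord.
have sE e : \sum_(i < n.+1) dihedral i e (c *: f) w = c *: cnorm (if e then sf f else f) w.
  rewrite /cnorm sw scaler_sumr; apply: eq_bigr => i _.
  by rewrite dihedralZ tensZE dihedral_fun.
rewrite !sE addrACA -scalerDr -[cnorm _ w + _]/(dnorm f w) h scaler0 add0r -opprD -mulrnDr addnn.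
by rewrite -scaler_nat scalerA c0 scaleN1r opprK.
Qed.
End Dihedral.

(** ** Inserting an operation into a word *)
Section Insertion.
Variables (k : fieldType) (d : int) (V : invSpace k d).
Notation word := (seq (helt V)).
Notation fn := (word -> scalars k).
Notation rf := (@rot_fun k d V (scalars k)).
Implicit Types (F G : fn) (w u v : word).

Variables (p : int) (hat : word -> helt V).

(** The derivation whose component of each length is the operation [hat]: a
    subword [v] is replaced by the letter [hat v].  The recursion is that of
    [derivation_cons]. *)
Fixpoint dsub F w : scalars k :=
  if w is x :: w' then
    \sum_(i < (size w').+1) F (hat (x :: take i w') :: drop i w')
    + ksgn (p * wdeg1 x) *: dsub (fun u => F (x :: u)) w'
  else 0.

Lemma dsub_cons F x w : dsub F (x :: w) =
  \sum_(i < (size w).+1) F (hat (x :: take i w) :: drop i w)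
  + ksgn (p * wdeg1 x) *: dsub (fun u => F (x :: u)) w.
Proof. by []. Qed.

Lemma dsub_sum F w : dsub F w = \sum_(a < size w) \sum_(l < size w - a)
  ksgn (p * wdeg (take a w)) *:
    F (take a w ++ hat (take l.+1 (drop a w)) :: drop l.+1 (drop a w)).
Proof.
elim: w F => [|x w IH] F; first by rewrite big_ord0.
rewrite dsub_cons [RHS]big_ord_recl; congr (_ + _).
  by apply: eq_bigr => i _; rewrite take0 drop0 wdeg_nil mulr0 scale1r.
rewrite IH scaler_sumr; apply: eq_bigr => a _; rewrite scaler_sumr.
apply: eq_bigr => l _; rewrite scalerA -ksgnD -mulrDr.
by rewrite -wdeg_cons.
Qed.

Lemma dsub_ext F G w : (forall u, (0 < size u <= size w)%N -> F u = G u) ->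
  dsub F w = dsub G w.
Proof.
move=> h; rewrite !dsub_sum; apply: eq_bigr => a _; apply: eq_bigr => l _.
rewrite h // size_cat /= addnS /= size_takel; last exact/ltnW.
by rewrite !size_drop; have := ltn_ord a; have := ltn_ord l; lia.
Qed.

Hypothesis hat_deg : forall v, wdeg1 (hat v) = wdeg v - p.

(** An insertion at the front; the others are conjugate to it by rotations
    ([rot_ins]). *)
Definition ins l F : fn := fun w => F (hat (take l.+1 w) :: drop l.+1 w).

(** The word is rotated until the subword comes first, and the shorter word
    obtained by the insertion is rotated back. *)
Lemma rot_ins a l F w : (a + l < size w)%N ->
  iter a rf (ins l (iter (size w - l - a) rf F)) w = ksgn (p * wdeg (take a w)) *:
    F (take a w ++ hat (take l.+1 (drop a w)) :: drop l.+1 (drop a w)).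
Proof.
move=> h; have sz : (size w = a + size (drop a w))%N by rewrite size_drop; lia.
have sa : size (take a w) = a by rewrite size_takel; lia.
rewrite -{2}(cat_take_drop a w) -[in iter a rf _]sa rot_iter /ins.
set u := take a w; set v := drop a w.
have sv : (l < size v)%N by rewrite -/v in sz; lia.
rewrite take_cat drop_cat.
have -> : (if (l.+1 < size v)%N then take l.+1 v
           else v ++ take (l.+1 - size v) u) = take l.+1 v.
  case: ltnP => // h2; have -> : l.+1 = size v by lia.
  by rewrite subnn take0 cats0 take_size.
have -> : (if (l.+1 < size v)%N then drop l.+1 v ++ u else drop (l.+1 - size v) u)
          = drop l.+1 v ++ u.
  case: ltnP => // h2; have -> : l.+1 = size v by lia.
  by rewrite subnn drop0 drop_size.
have -> : (size w - l - size u)%N = size (hat (take l.+1 v) :: drop l.+1 v).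
  by rewrite [RHS]/= size_drop; rewrite -/u in sa; rewrite -/v in sz; lia.
rewrite -cat_cons rot_iter scalerA -ksgnD wdeg_cons hat_deg; congr (_ *: _).
by rewrite -[in wdeg v](cat_take_drop l.+1 v) wdeg_cat; signs.
Qed.

Lemma triangle_swap (U : zmodType) (M : nat) (F : nat -> nat -> U) :
  \sum_(a < M) \sum_(b < M - a) F a b = \sum_(b < M) \sum_(a < M - b) F a b.
Proof.
rewrite -(triangle_sum F M) -(triangle_sum (fun b a => F a b) M).
apply: eq_bigr => n _; rewrite (reindex_inj rev_ord_inj); apply: eq_bigr => a _ /=.
by rewrite subSS subKn // -ltnS.
Qed.

Lemma dsub_rot F w : dsub F w = \sum_(a < size w) \sum_(l < size w - a)
  iter a rf (ins l (iter (size w - l - a) rf F)) w.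
Proof.
rewrite dsub_sum; apply: eq_bigr => a _; apply: eq_bigr => l _.
by rewrite rot_ins //; have := ltn_ord l; lia.
Qed.

(** In the sum over all rotations of the word, every insertion may be moved to the
    front.  The insertions of length [l.+1] then leave all the rotations of the
    shorter word, which form its norm. *)
Lemma cnorm_dsub F w : cnorm (dsub F) w = \sum_(l < size w) cnorm (ins l (cnorm F)) w.
Proof.
pose n := size w.
transitivity (cnorm (fun u => \sum_(a < n) \sum_(l < n - a)
    iter a rf (ins l (iter (n - l - a) rf F)) u) w).
  by apply: cnorm_local erefl => u; rewrite dsub_rot => ->.
rewrite cnorm_sum; under eq_bigr do rewrite cnorm_sum.
under eq_bigr do under eq_bigr do rewrite cnorm_rot.
rewrite (triangle_swap n (fun a l => cnorm (ins l (iter (n - l - a) rf F)) w)).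
apply: eq_bigr => l _.
rewrite -(cnorm_sum _ (fun a : 'I__ => ins l (iter (n - l - a) rf F))).
apply: cnorm_local erefl => u su; rewrite /ins.
set u' := (X in _ = cnorm F X).
have su' : size u' = (n - l)%N.
  by rewrite /u' /= size_drop su -/n; have := ltn_ord l; rewrite -/n; lia.
rewrite -cnorm_rot1 /cnorm su' (reindex_inj rev_ord_inj); apply: eq_bigr => a _.
rewrite -iterSr.
by have -> : (n - l - rev_ord a)%N = a.+1 by rewrite /= subKn.
Qed.
End Insertion.

(** ** Non-degenerate forms *)
Section Nondegenerate.
Variables (k : fieldType) (d : int) (V : invSpace k d).
Notation word := (seq (helt V)).
Notation T := (tens V (scalars k)).
Implicit Types (w u v : word) (x z : helt V).
Hypothesis nondeg : nondegenerate_form V.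

(** Non-degeneracy speaks of one degree at a time: [G] is a functional on one
    [V i], extended by zero. *)
Lemma representable i (G : helt V -> k) :
  (forall j (a : k) (x y : V j), G (hel (a *: x + y)) = a * G (hel x) + G (hel y)) ->
  (forall z, G z != 0 -> tag z = i) ->
  exists2 e : helt V, tag e = - d - i & forall z, hform e z = G z.
Proof.
move=> Glin Gsupp.
pose phi : {linear V (- d - (- d - i)) -> k^o} :=
  HB.pack (fun y : V (- d - (- d - i)) => G (hel y) : k^o)
    (GRing.isLinear.Build k _ k^o _ (fun y : V (- d - (- d - i)) => G (hel y) : k^o)
       (@Glin (- d - (- d - i)))).
have [x hx] := (nondeg (- d - i)).2 phi.
exists (hel x) => // -[j y]; rewrite /hform /=.
have [e|ne] := eqVneq j (- d - (- d - i)); first by subst j; exact: hx.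
have -> : G (existT _ j y) = 0.
  apply/eqP; apply: contraNT ne => /Gsupp /= ->.
  by rewrite opprB addrCA subrr addr0.
by apply: is_form_deg; apply: contra ne => /eqP h; apply/eqP; lia.
Qed.

Lemma hform_inj (x y : helt V) : tag x = tag y ->
  (forall z, hform x z = hform y z) -> x = y.
Proof.
case: x y => i x [j y] /= e; subst j => h.
have [h0 _] := nondeg i; congr existT; apply/eqP; rewrite -subr_eq0; apply/eqP/h0 => j z.
rewrite addrC -scaleN1r is_formDl mulN1r.
by have := h (hel z); rewrite /hform /= => ->; rewrite addNr.
Qed.

(** The components of a derivation as operations on [V], recovered from the form. *)
Definition is_hat p (D : T -> T) (hat : word -> helt V) :=
  (forall v, wdeg1 (hat v) = wdeg v - p) /\
  (forall v z, hform (hat v) z = D (form_elt (scalars k) z) v).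

Section Derivation.
Variables (p : int) (D : T -> T) (Dder : is_derivation p D).

Let Dlin : tlinear D. Proof. by case: Dder. Qed.
Let Dcont : tcont D. Proof. by case: Dder. Qed.
Let Dhom q f : homog q f -> homog (q + p) (D f). Proof. by case: Dder => ? ? h _; exact: h. Qed.

Lemma hat_exists : exists hat, is_hat p D hat.
Proof.
suff h v : exists2 e : helt V, wdeg1 e = wdeg v - p &
    forall z, hform e z = D (form_elt (scalars k) z) v.
  pose hat v := projT1 (cid2 (h v)).
  by exists hat; split=> v; rewrite /hat; case: cid2.
have [|z|e te he] := @representable (wdeg v - d - 1 - p)
    (fun z => D (form_elt (scalars k) z) v).
- by move=> j a x y; rewrite form_eltP (tlinD Dlin) tensDE (tlinZ Dlin) tensZE.
- by move/(form_deg Dder) => ->; lia.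
- by exists e => //; rewrite /wdeg1 te; lia.
Qed.

Variables (hat : word -> helt V) (hatP : is_hat p D hat).

(** By continuity finitely many components of [phi] matter, and only one of them
    for degree reasons.  It is represented by a vector, so that it is a multiple
    of a [form_elt]. *)
Lemma letter_hat (phi : T) v : (forall u, size u != 1%N -> phi u = 0) ->
  D phi v = phi [:: hat v].
Proof.
move=> phi1; pose q := wdeg v - p.
(* the degrees met by the continuity of [D] at [v] *)
pose L := tsupport Dcont v; pose Q := undup (q :: map (@wdeg _ _ V) L).
have -> : D phi v = D (\sum_(r <- Q) component r phi) v.
  apply: (tsupport_eq Dlin (Dcont := Dcont)) => u uL; rewrite tens_sumE.
  rewrite (bigD1_seq (wdeg u)) ?undup_uniq //=; last first.
    by rewrite mem_undup inE map_f ?orbT.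
  by rewrite eqxx big1 ?addr0 // => r /negbTE ne; rewrite eq_sym ne.
rewrite (tlin_sum Dlin) tens_sumE (bigD1_seq q) ?undup_uniq ?mem_undup ?mem_head //=.
rewrite [X in _ + X]big1 ?addr0; last first.
  move=> r nr; apply/eqP; apply: contraNT nr.
  by move/(Dhom (@component_homog _ _ _ _ r phi)); rewrite /q => ->; rewrite addrK.
have [|z|e te he] := @representable (1 - q) (fun z => component q phi [:: z]).
- by move=> j a x y; exact: (tens_multilinear (component q phi) a x y [::] [::]).
- by move/(@component_homog _ _ _ _ q phi); rewrite wdeg_seq1 /wdeg1; lia.
have cE : component q phi = ksgn ((- d - (1 - q)) * (1 - q)) *: form_elt (scalars k) e.
  apply: tensP => u; rewrite tensZE.
  have [|u1] := eqVneq (size u) 1%N; last first.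
    rewrite componentE phi1 // if_same form_eltE.
    by case: u u1 => [|y [|y' u]]; rewrite ?scaler0.
  case: u => [|y [|//]] // _; rewrite -he form_eltE hform_sym te.
  have [->|/hform_deg] := eqVneq (hform y e) 0; first by rewrite mulr0 scale0r scaler0.
  rewrite te => ->; rewrite scalerA [RHS]mulr1.
  by congr (ksgn (_ * _) * _); lia.
transitivity (component q phi [:: hat v]); last first.
  by rewrite componentE wdeg_seq1 (proj1 hatP) eqxx.
rewrite cE (tlinZ Dlin) !tensZE -(proj2 hatP) form_eltE.
by congr (_ *: _); exact/esym/mulr1.
Qed.

(** A derivation is determined by its components. *)
Lemma derivation_dsub (f : T) w : D f w = dsub p hat f w.
Proof.
elim: w f => [|x w IH] f; first exact: tens_nil.
rewrite (derivation_cons _ _ _ Dder) dsub_cons IH; congr (_ + _ *: _).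
  by apply: eq_bigr => i _; rewrite letter_hat // => -[|y [|y' u]].
by apply: dsub_ext => -[|y u].
Qed.
End Derivation.

Lemma derivation_eq p (D E : T -> T) : is_derivation p D -> is_derivation p E ->
  (forall z, D (form_elt _ z) = E (form_elt _ z)) -> D = E.
Proof.
move=> hD hE h; have [hat hatP] := hat_exists hD.
have hatP' : is_hat p E hat by split=> [v|v z]; rewrite -?h; apply hatP.
apply: funext => f; apply: tensP => w.
by rewrite (derivation_dsub hD hatP) (derivation_dsub hE hatP').
Qed.

Hypothesis char0 : [pchar k] =i pred0.

(** By [cnorm_dsub], [cnorm (D f)] only depends on [cnorm f], and [D] commutes with
    the involution. *)
Lemma derivation_dihedral p (D : T -> T) (f : T) : Der_cycl p D ->
  f \in @dihedral_pred k d V -> D f \in @dihedral_pred k d V.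
Proof.
move=> [hD _ hs] /(dihedral_dnorm char0) hf; apply/(dihedral_dnorm char0) => w.
have [hat hatP] := hat_exists hD.
have cD (g : T) u : cnorm (D g) u = \sum_(l < size u) cnorm (ins hat l (cnorm g)) u.
  rewrite -(cnorm_dsub (proj1 hatP)); apply: cnorm_local erefl => v _.
  exact: derivation_dsub.
rewrite /dnorm -[star_fun (D f)]/(tens_fun (star (D f))) -hs !cD -big_split.
rewrite big1 // => l _ /=; rewrite -cnormD.
transitivity (cnorm (fun=> 0 : scalars k) w); last first.
  by rewrite /cnorm big1 // => i _; exact: (iter_rot0 (V := V) i w).
by apply: cnorm_local erefl => u _; rewrite /ins; exact: hf.
Qed.
End Nondegenerate.

(** ** The potential of a cyclic derivation *)
Section Potential.
Variables (k : fieldType) (d : int) (V : invSpace k d).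
Notation word := (seq (helt V)).
Notation fn := (word -> scalars k).
Notation rf := (@rot_fun k d V (scalars k)).
Notation sf := (@star_fun k d V (scalars k)).
Notation T := (tens V (scalars k)).
Notation form z := (form_elt (scalars k) z).
Notation ws w := (rev (map (@helt_star k d V) w)).
Implicit Types (w u v : word) (x y z : helt V).

(** The function [<\hat D(x_1, ..., x_n), x_(n+1)>] with the sign for which
    cyclicity is invariance under rotation ([ham_cyclic]). *)
Definition ham (D : T -> T) w : scalars k :=
  if w is x :: u then ksgn (d * wdeg1 (last x u)) *: D (form (last x u)) (belast x u)
  else 0.

Lemma ham_rcons D w z : ham D (rcons w z) = ksgn (d * wdeg1 z) *: D (form z) w.
Proof. by case: w => [|x w] //; rewrite rcons_cons /ham last_rcons belast_rcons. Qed.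

Lemma ham1 D x : ham D [:: x] = 0.
Proof. by rewrite (ham_rcons D [::] x) tens_nil scaler0. Qed.

Lemma ham_multilinear D : tlinear D -> multilinear (ham D).
Proof.
move=> Dl i a x y u v; case: (lastP v) => [|v' z].
  rewrite !cats1 !ham_rcons form_eltP (tlinD Dl) tensDE (tlinZ Dl) tensZE scalerDr.
  by congr (_ + _); rewrite !scalerA mulrC.
rewrite -!rcons_cons -!rcons_cat !ham_rcons tens_multilinear scalerDr.
by congr (_ + _); rewrite !scalerA mulrC.
Qed.

Lemma star_form z : star (form z) = - form (helt_star z).
Proof.
apply: tensP => w; rewrite tensNE starE !form_eltE.
case: w => [|x [|y w]]; rewrite ?oppr0 ?scaler0 //; last first.
  by rewrite !ws_cons; case: (ws w) => [|? [|? ?]] /=; rewrite scaler0 ?oppr0.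
rewrite ws_cons /= -scaleN1r !scalerA; congr (_ * _ *: _).
  by rewrite wdeg_nil mulr0.
by rewrite -[x in RHS]helt_starK /hform is_form_star.
Qed.

Section Derivation.
Variables (p : int) (D : T -> T) (Dder : is_derivation p D).

Let Dlin : tlinear D. Proof. by case: Dder. Qed.

Lemma ham_deg w : ham D w != 0 -> wdeg w = p + d + 2.
Proof.
case: (lastP w) => [|u z]; first by rewrite eqxx.
rewrite ham_rcons scaler_eq0 negb_or => /andP[_ /(form_deg Dder)].
by rewrite wdeg_rcons /wdeg1 => ->; lia.
Qed.

Lemma ham_cyclic : is_cyclic p D <-> forall u, rf (ham D) u = ham D u.
Proof.
rewrite is_cyclicE; split=> [h [|z u] //|h u y z].
  rewrite rf_cons; case: (lastP u) => [|v y].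
    by rewrite ham1 scaler0.
  rewrite -[z :: rcons v y]rcons_cons !ham_rcons h !scalerA -!ksgnD.
  have [->|/(form_deg Dder)] := eqVneq (D (form y) (z :: v)) 0; first by rewrite !scaler0.
  rewrite wdeg_cons => /(congr1 par) e; congr (_ *: _); apply: ksgn_par.
  move: e; rewrite wdeg_rcons /wdeg1 !parE /= ?par1.
  case: (par (tag z)); case: (par (tag y)); case: (par p); case: (par d);
    by case: (par (wdeg v)).
have := h (z :: rcons u y); rewrite rf_cons -rcons_cons !ham_rcons scalerA -ksgnD.
move=> E; apply: (ksgn_inj_scale (etrans E _)); rewrite [RHS]scalerA -ksgnD.
have [->|/(form_deg Dder)] := eqVneq (D (form y) (z :: u)) 0; first by rewrite !scaler0.
rewrite wdeg_cons => /(congr1 par) e; congr (_ *: _); apply: ksgn_par.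
move: e; rewrite wdeg_rcons /wdeg1 !parE /= ?par1.
case: (par (tag z)); case: (par (tag y)); case: (par p); case: (par d);
  by case: (par (wdeg u)).
Qed.

(** Reversal brings the last letter, which [ham] sets apart, to the front; a
    rotation puts it back. *)
Lemma ham_star : is_cyclic p D -> (forall f, D (star f) = star (D f)) ->
  forall w, sf (ham D) w = ham D w.
Proof.
move=> /ham_cyclic hc hs w; case: (lastP w) => [|u z]; first by rewrite sfE scaler0.
rewrite sfE ws_rcons -hc rf_cons !ham_rcons.
have -> : form (helt_star z) = - star (form z) by rewrite star_form opprK.
rewrite (tlinN Dlin) hs tensNE starE size_ws wpairs_ws wsK wdeg_ws.
rewrite -scaleN1r -[-1]/(ksgn 1) !scalerA -!ksgnD size_rcons wpairs_rcons.
congr (_ *: _); rewrite -addn1 PoszD.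
by apply: ksgn_par; rewrite -[wdeg1 (helt_star z)]/(wdeg1 z); par_cases.
Qed.
End Derivation.
End Potential.

Section Bracket.
Variables (k : fieldType) (d : int) (V : invSpace k d).
Notation word := (seq (helt V)).
Notation fn := (word -> scalars k).
Notation rf := (@rot_fun k d V (scalars k)).
Notation T := (tens V (scalars k)).
Notation form z := (form_elt (scalars k) z).
Implicit Types (w u v t : word) (x y z : helt V).

Hypothesis nondeg : nondegenerate_form V.
Variables (p : int) (D m : T -> T).
Hypotheses (hD : is_derivation p D) (hm : is_derivation 1 m).
Hypotheses (cD : is_cyclic p D) (cm : is_cyclic 1 m).
Variables (hatD hatm : word -> helt V).
Hypotheses (hatDP : is_hat p D hatD) (hatmP : is_hat 1 m hatm).

Local Notation H := (ham D).
Let Hinv u : rf H u = H u. Proof. exact: (ham_cyclic hD).1 cD u. Qed.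

Lemma rot_swap (F : fn) u v : (forall w, rf F w = F w) ->
  F (u ++ v) = ksgn (wdeg u * wdeg v) *: F (v ++ u).
Proof. by move=> h; rewrite -rot_iter iter_inv. Qed.

Lemma ham_hat u v : ham m (rcons u (hatD v)) =
  ksgn (d * wdeg1 (hatD v)) *: (hform (hatm u) (hatD v) : scalars k).
Proof. by rewrite ham_rcons (proj2 hatmP). Qed.

(** An operation of [D] inside an operation of [m], seen on the cyclic word, is an
    operation of [m] inside an operation of [D]: both sides pair the results of
    the two operations by the form. *)
Lemma ins_wrap u v t z : let w := u ++ v ++ rcons t z in
  iter (size (u ++ v)) rf (ins hatm (size (t ++ u)) H) w =
  - ksgn (d * wdeg1 z + p) *: (ksgn (p * wdeg u) *: m (form z) (u ++ hatD v :: t)).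
Proof.
move=> w; rewrite /w catA rot_iter.
have -> : ins hatm (size (t ++ u)) H (rcons t z ++ u ++ v) = H (hatm (rcons t z ++ u) :: v).
  rewrite /ins catA take_size_cat ?drop_size_cat // !size_cat size_rcons; lia.
set x := hatD v; set y := hatm _.
have -> : m (form z) (u ++ x :: t) = ksgn (d * wdeg1 z) *: ham m (rcons (u ++ x :: t) z).
  by rewrite ham_rcons scalerA ksgnK scale1r.
have -> : rcons (u ++ x :: t) z = rcons u x ++ rcons t z.
  by rewrite rcons_cat cat_rcons.
rewrite (rot_swap _ _ ((ham_cyclic hm).1 cm)).
rewrite -rcons_cat ham_hat -/x -/y -(cat1s y) (rot_swap _ _ Hinv) cats1 ham_rcons -(proj2 hatDP) -/x.
rewrite hform_sym !scalerA -[- ksgn _]mulN1r -[-1]/(ksgn 1) -!ksgnD.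
have [->|/hform_deg] := eqVneq (hform y x) 0; first by rewrite ?scaler0 ?mulr0.
have ex : wdeg1 x = wdeg v - p by exact: (proj1 hatDP).
have ey : wdeg1 y = wdeg (rcons t z ++ u) - 1 by exact: (proj1 hatmP).
move=> e; have {e} /(congr1 par) pd : d = wdeg1 x + wdeg1 y - 2.
  by rewrite /wdeg1 e; lia.
congr (_ *: _); apply: ksgn_par; move: pd.
rewrite wdeg_seq1 !wdeg_rcons !wdeg_cat ?wdeg_rcons.
have -> : tag y = 1 - wdeg1 y by rewrite /wdeg1 opprB addrC subrK.
have -> : tag x = 1 - wdeg1 x by rewrite /wdeg1 opprB addrC subrK.
rewrite ex ey wdeg_cat wdeg_rcons !parE /= ?par1 => ->.
case: (par p); case: (par (tag z)); case: (par (wdeg u));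
  case: (par (wdeg v)); by case: (par (wdeg t)).
Qed.

(** For insertions in a cyclic word, of length [l.+1] and at place [a], the two
    triangles are the insertions avoiding the last letter and those containing
    it; the latter are indexed by the letters that they leave out. *)
Lemma square_triangles (U : zmodType) N (X : nat -> nat -> U) :
  (forall a, X a N = 0) ->
  \sum_(l < N.+1) \sum_(a < N.+1) X a l =
    \sum_(a < N) \sum_(l < N - a) X a l
    + \sum_(i < N) \sum_(s < N - i) X (i + s.+1)%N (N - s.+1)%N.
Proof.
move=> X0; rewrite big_ord_recr /= [X in _ + X]big1 ?addr0 => [|a _]; last exact: X0.
transitivity (\sum_(l < N) (\sum_(a < N - l) X a l + \sum_(i < l.+1) X (N - l + i)%N l)).
  apply: eq_bigr => l _; have -> : N.+1 = (N - l + l.+1)%N by have := ltn_ord l; lia.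
  rewrite big_split_ord; congr (_ + _).
rewrite big_split; congr (_ + _); first exact/esym/triangle_swap.
rewrite (triangle_swap N (fun i s => X (i + s.+1)%N (N - s.+1)%N)).
rewrite (reindex_inj rev_ord_inj); apply: eq_bigr => s _ /=; rewrite subnSK //.
apply: eq_bigr => i _; rewrite subKn // ?[(i + _)%N]addnC //.
Qed.

(** The insertions avoiding the last letter [z] make up [m (D (form z))], those
    containing it make up [D (m (form z))] by [ins_wrap]. *)
Lemma ham_bracket w :
  ham (bracket 1 p m D) w = \sum_(l < size w) cnorm (ins hatm l H) w.
Proof.
case: (lastP w) => [|{}w z]; first by rewrite big_ord0.
pose N := size w; pose X a l := iter a rf (ins hatm l H) (rcons w z).
have -> : \sum_(l < size (rcons w z)) cnorm (ins hatm l H) (rcons w z) =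
    \sum_(l < N.+1) \sum_(a < N.+1) X a l.
  by rewrite /cnorm size_rcons.
rewrite square_triangles; last first.
  move=> a; rewrite -[RHS](iter_rot0 (V := V) a (rcons w z)); apply: rot_local (erefl _) => u su.
  rewrite /ins -[N.+1]/(size w).+1 drop_oversize ?take_oversize ?su ?size_rcons //.
  exact: ham1.
rewrite ham_rcons /bracket tensBE tensZE scalerBr; congr (_ + _).
  rewrite (derivation_dsub nondeg hm hatmP) dsub_sum scaler_sumr; apply: eq_bigr => a _.
  rewrite scaler_sumr; apply: eq_bigr => l _.
  have hl : (a + l < size w)%N by have := ltn_ord l; rewrite ltn_subRL.
  have -> : X a l = iter a rf (ins hatm l (iter (size (rcons w z) - l - a) rf H)) (rcons w z).
    by rewrite [iter (_ - _) rf H](_ : _ = H) //; apply: funext => u; exact: iter_inv.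
  rewrite (rot_ins (proj1 hatmP)); last by rewrite size_rcons ltnS ltnW.
  have [ha hs] : (a <= size w)%N /\ (l < size (drop a w))%N.
    by rewrite size_drop; have := ltn_ord a; lia.
  rewrite drop_rcons // -!cats1 takel_cat // takel_cat // !cats1 drop_rcons //.
  by rewrite -rcons_cons -rcons_cat ham_rcons !scalerA mulrC.
rewrite (derivation_dsub nondeg hD hatDP) dsub_sum scalerA -scaleNr scaler_sumr.
apply: eq_bigr => i _; rewrite scaler_sumr; apply: eq_bigr => s _.
set u := take i w; set v := take s.+1 (drop i w); set t := drop s.+1 (drop i w).
have ltN := ltn_ord s; have lti := ltn_ord i.
have wE : rcons w z = u ++ v ++ rcons t z.
  by rewrite -!rcons_cat /u /v /t !cat_take_drop.
have su : size u = i by rewrite size_takel // ltnW.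
have sv : size v = s.+1 by rewrite size_takel // size_drop.
have -> : (i + s.+1)%N = size (u ++ v) by rewrite size_cat su sv.
have -> : (N - s.+1)%N = size (t ++ u).
  by rewrite size_cat !size_drop su; rewrite -/N in ltN lti *; lia.
by rewrite /X wE ins_wrap ksgnD mul1r.
Qed.
End Bracket.

(** ** Cyclic derivations as coinvariants *)
Section Coinvariants.
Variables (k : fieldType) (char0 : [pchar k] =i pred0) (d : int) (V : invSpace k d).
Notation word := (seq (helt V)).
Notation fn := (word -> scalars k).
Notation rf := (@rot_fun k d V (scalars k)).
Notation sf := (@star_fun k d V (scalars k)).
Notation T := (tens V (scalars k)).
Notation form z := (form_elt (scalars k) z).
Notation lpi := (lpi (@dihedral_pred_submod k d V)).
Notation Der := (@Der_cycl k d V (scalars k)).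
Implicit Types (w u v : word) (x y z : helt V).

(** A representative of the class attached to [D]: its sum of rotations is [ham D].
    It is chosen rather than constructed so as to be defined for all maps. *)
Definition pot (D : T -> T) : T :=
  xget (0 : T) [set f : T | forall w, f w = (size w)%:R^-1 *: ham D w].

Lemma potE D w : tlinear D -> pot D w = (size w)%:R^-1 *: ham D w.
Proof.
move=> Dl; rewrite /pot; case: xgetP => [f _ -> //|/(_ (mk_tens (f := fun w => (size w)%:R^-1 *: ham D w) _ _))].
have mh : multilinear (fun w => (size w)%:R^-1 *: ham D w).
  move=> i a x y u v; rewrite ham_multilinear // scalerDr !size_cat /=.
  by congr (_ + _); rewrite !scalerA mulrC.
have h0 : (size ([::] : word))%:R^-1 *: ham D [::] = 0 by rewrite scaler0.
by move/(_ mh h0)/(_ (fun=> erefl)).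
Qed.

Lemma natr_size_neq0 w : w <> [::] -> (size w)%:R != 0 :> k.
Proof. by case: w => // x w _; exact: natr_neq0. Qed.

Lemma ham_pot D w : tlinear D -> ham D w = (size w)%:R *: pot D w.
Proof.
move=> Dl; rewrite potE // scalerA; case: w => [|x w]; first by rewrite scaler0.
by rewrite mulfV ?scale1r // natr_size_neq0.
Qed.

Section Derivation.
Variables (p : int) (D : T -> T) (hD : Der p D).
Let Dl : tlinear D. Proof. exact: Der_lin hD. Qed.

Lemma cnorm_pot w : cnorm (pot D) w = ham D w.
Proof.
rewrite cnorm_inv ?[RHS]ham_pot // => -[|x u] //.
case: hD => h1 /(ham_cyclic h1) h2 _.
by rewrite rf_cons !potE // size_rcons -[in RHS]h2 rf_cons !scalerA mulrC.
Qed.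

Lemma star_pot : star (pot D) = pot D.
Proof.
case: hD => h1 h2 h3; apply: tensP => w; rewrite -[LHS]/(sf (pot D) w) sfE !potE // size_ws.
by rewrite -(ham_star h1 h2 h3 w) sfE !scalerA mulrC.
Qed.

Lemma dnorm_pot w : dnorm (pot D) w = ham D w *+ 2.
Proof.
by rewrite /dnorm -[star_fun (pot D)]/(tens_fun (star (pot D))) star_pot cnorm_pot.
Qed.

Lemma pot_homog : homog (p + d + 2) (pot D).
Proof.
case: hD => h1 _ _ w; rewrite potE // scaler_eq0 negb_or => /andP[_].
exact: ham_deg.
Qed.

Lemma pot_small w : (size w < 2)%N -> pot D w = 0.
Proof. by rewrite potE //; case: w => [|x [|//]] _; rewrite ?ham1 scaler0. Qed.
End Derivation.

Lemma ham_comb (a : k) D E w : ham (a *: D + E) w = a *: ham D w + ham E w.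
Proof.
case: (lastP w) => [|u z]; first by rewrite scaler0 addr0.
rewrite !ham_rcons -[(a *: D + E) _]/(a *: D (form z) + E (form z)) tensDE tensZE scalerDr.
by congr (_ + _); rewrite !scalerA mulrC.
Qed.

Hypothesis nondeg : nondegenerate_form V.

(** The norm of the potential is twice [ham D], which determines [D] on the
    elements of [W] given by the form. *)
Lemma pot_inj p D E : Der p D -> Der p E -> lpi (pot D) = lpi (pot E) -> D = E.
Proof.
move=> hD hE /lpi_eq/(dihedral_dnorm char0) h.
have hH w : ham D w = ham E w.
  have : dnorm (pot D) w = dnorm (pot E) w.
    transitivity (dnorm (fun u => (pot D - pot E) u + pot E u) w).
      by apply: dnorm_local erefl => u _; rewrite tensBE subrK.
    by rewrite dnorm_add h add0r.
  rewrite (dnorm_pot hD) (dnorm_pot hE) => /eqP; rewrite -subr_eq0 -mulrnBl -scaler_nat.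
  by rewrite scaler_eq0 (negbTE (natr_neq0 char0 1)) /= subr_eq0 => /eqP.
case: (hD) (hE) => [h1 _ _] [h2 _ _]; apply: (derivation_eq nondeg h1 h2) => z.
apply: tensP => w; have := hH (rcons w z); rewrite !ham_rcons.
exact: ksgn_inj_scale.
Qed.

Variables (m : T -> T) (hm : Der 1 m).

Lemma lpi_derivation (f g : T) : lpi f = lpi g -> lpi (m f) = lpi (m g).
Proof.
move=> /lpi_eq h; apply/lpi_eq; rewrite -(tlinB (Der_lin hm)).
exact: derivation_dihedral hm h.
Qed.

(** Both sides are invariant under the involution, and their sums of rotations
    agree by [ham_bracket] and [cnorm_dsub]. *)
Lemma pot_bracket p D : Der p D -> lpi (pot (bracket 1 p m D)) = lpi (m (pot D)).
Proof.
move=> hD; have hB := Der_bracket hm hD; case: (hm) (hD) => [m1 m2 m3] [D1 D2 _].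
have [hatm hatmP] := hat_exists nondeg m1; have [hatD hatDP] := hat_exists nondeg D1.
have cn w : cnorm (m (pot D)) w = ham (bracket 1 p m D) w.
  rewrite (ham_bracket nondeg D1 m1 D2 m2 hatDP hatmP).
  transitivity (cnorm (dsub 1 hatm (pot D)) w).
    by apply: cnorm_local erefl => u _; exact: derivation_dsub.
  rewrite (cnorm_dsub (proj1 hatmP)); apply: eq_bigr => l _.
  by apply: cnorm_local erefl => u _; rewrite /ins (cnorm_pot hD).
apply/lpi_eq/(dihedral_dnorm char0) => w.
transitivity (dnorm (fun u => pot (bracket 1 p m D) u + (-1) *: m (pot D) u) w).
  by apply: dnorm_local erefl => u _; rewrite scaleN1r tensBE.
rewrite dnorm_add dnorm_scale (dnorm_pot hB) /dnorm -[star_fun (m _)]/(tens_fun (star (m (pot D)))).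
by rewrite -m3 (star_pot hD) !cn scaleN1r subrr.
Qed.

(** The sign compensates for the one that the suspension puts on the
    differential. *)
Definition to_coinv (p : int) (D : T -> T) := ksgn (d * p) *: lpi (pot D).

Lemma to_coinv_chain p D : Der p D ->
  to_coinv (p + 1) (bracket 1 p m D) =
    ksgn (d + 1) *: (ksgn 1 *: lpi (m (lrepr (to_coinv p D)))).
Proof.
move=> hD; rewrite /to_coinv.
have -> : lpi (m (lrepr (ksgn (d * p) *: lpi (pot D)))) = ksgn (d * p) *: lpi (m (pot D)).
  rewrite -[X in _ = X]lpiZ -(tlinZ (Der_lin hm)); apply: lpi_derivation.
  by rewrite lreprK; exact/esym/lpiZ.
rewrite pot_bracket // !scalerA -!ksgnD; congr (_ *: _); signs.
Qed.
End Coinvariants.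

(** ** The derivation with a given potential *)
Section Substitution.
Variables (k : fieldType) (d : int) (V : invSpace k d).
Notation word := (seq (helt V)).
Notation fn := (word -> scalars k).
Notation T := (tens V (scalars k)).
Notation form z := (form_elt (scalars k) z).
Notation ws w := (rev (map (@helt_star k d V) w)).
Implicit Types (F G : fn) (w u v t : word) (x y z : helt V).
Variables (p : int) (hat : word -> helt V).
Notation dsub := (dsub p hat).

Lemma dsub_comb (a : k) F G w : dsub (fun u => a *: F u + G u) w = a *: dsub F w + dsub G w.
Proof.
rewrite !dsub_sum scaler_sumr -big_split; apply: eq_bigr => i _ /=.
rewrite scaler_sumr -big_split; apply: eq_bigr => l _ /=.
by rewrite scalerDr !scalerA [a * _]mulrC.
Qed.

Lemma dsub0 w : dsub (fun=> 0) w = 0.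
Proof.
by rewrite dsub_sum big1 // => i _; rewrite big1 // => l _; rewrite scaler0.
Qed.

Lemma dsub_letter F x w : (forall u, size u != 1%N -> F u = 0) ->
  dsub F (x :: w) = F [:: hat (x :: w)].
Proof.
move=> h; rewrite dsub_cons (bigD1 ord_max) //= take_size drop_size.
rewrite big1 => [|i ni]; last first.
  rewrite h //= eqSS size_drop subn_eq0 -ltnNge ltn_neqAle -ltnS ltn_ord andbT.
  by apply: contra ni => /eqP e; apply/eqP/val_inj.
rewrite addr0 (@dsub_ext _ _ _ _ _ _ (fun=> 0)) ?dsub0 ?scaler0 ?addr0 //.
by case=> // y u _; rewrite h.
Qed.

Lemma dsub_finite w : exists L : seq word,
  forall F, (forall u, u \in L -> F u = 0) -> dsub F w = 0.
Proof.
elim: w => [|x w [L hL]]; first by exists [::].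
exists ([seq hat (x :: take i w) :: drop i w | i <- iota 0 (size w).+1] ++ [seq x :: u | u <- L]).
move=> F h; rewrite dsub_cons hL ?scaler0 ?addr0; last first.
  by move=> u uL; apply: h; rewrite mem_cat map_f ?orbT.
rewrite big1 // => i _; apply: h; rewrite mem_cat; apply/orP; left.
by apply/mapP; exists (nat_of_ord i); rewrite // mem_iota /= add0n.
Qed.

Hypothesis hat_deg : forall v, wdeg1 (hat v) = wdeg v - p.

Lemma dsub_homog q F w : (forall u, wdeg u != q -> F u = 0) -> wdeg w != q + p -> dsub F w = 0.
Proof.
move=> h nw; rewrite dsub_sum big1 // => i _; rewrite big1 // => l _.
rewrite h ?scaler0 //; apply: contra nw => /eqP <-; rewrite wdeg_cat wdeg_cons hat_deg.
have -> : wdeg w = wdeg (take i w) + (wdeg (take l.+1 (drop i w)) + wdeg (drop l.+1 (drop i w))).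
  by rewrite -!wdeg_cat !cat_take_drop.
by apply/eqP; lia.
Qed.

Lemma prod_fun_cons F G x w : prod_fun F G (x :: w) =
  F [::] * G (x :: w) + prod_fun (fun u => F (x :: u)) G w.
Proof. by rewrite /prod_fun big_ord_recl. Qed.

(** The functions may be nonzero on the empty word: in the induction the first
    letter of [F] is fixed, after which the word left to it may be empty. *)
Lemma dsub_prod q F G w : (forall u, wdeg u != q -> F u = 0) ->
  dsub (prod_fun F G) w =
    prod_fun (dsub F) G w + ksgn (p * q) *: prod_fun F (dsub G) w.
Proof.
elim: w q F => [|x w IH] q F hF.
  by rewrite /prod_fun !big_ord1 /= mul0r mulr0 scaler0 addr0.
pose Fx := fun u => F (x :: u).
have hFx u : wdeg u != q - wdeg1 x -> Fx u = 0.
  by move=> h; apply: hF; apply: contra h; rewrite wdeg_cons => /eqP <-; apply/eqP; lia.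
have eF (u : word) : dsub (fun u => prod_fun F G (x :: u)) u =
    F [::] * dsub (fun u => G (x :: u)) u + dsub (prod_fun Fx G) u.
  rewrite -[X in X + _]/((F [::] : k) *: _) -dsub_comb; apply: dsub_ext => u' _.
  exact: prod_fun_cons.
rewrite dsub_cons eF (IH _ _ hFx) !prod_fun_cons [dsub F [::]]/= mul0r add0r.
have -> : prod_fun (fun u => dsub F (x :: u)) G w =
    \sum_(m < (size w).+1) \sum_(i < m.+1)
      F (hat (x :: take i w) :: take (m - i) (drop i w)) * G (drop m w)
    + ksgn (p * wdeg1 x) *: prod_fun (dsub Fx) G w.
  rewrite /prod_fun scaler_sumr -big_split; apply: eq_bigr => m _ /=.
  rewrite size_takel -1?ltnS // mulrDl scalerAl mulr_suml; congr (_ + _).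
  apply: eq_bigr => i _; rewrite take_drop subnK; last by rewrite -ltnS.
  by rewrite take_takel // -ltnS.
(* an insertion inside the first factor: sum over its end [i] and then over the
   number [b] of letters left to the factor *)
pose A i b := F (hat (x :: take i w) :: take b (drop i w)) * G (drop (b + i) w).
have -> : \sum_(m < (size w).+1) \sum_(i < m.+1)
      F (hat (x :: take i w) :: take (m - i) (drop i w)) * G (drop m w) =
    \sum_(i < (size w).+1) \sum_(b < (size w).+1 - i) A i b.
  rewrite -triangle_sum; apply: eq_bigr => m _; apply: eq_bigr => i _.
  by rewrite /A subnK // -ltnS.
have -> : \sum_(i < (size w).+1) prod_fun F G (hat (x :: take i w) :: drop i w) =
    F [::] * (\sum_(i < (size w).+1) G (hat (x :: take i w) :: drop i w))
    + \sum_(i < (size w).+1) \sum_(b < (size w).+1 - i) A i b.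
  rewrite mulr_sumr -big_split; apply: eq_bigr => i _ /=.
  rewrite prod_fun_cons /prod_fun size_drop -subSn -1?ltnS //; congr (_ + _).
  by apply: eq_bigr => b _; rewrite drop_drop.
rewrite dsub_cons.
have -> : ksgn (p * q) *: (F [::] * (\sum_(i < (size w).+1) G (hat (x :: take i w) :: drop i w)
     + ksgn (p * wdeg1 x) *: dsub (fun u => G (x :: u)) w) + prod_fun Fx (dsub G) w) =
   F [::] * (\sum_(i < (size w).+1) G (hat (x :: take i w) :: drop i w)
     + ksgn (p * wdeg1 x) *: dsub (fun u => G (x :: u)) w)
   + ksgn (p * q) *: prod_fun Fx (dsub G) w.
  rewrite scalerDr; congr (_ + _).
  have [<-|/hF ->] := eqVneq (wdeg ([::] : word)) q; last by rewrite mul0r scaler0.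
  by rewrite wdeg_nil mulr0 scale1r.
have e : p * wdeg1 x + p * (q - wdeg1 x) = p * q by rewrite -mulrDr addrCA subrr addr0.
rewrite -e ksgnD !scaleE; ring.
Qed.
End Substitution.

Section Realization.
Variables (k : fieldType) (d : int) (V : invSpace k d).
Notation word := (seq (helt V)).
Notation fn := (word -> scalars k).
Notation rf := (@rot_fun k d V (scalars k)).
Notation sf := (@star_fun k d V (scalars k)).
Notation T := (tens V (scalars k)).
Notation form z := (form_elt (scalars k) z).
Notation ws w := (rev (map (@helt_star k d V) w)).
Implicit Types (F G : fn) (w u v t : word) (x y z : helt V).
Hypothesis nondeg : nondegenerate_form V.

Lemma is_formZ i j (a : k) (x : V i) (y : V j) : is_form (a *: x) y = a * is_form x y.
Proof.
have := is_formDl (-1) (0 : V i) 0 y; rewrite scaler0 addr0 mulN1r addNr => h0.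
by have := is_formDl a x 0 y; rewrite !addr0 h0 addr0.
Qed.

(** The degree is part of an element, so that a combination can only be formed once
    the degrees are identified. *)
Lemma helt_comb (a : k) (e1 e2 e3 : helt V) : tag e1 = tag e3 -> tag e2 = tag e3 ->
  (forall z, hform e3 z = a * hform e1 z + hform e2 z) ->
  exists i (x y : V i), [/\ e1 = hel x, e2 = hel y & e3 = hel (a *: x + y)].
Proof.
case: e1 e2 e3 => i x [j y] [l z] /= e1 e2; subst i j => h.
exists l, x, y; split=> //; apply: (hform_inj nondeg) => // t.
by rewrite h /hform /= is_formDl.
Qed.

Variables (p : int) (h : T).
Hypotheses (hrot : forall w, rf h w = h w) (hstar : forall w, sf h w = h w).
Hypotheses (hdeg : homog (p + d + 2) h) (h1 : forall z, h [:: z] = 0).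

Lemma hat_realize : exists hat : word -> helt V,
  (forall v, wdeg1 (hat v) = wdeg v - p) /\
  (forall v z, hform (hat v) z = ksgn (d * wdeg1 z) *: h (rcons v z)).
Proof.
suff ex v : exists2 e : helt V, wdeg1 e = wdeg v - p &
    forall z, hform e z = ksgn (d * wdeg1 z) *: h (rcons v z).
  pose hat v := projT1 (cid2 (ex v)).
  by exists hat; split=> v; rewrite /hat; case: cid2.
have [|z|e te he] := @representable k d V nondeg (wdeg v - 1 - p - d)
    (fun z => ksgn (d * wdeg1 z) *: h (rcons v z)).
- move=> j a x y; rewrite -!cats1 tens_multilinear scalerDr; congr (_ + _).
  by rewrite -[RHS]/(a *: (_ *: _)) !scalerA mulrC.
- move=> nz; have /hdeg : h (rcons v z) != 0.
    by apply: contraNneq nz => ->; rewrite scaler0.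
  by rewrite wdeg_rcons /wdeg1; lia.
- by exists e => //; rewrite /wdeg1 te; lia.
Qed.

Variable hat : word -> helt V.
Hypothesis hat_deg : forall v, wdeg1 (hat v) = wdeg v - p.
Hypothesis hatE : forall v z, hform (hat v) z = ksgn (d * wdeg1 z) *: h (rcons v z).

Lemma tag_hat v : tag (hat v) = 1 - wdeg v + p.
Proof. by have := hat_deg v; rewrite /wdeg1; lia. Qed.

Lemma hat_mult (F : fn) A B i (a : k) (x y : V i) u v : multilinear F ->
  F (A ++ hat (u ++ hel (a *: x + y) :: v) :: B) =
    a *: F (A ++ hat (u ++ hel x :: v) :: B) + F (A ++ hat (u ++ hel y :: v) :: B).
Proof.
move=> mF.
have [|||j [x' [y' [-> -> ->]]]] := @helt_comb a (hat (u ++ hel x :: v))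
    (hat (u ++ hel y :: v)) (hat (u ++ hel (a *: x + y) :: v)).
- by rewrite !tag_hat (wdeg_same (a *: x + y) x).
- by rewrite !tag_hat (wdeg_same (a *: x + y) y).
- move=> z; rewrite !hatE !rcons_cat !rcons_cons tens_multilinear scalerDr.
  by congr (_ + _); rewrite -[RHS]/(a *: (_ *: _)) !scalerA mulrC.
exact: mF.
Qed.

Lemma dsub_multilinear F : multilinear F -> multilinear (dsub p hat F).
Proof.
move=> mF i a x y u v; elim: u F mF => [|z u IH] F mF.
  rewrite !cat0s !dsub_cons.
  have -> : dsub p hat (fun s => F (hel (a *: x + y) :: s)) v =
      a *: dsub p hat (fun s => F (hel x :: s)) v + dsub p hat (fun s => F (hel y :: s)) v.
    by rewrite -dsub_comb; apply: dsub_ext => s _; exact: (mF i a x y [::] s).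
  rewrite !scalerDr addrACA; congr (_ + (_ + _)); last by rewrite !scalerA mulrC.
  rewrite scaler_sumr -big_split.
  by apply: eq_bigr => j _; exact: (@hat_mult F [::] _ i a x y [::]).
have mFz : multilinear (fun s => F (z :: s)).
  by move=> j b x' y' u' v'; exact: (mF j b x' y' (z :: u') v').
rewrite !cat_cons !dsub_cons (IH _ mFz) !scalerDr scalerA mulrC -scalerA addrACA.
congr (_ + _); rewrite scaler_sumr !size_cat -big_split; apply: eq_bigr => j _ /=.
rewrite !take_cat !drop_cat; case: ltnP => hj.
  exact: (mF i a x y (hat (z :: take j u) :: drop j u) v).
case: (j - size u)%N => [|l]; rewrite ?cats0.
  exact: (mF i a x y [:: hat (z :: u)] v).
rewrite ![take l.+1 _]/= -!cat_cons.
exact: (@hat_mult F [::] _ i a x y (z :: u)).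
Qed.

Definition dmap (f : T) : T :=
  mk_tens (dsub_multilinear (tens_multilinear f)) (erefl : dsub p hat f [::] = 0).

Lemma dmapE f w : dmap f w = dsub p hat f w. Proof. by []. Qed.

Lemma dmap_derivation : is_derivation p dmap.
Proof.
split.
- split=> [f g|r f]; apply: tensP => w; rewrite ?tensDE ?tscaleE !dmapE.
    have := dsub_comb p hat 1 f g w; rewrite scale1r => <-.
    by apply: dsub_ext => u _; rewrite scale1r tensDE.
  have := dsub_comb p hat (r : k) f (fun=> 0) w; rewrite dsub0 addr0 => e.
  by rewrite -[RHS]e; apply: dsub_ext => u _; rewrite addr0.
- apply/tcont_scalars => w; have [L hL] := dsub_finite p hat w; exists L => f hf.
  by rewrite dmapE; exact: hL.
- move=> q f /homogP hf; apply/homogP => w nw; rewrite dmapE.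
  exact: (dsub_homog hat_deg hf).
move=> q f g /homogP hf; apply: tensP => w; rewrite tensDE tensZE.
exact: (@dsub_prod _ _ _ p hat q f g w hf).
Qed.

Lemma ham_dmap w : ham dmap w = h w.
Proof.
case: (lastP w) => [|{}w z]; first by rewrite tens_nil.
rewrite ham_rcons dmapE; case: w => [|x w]; first by rewrite scaler0 h1.
rewrite dsub_letter; last by case=> [|y [|y' u]].
rewrite form_eltE hatE -[_%:A]/(_ * 1) mulr1 -[_ *: h _]/(_ * _) -[LHS]/(_ * (_ * _)).
by rewrite mulrA ksgnK mul1r.
Qed.

Lemma dmap_cyclic : is_cyclic p dmap.
Proof.
apply/(ham_cyclic dmap_derivation) => u.
by rewrite (funext ham_dmap) hrot.
Qed.

(** Up to sign, [hat] commutes with the involution because [h] is invariant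
    under the dihedral group. *)
Lemma hat_star (F : fn) A B v : multilinear F ->
  F (A ++ hat (ws v) :: B) =
    ksgn ((size v)%:Z + 1 + wpairs v) *: F (A ++ helt_star (hat v) :: B).
Proof.
move=> mF; set c := ksgn _.
have e : hat (ws v) = hel (c *: tagged (helt_star (hat v))).
  apply: (hform_inj nondeg) => [|z]; first by rewrite /= !tag_hat wdeg_ws.
  rewrite hatE; transitivity (c * hform (helt_star (hat v)) z); last first.
    exact/esym/is_formZ.
  have -> : hform (helt_star (hat v)) z = hform (hat v) (helt_star z).
    by rewrite -{1}[z]helt_starK /hform is_form_star.
  rewrite hatE -[h (rcons v _)]hstar sfE ws_rcons helt_starK -[h (z :: _)]hrot rf_cons wdeg_ws size_rcons wpairs_rcons.
  rewrite -[RHS]/(_ * (_ * (_ * (_ * _)))) -[LHS]/(_ * _) !mulrA; congr (_ * _).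
  rewrite /c -!ksgnD -addn1 PoszD -[wdeg1 (helt_star z)]/(wdeg1 z); signs.
by rewrite e mlinZ.
Qed.

(** Reversing the word exchanges the letters before and after the subword, which
    reverses the index of the place of the insertion. *)
Lemma dmap_star (f : T) : dmap (star f) = star (dmap f).
Proof.
apply: tensP => w; rewrite -[star (dmap f) w]/(sf (dsub p hat f) w) sfE dmapE !dsub_sum.
rewrite size_ws; pose n := size w; pose X (F : fn) s a l := ksgn (p * wdeg (take a s)) *:
  F (take a s ++ hat (take l.+1 (drop a s)) :: drop l.+1 (drop a s)).
rewrite (triangle_swap n (X (star f) w)) (triangle_swap n (X f (ws w))) scaler_sumr.
apply: eq_bigr => l _; rewrite (reindex_inj rev_ord_inj) scaler_sumr.
apply: eq_bigr => a _ /=; have ltl := ltn_ord l; have lta := ltn_ord a.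
pose b := (n - l - a.+1)%N; rewrite -/b /X.
set u := take b w; set v := take l.+1 (drop b w); set t := drop l.+1 (drop b w).
have st : size t = a by rewrite !size_drop -/n /b; lia.
have sv : size v = l.+1 by rewrite size_takel // size_drop -/n /b; lia.
have wE : w = u ++ v ++ t by rewrite !cat_take_drop.
have -> : ws w = ws t ++ ws v ++ ws u by rewrite {1}wE !ws_cat catA.
rewrite take_size_cat ?drop_size_cat ?take_size_cat ?drop_size_cat ?size_ws //.
rewrite hat_star; last exact: tens_multilinear.
rewrite sfE ws_cat ws_cons cat_rcons !scalerA; congr (_ *: _).
have sgn_cat (u1 u2 : word) : wpairs (u1 ++ u2) = wpairs u1 + wpairs u2 + wdeg u1 * wdeg u2.
  elim: u1 => [|x u1 IH]; first by rewrite wdeg_nil mul0r addr0 add0r.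
  by rewrite cat_cons ![wpairs (_ :: _)]/= IH wdeg_cat wdeg_cons; lia.
rewrite wE !size_cat ![size (_ :: _)]/= !sgn_cat -!ksgnD wdeg_ws.
rewrite ![wpairs (_ :: _)]/= !wdeg_cat wdeg_cons hat_deg -addn1 !PoszD; signs.
Qed.

Lemma dmap_Der : Der_cycl p dmap.
Proof. by split; [exact: dmap_derivation | exact: dmap_cyclic | exact: dmap_star]. Qed.
End Realization.

Section Isomorphism.
Variables (k : fieldType) (char0 : [pchar k] =i pred0) (d : int) (V : invSpace k d).
Notation word := (seq (helt V)).
Notation rf := (@rot_fun k d V (scalars k)).
Notation sf := (@star_fun k d V (scalars k)).
Notation T := (tens V (scalars k)).
Notation lpi := (lpi (@dihedral_pred_submod k d V)).
Notation Der := (@Der_cycl k d V (scalars k)).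
Hypothesis nondeg : nondegenerate_form V.

(** The factor [2^-1] reflects that the norm of a potential is twice [ham]
    ([dnorm_pot]). *)
Lemma dihedral_average (f : T) : exists h : T,
  [/\ forall w, rf h w = h w, forall w, sf h w = h w
    & forall w, h w = 2^-1 *: dnorm f w].
Proof.
pose F i := iter i (@Defs.rot _ _ _ _) f + iter i (@Defs.rot _ _ _ _) (star f).
have FE w : \sum_(i < size w) F i w = dnorm f w.
  rewrite /dnorm /cnorm -big_split; apply: eq_bigr => i _.
  by rewrite /F tensDE !iter_rot_fun.
have mh : multilinear (fun w => 2^-1 *: dnorm f w).
  move=> i a x y u v; rewrite -!FE !size_cat ![size (_ :: _)]/= !scaler_sumr -big_split.
  apply: eq_bigr => j _; rewrite tens_multilinear scalerDr.
  by congr (_ + _); rewrite !scalerA mulrC.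
have h0 : 2^-1 *: dnorm f [::] = 0 by rewrite -FE big_ord0 scaler0.
have rd w : rf (dnorm f) w = dnorm f w.
  have := iter_rotD 1 (cnorm f) (cnorm (sf f)) w; rewrite /= !rot_cnorm; exact.
have sd w : sf (dnorm f) w = dnorm f w.
  rewrite -[LHS]/(sf (fun u => cnorm f u + cnorm (sf f) u) w) sfD !sf_cnorm addrC.
  by rewrite (funext (sfK f)).
exists (mk_tens mh h0); split=> // w.
  rewrite -[RHS]/(2^-1 *: dnorm f w) -rd; exact: (iter_rotZ 1 2^-1 (dnorm f) w).
by rewrite -[RHS]/(2^-1 *: dnorm f w) -sd; exact: (sfZ 2^-1 (dnorm f) w).
Qed.

Lemma dnorm_homog q (f : T) w : homog q f -> wdeg w != q -> dnorm f w = 0.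
Proof.
move=> /homogP hf nw.
have c0 (G : word -> scalars k) : (forall u, wdeg u != q -> G u = 0) -> cnorm G w = 0.
  move=> hG; rewrite /cnorm big1 // => i _; rewrite rot_iter_take; last exact/ltnW/ltn_ord.
  rewrite hG ?scaler0 // wdeg_cat addrC -wdeg_cat cat_take_drop //.
by rewrite /dnorm !c0 ?addr0 // => u nu; rewrite sfE hf ?scaler0 // wdeg_ws.
Qed.

(** Up to sign, [ham D] is half the norm of [f]. *)
Lemma to_coinv_surj p (f : T) : homog (p + d + 2) f ->
  (forall w, (size w < 2)%N -> f w = 0) ->
  exists2 D, Der p D & to_coinv p D = lpi f.
Proof.
move=> hf f0; have [h0 [h0r h0s h0E]] := dihedral_average f.
pose h := ksgn (d * p) *: h0.
have hE w : h w = ksgn (d * p) *: h0 w by exact: tensZE.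
have hr w : rf h w = h w.
  rewrite (_ : tens_fun h = fun u => ksgn (d * p) *: h0 u); last exact/funext.
  by rewrite -[RHS]/(ksgn (d * p) *: h0 w) -[in RHS]h0r; exact: (iter_rotZ 1).
have hs w : sf h w = h w.
  rewrite (_ : tens_fun h = fun u => ksgn (d * p) *: h0 u); last exact/funext.
  by rewrite sfZ h0s.
have hdeg : homog (p + d + 2) h.
  by apply/homogP => w nw; rewrite hE h0E (dnorm_homog hf nw) !scaler0.
have h1 z : h [:: z] = 0.
  have e0 : dnorm f [:: z] = 0.
    by rewrite /dnorm /cnorm !big_ord1 /= sfE !f0 ?scaler0 ?addr0.
  by rewrite hE h0E e0 !scaler0.
have [hat [hat_deg hatE]] := hat_realize nondeg hdeg.
pose D := dmap nondeg hat_deg hatE.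
have hD : Der p D by exact: dmap_Der.
exists D => //; rewrite /to_coinv -[LHS]lpiZ; apply/lpi_eq/(dihedral_dnorm char0) => w.
transitivity (dnorm (fun u => (ksgn (d * p) *: pot D u) + (-1) *: f u) w).
  by apply: dnorm_local erefl => u _; rewrite scaleN1r tensBE tensZE.
rewrite dnorm_add !dnorm_scale (dnorm_pot char0 hD) ham_dmap // hE h0E.
have e : ksgn (d * p) * (2 * (ksgn (d * p) * 2^-1)) = 1 :> k.
  by rewrite mulrCA [ksgn _ * (_ * _)]mulrA ksgnK mul1r mulfV // (natr_neq0 char0 1).
by rewrite -scaler_nat scaleN1r !scalerA -!mulrA e scale1r subrr.
Qed.

Lemma coinv_iso (m : T -> T) : cycl_Ainf m ->
  complex_iso (complex_of (Der_dgLie m)) (susp (d + 1) (CD_ge1 m)).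
Proof.
move=> [hm _]; exists (@to_coinv k d V) => p; split.
- split.
  + move=> D hD /=; exists (ksgn (d * p) *: pot D); split.
    * apply: homogZ; have -> : p + (d + 1) + 1 = p + d + 2 by lia.
      exact: pot_homog hD.
    * by move=> w sw; rewrite tensZE (pot_small hD) // scaler0.
    by rewrite /to_coinv; exact/esym/lpiZ.
  + move=> D E /set_mem hD /set_mem hE h; apply: (pot_inj char0 nondeg hD hE).
    exact: ksgn_inj_scale h.
  move=> c [f [hf f0 ->]].
  have [|D hD e] := @to_coinv_surj p f _ f0; last by exists D.
  by have -> : p + d + 2 = p + (d + 1) + 1 by lia.
- move=> a D E hD hE; rewrite /to_coinv.
  have -> : pot (a *: D + E) = a *: pot D + pot E.
    have hDE : Der p (a *: D + E) := Der_comb a hD hE.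
    apply: tensP => w; rewrite tensDE tensZE !potE ?ham_comb; try exact: Der_lin hE.
    - by rewrite scalerDr !scalerA mulrC.
    - exact: Der_lin hD.
    - exact: Der_lin hDE.
  by rewrite lpiD -[lpi (a *: _)]/(lpi _) lpiZ scalerDr !scalerA mulrC.
move=> D hD; exact: to_coinv_chain.
Qed.
End Isomorphism.

Theorem theorem4p20 (k : fieldType) (char0 : [pchar k] =i pred0)
    (d : int) (V : invSpace k d)
    (m : tens V (scalars k) -> tens V (scalars k)) (hm : cycl_Ainf m) :
  [/\ is_dgLie (Der_dgLie m),
      [/\ is_functor (Def_MC (Der_dgLie m)), is_functor (Def_V m)
        & nat_equiv (Def_MC (Der_dgLie m)) (Def_V m)]
    & nondegenerate_form V ->
        complex_iso (complex_of (Der_dgLie m)) (susp (d + 1) (CD_ge1 m))].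
Proof.
split; first exact: Der_dgLie_is_dgLie.
  exact: functors_equivalent.
by move=> nondeg; exact: coinv_iso.
Qed.
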